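(* Let $\alpha>0$ be fixed, let $\lambda$ be a fourth root of unity, and let $\mu\neq0$ be a measure on $\mathbb{R}$ that is $\alpha$-periodic, i.e. $\delta_\alpha*\mu=\mu$. Then the following are equivalent. (1) $\mu$ is an eigenmeasure of $\mathcal{F}$ with eigenvalue $\lambda$. (2) $\mu$ is a strict eigenmeasure of $\mathcal{F}$ with eigenvalue $\lambda$. (3) $\alpha=\sqrt n$ for some $n\in\mathbb{N}$ and $\mu=\varrho*\delta_{\alpha\mathbb{Z}}$ with $\varrho=\sum_{m=0}^{n-1}c_m\delta_{m/\alpha}$, i.e. $\mu=\sum_{m=0}^{n-1}\sum_{k\in\mathbb{Z}}c_m\,\delta_{m/\sqrt n+k\sqrt n}$, where $c=(c_0,\dots,c_{n-1})^T\in\mathbb{C}^n$ satisfies $U_nc=\lambda c$.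
   Context: All measures are complex Radon measures on $\mathbb{R}$; $\delta_x$ is the unit point mass at $x$, $\delta_A=\sum_{x\in A}\delta_x$, $*$ is convolution. The Fourier transform $\mathcal{F}$ is $\widehat{g}(y)=\int e^{-2\pi ixy}g(x)\,dx$, extended to tempered distributions by duality. A measure is tempered if it defines a tempered distribution; it is transformable if its distributional transform is a measure. A non-trivial tempered measure $\mu$ is an eigenmeasure with eigenvalue $\lambda$ if it is transformable and $\mathcal{F}(\mu)=\lambda\mu$; it is a strict eigenmeasure if it is transformable in the strict sense (there is a measure $\widehat\mu$ with $\check f\in L^1(|\widehat\mu|)$ and $\mu(f)=\widehat\mu(\check f)$ for all $f$ in the span of $\{g*h:g,h\in C_c(\mathbb{R})\}$, $\check f(y)=\widehat f(-y)$) and $\widehat\mu=\lambda\mu$ as measures. $U_n$ is the unitary discrete Fourier matrix with entries $(U_n)_{k\ell}=\omega^{k\ell}/\sqrt n$, $\omega=e^{-2\pi i/n}$, $0\le k,\ell\le n-1$. *)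

(* Defs.v *)
From Stdlib Require Import Reals ZArith.
From Coquelicot Require Import Coquelicot.
Local Open Scope R_scope.

(** Complex Radon measures on R are represented (Bourbaki-style) as
    functionals [mu : (R -> C) -> C], meaningful on C_c(R) (continuous,
    compactly supported complex functions). *)

Definition Cc (f : R -> C) : Prop :=
  (forall x, continuous f x) /\ exists r, forall x, r < Rabs x -> f x = RtoC 0.

Definition fadd (f g : R -> C) : R -> C := fun x => (f x + g x)%C.
Definition fscal (a : C) (f : R -> C) : R -> C := fun x => (a * f x)%C.

Definition is_measure (mu : (R -> C) -> C) : Prop :=
  (forall f g, Cc f -> Cc g -> mu (fadd f g) = (mu f + mu g)%C) /\
  (forall a f, Cc f -> mu (fscal a f) = (a * mu f)%C) /\
  (forall r, exists M, forall f B, Cc f ->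
      (forall x, r < Rabs x -> f x = RtoC 0) ->
      (forall x, Cmod (f x) <= B) -> Cmod (mu f) <= M * B).

Definition nontrivial (mu : (R -> C) -> C) : Prop :=
  exists f, Cc f /\ mu f <> RtoC 0.

(** delta_alpha * mu = mu ; (delta_a * mu)(f) = mu (x |-> f (x + a)) *)
Definition periodic (alpha : R) (mu : (R -> C) -> C) : Prop :=
  forall f, Cc f -> mu (fun x => f (x + alpha)) = mu f.

Fixpoint csum (n : nat) (a : nat -> C) : C :=
  match n with O => RtoC 0 | S m => (csum m a + a m)%C end.
Fixpoint rsum (n : nat) (a : nat -> R) : R :=
  match n with O => 0 | S m => rsum m a + a m end.
Definition zsum (N : nat) (g : Z -> C) : C :=
  csum (2 * N + 1) (fun j => g (Z.of_nat j - Z.of_nat N)%Z).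

Definition smooth (f : R -> C) : Prop :=
  forall k x, ex_derive_n (fun t => Re (f t)) k x /\ ex_derive_n (fun t => Im (f t)) k x.
Definition Dn (f : R -> C) (l : nat) (x : R) : C :=
  (Derive_n (fun t => Re (f t)) l x, Derive_n (fun t => Im (f t)) l x).

Definition schwartz (f : R -> C) : Prop :=
  smooth f /\ forall j l, exists B, forall x, Rabs x ^ j * Cmod (Dn f l x) <= B.
Definition test_fun (f : R -> C) : Prop :=
  smooth f /\ exists r, forall x, r < Rabs x -> f x = RtoC 0.

(** T is a tempered distribution (continuous C-linear functional on S(R),
    continuity expressed through the Schwartz seminorms
    sup |x^j f^(l)(x)|) that coincides with the distribution of mu on C_c^oo. *)
Definition tempered_extension (mu T : (R -> C) -> C) : Prop :=
  (forall f g, schwartz f -> schwartz g -> T (fadd f g) = (T f + T g)%C) /\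
  (forall a f, schwartz f -> T (fscal a f) = (a * T f)%C) /\
  (exists (N : nat) (K : R), forall f (B : nat -> nat -> R), schwartz f ->
      (forall j l x, (j <= N)%nat -> (l <= N)%nat ->
          Rabs x ^ j * Cmod (Dn f l x) <= B j l) ->
      Cmod (T f) <= K * rsum (S N) (fun j => rsum (S N) (fun l => B j l))) /\
  (forall f, test_fun f -> T f = mu f).

Definition tempered (mu : (R -> C) -> C) : Prop :=
  exists T, tempered_extension mu T.

(** Lebesgue integral over R (improper integral) of a complex function *)
Definition integral (f : R -> C) : C :=
  @RInt_gen C_R_CompleteNormedModule f (Rbar_locally m_infty) (Rbar_locally p_infty).

Definition cexpi (t : R) : C := (cos t, sin t).

Definition fourier (f : R -> C) : R -> C :=
  fun y => integral (fun x => Cmult (f x) (cexpi (- 2 * PI * x * y))).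
Definition fcheck (f : R -> C) : R -> C := fun y => fourier f (- y).

Definition eigenmeasure (mu : (R -> C) -> C) (lam : C) : Prop :=
  is_measure mu /\ nontrivial mu /\
  exists T, tempered_extension mu T /\
    forall f, schwartz f -> T (fourier f) = (lam * T f)%C.

Definition conv (g h : R -> C) : R -> C :=
  fun x => integral (fun y => Cmult (g (x - y)) (h y)).
Definition in_span_conv (f : R -> C) : Prop :=
  exists (n : nat) (a : nat -> C) (g h : nat -> R -> C),
    (forall i, Cc (g i) /\ Cc (h i)) /\
    forall x, f x = csum n (fun i => (a i * conv (g i) (h i) x)%C).

(** For a continuous F: F in L^1(|nu|) iff the upper integral of |F| w.r.t.
    |nu| is finite, i.e. sup { |nu h| : h in C_c, |h| <= |F| } < oo. *)
Definition integrable_wrt (nu : (R -> C) -> C) (F : R -> C) : Prop :=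
  (forall x, continuous F x) /\
  exists M, forall h, Cc h -> (forall x, Cmod (h x) <= Cmod (F x)) -> Cmod (nu h) <= M.

Definition cutoff (r x : R) : R := Rmax 0 (Rmin 1 (r + 1 - Rabs x)).

(** nu(F) = v for integrable F, computed by dominated convergence *)
Definition integral_wrt_is (nu : (R -> C) -> C) (F : R -> C) (v : C) : Prop :=
  filterlim (fun r : nat => nu (fun x => Cmult (RtoC (cutoff (INR r) x)) (F x)))
    eventually (locally v).

Definition strict_transform (mu nu : (R -> C) -> C) : Prop :=
  is_measure nu /\
  forall f, in_span_conv f ->
    integrable_wrt nu (fcheck f) /\ integral_wrt_is nu (fcheck f) (mu f).

Definition strict_eigenmeasure (mu : (R -> C) -> C) (lam : C) : Prop :=
  is_measure mu /\ nontrivial mu /\ tempered mu /\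
  exists nu, strict_transform mu nu /\
    forall g, Cc g -> nu g = (lam * mu g)%C.

Definition dft_entry (n k l : nat) : C :=
  Cmult (cexpi (- 2 * PI * INR k * INR l / INR n)) (RtoC (/ sqrt (INR n))).
Definition dft_eigvec (n : nat) (c : nat -> C) (lam : C) : Prop :=
  forall k, (k < n)%nat -> csum n (fun l => (dft_entry n k l * c l)%C) = (lam * c k)%C.

Definition comb_form (alpha : R) (mu : (R -> C) -> C) (lam : C) : Prop :=
  exists n : nat, alpha = sqrt (INR n) /\
  exists c : nat -> C, dft_eigvec n c lam /\
    forall f, Cc f ->
      filterlim (fun N : nat =>
          csum n (fun m => Cmult (c m) (zsum N (fun k => f (INR m / alpha + IZR k * alpha)))))
        eventually (locally (mu f)).

(* Main.v *)
Require Import Defs.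
From Stdlib Require Import Reals ZArith Lia Lra Classical FunctionalExtensionality.
From Coquelicot Require Import Coquelicot.
Open Scope R_scope.

(** An [alpha]-periodic measure lives on the circle R/(alpha Z), so it has Fourier coefficients m_j.
    For a compactly supported [f] whose transform decays, summing [f^] over the translates by [alpha]
    and applying Poisson summation shows that [mu] integrates [f^] to (1/alpha) sum_j m_j f(j/alpha).
    Either eigenvalue equation therefore expresses [mu], first on convolutions of C_c functions with
    smooth bumps and by density on C_c, as a sum of point masses on (1/alpha)Z; periodicity of a
    nonzero atom forces alpha^2 to be an integer n, and comparing masses gives the eigenvector equation.
    Conversely, for a measure on (1/alpha)Z with n-periodic masses, the eigenvector equation turns
    Poisson summation into the eigenvalue equation. Poisson summation comes from Fejer means: they
    converge to the lattice sum for every [f] in C_c, so it is enough that the symmetric sums of the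
    transform converge. For convolutions g*h of merely continuous functions this follows from Bessel's
    inequality, itself a consequence of the boundedness of the Fejer means of g * conj(g(-.)). *)

(** * Limits and finite sums of complex numbers *)

(** [mu] acts on C_c only, while the transform of a compactly supported function is not compactly
    supported. Both eigenvalue equations are therefore evaluated along cutoffs: smooth ones for the
    tempered extension, whose continuity fixes its values on Schwartz functions, and the piecewise
    linear [cutoff] of the strict definition. This is why the periodic computation is made for an
    arbitrary family [theta]. The two notions do not yield the same finite system: the strict one
    puts [lam] on the other side and carries the conjugate kernel, so discrete Fourier inversion has
    to link them. In the converse direction, passing from test functions to Schwartz functions needs
    an error that is small in f and in its transform at once. Both are measured against the weight
    1/(1 + x^2), because sums over a lattice are bounded in that norm; the smooth cutoffs must then
    have derivatives bounded uniformly in the radius. *)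

Ltac ceq := apply injective_projections; cbn [fst snd Cmult Cplus Copp Cminus RtoC Re Im cexpi Cconj Ci]; try ring.

Definition clim (u : nat -> C) (l : C) :=
  forall eps, 0 < eps -> exists N, forall n, (N <= n)%nat -> Cmod (u n - l) < eps.

Lemma Cmod_le_Re_Im z : Cmod z <= Rabs (Re z) + Rabs (Im z).
Proof.
  destruct z as [a b]. replace (Cmod (a, b)) with (Cmod (RtoC a + RtoC b * Ci)%C) by (f_equal; ceq).
  eapply Rle_trans; [apply Cmod_triangle|].
  rewrite Cmod_mult, Cmod_Ci, !Cmod_R. 
  unfold Re, Im; simpl. rewrite Rmult_1_r.
  apply Rplus_le_compat; right; f_equal; ring.
Qed.

Lemma im_le_Cmod z : Rabs (Im z) <= Cmod z.
Proof. eapply Rle_trans; [|apply Rmax_Cmod]. apply Rmax_r. Qed.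

(** A ball of the product structure on C lies in a disc larger by at most the factor sqrt 2, which
    the radius [eps / sqrt 2] compensates. *)
Lemma clim_filterlim u l : clim u l <-> filterlim u eventually (locally l).
Proof.
  rewrite (filterlim_locally (U := C_UniformSpace)). split.
  - intros H eps. destruct (H eps (cond_pos eps)) as [N HN]. exists N. intros n Hn.
    apply C_NormedModule_mixin_compat1. apply (HN n Hn).
  - intros H eps Heps. assert (Hs : 0 < sqrt 2) by (apply sqrt_lt_R0; lra).
    destruct (H (mkposreal (eps / sqrt 2) (Rdiv_lt_0_compat _ _ Heps Hs))) as [N HN].
    exists N. intros n Hn. specialize (HN n Hn).
    apply C_NormedModule_mixin_compat2 in HN. simpl in HN.
    replace (sqrt 2 * (eps / sqrt 2)) with eps in HN by (field; lra). exact HN.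
Qed.

Lemma Cmod_arbitrarily_small z : (forall eps, 0 < eps -> Cmod z <= eps) -> z = RtoC 0.
Proof.
  intros H. apply Cmod_eq_0. destruct (Rle_lt_or_eq_dec 0 (Cmod z) (Cmod_ge_0 z)); [|easy].
  specialize (H (Cmod z / 2)). lra.
Qed.

Lemma clim_unique u l1 l2 : clim u l1 -> clim u l2 -> l1 = l2.
Proof.
  intros H1 H2. rewrite clim_filterlim in H1, H2.
  exact (filterlim_locally_unique (V := C_R_NormedModule) u l1 l2 H1 H2).
Qed.

Lemma clim_const l : clim (fun _ => l) l.
Proof. intros e He. exists 0%nat. intros. replace (l - l)%C with (RtoC 0) by ring. now rewrite Cmod_0. Qed.

Lemma clim_eventually u v l K : (forall n, (K <= n)%nat -> u n = v n) -> clim u l -> clim v l.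
Proof.
  intros E H e He. destruct (H e He) as [N HN]. exists (N + K)%nat. intros n Hn.
  rewrite <- E by lia. apply HN. lia.
Qed.

Lemma clim_plus u v a b : clim u a -> clim v b -> clim (fun n => u n + v n)%C (a + b)%C.
Proof.
  intros H1 H2 e He. destruct (H1 (e/2)) as [N1 H1']; [lra|]. destruct (H2 (e/2)) as [N2 H2']; [lra|].
  exists (N1 + N2)%nat. intros n Hn. specialize (H1' n ltac:(lia)). specialize (H2' n ltac:(lia)).
  replace (u n + v n - (a + b))%C with ((u n - a) + (v n - b))%C by ring.
  eapply Rle_lt_trans; [apply Cmod_triangle|]. lra.
Qed.

Lemma clim_scal c u a : clim u a -> clim (fun n => c * u n)%C (c * a)%C.
Proof.
  intros H e He. pose proof (Cmod_ge_0 c).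
  destruct (H (e / (Cmod c + 1))) as [N HN]. { apply Rdiv_lt_0_compat; lra. }
  exists N. intros n Hn. specialize (HN n Hn).
  replace (c * u n - c * a)%C with (c * (u n - a))%C by ring. rewrite Cmod_mult.
  apply Rle_lt_trans with (Cmod c * (e / (Cmod c + 1))).
  - apply Rmult_le_compat_l; lra.
  - apply Rlt_le_trans with ((Cmod c + 1) * (e / (Cmod c + 1))); [|right; field; lra].
    apply Rmult_lt_compat_r; [apply Rdiv_lt_0_compat; lra|lra].
Qed.

Lemma clim_bound u l M : (forall n, Cmod (u n) <= M) -> clim u l -> Cmod l <= M.
Proof.
  intros B H. apply le_epsilon. intros e He. destruct (H e He) as [N HN].
  specialize (HN N (Nat.le_refl _)). specialize (B N).
  replace l with (u N - (u N - l))%C by ring.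
  eapply Rle_trans; [apply Cmod_triangle|]. rewrite Cmod_opp. lra.
Qed.

Lemma clim_0_of_bound u b : (forall n, Cmod (u n) <= b n) -> is_lim_seq b 0 -> clim u (RtoC 0).
Proof.
  intros B H e He. apply is_lim_seq_spec in H. destruct (H (mkposreal e He)) as [N HN].
  exists N. intros n Hn. specialize (HN n Hn). simpl in HN. rewrite Rminus_0_r in HN.
  replace (u n - RtoC 0)%C with (u n) by ring. eapply Rle_lt_trans; [apply B|].
  eapply Rle_lt_trans; [apply Rle_abs|]. exact HN.
Qed.

Lemma clim_diff u l : clim u l <-> clim (fun n => u n - l)%C (RtoC 0).
Proof.
  split; intros H e He; destruct (H e He) as [N HN]; exists N; intros n Hn; specialize (HN n Hn);
  [replace (u n - l - RtoC 0)%C with (u n - l)%C by ring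
  |replace (u n - l - RtoC 0)%C with (u n - l)%C in HN by ring]; exact HN.
Qed.

Lemma clim_components u l :
  is_lim_seq (fun n => Re (u n)) (Re l) -> is_lim_seq (fun n => Im (u n)) (Im l) -> clim u l.
Proof.
  intros H1 H2 e He. apply is_lim_seq_spec in H1. apply is_lim_seq_spec in H2.
  assert (He2 : 0 < e / 2) by lra.
  destruct (H1 (mkposreal _ He2)) as [N1 H1']. destruct (H2 (mkposreal _ He2)) as [N2 H2'].
  exists (N1 + N2)%nat. intros n Hn. specialize (H1' n ltac:(lia)). specialize (H2' n ltac:(lia)).
  eapply Rle_lt_trans; [apply Cmod_le_Re_Im|].
  change (Re (u n - l)%C) with (Re (u n) - Re l). change (Im (u n - l)%C) with (Im (u n) - Im l).
  cbn [pos] in H1', H2'. lra.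
Qed.

Lemma clim_Re u l : clim u l -> is_lim_seq (fun n => Re (u n)) (Re l).
Proof.
  intros H. apply is_lim_seq_spec. intros [e He]. destruct (H e He) as [N HN]. exists N. intros n Hn.
  simpl. eapply Rle_lt_trans; [apply (re_le_Cmod (u n - l)%C)|]. now apply HN.
Qed.

Lemma clim_Im u l : clim u l -> is_lim_seq (fun n => Im (u n)) (Im l).
Proof.
  intros H. apply is_lim_seq_spec. intros [e He]. destruct (H e He) as [N HN]. exists N. intros n Hn.
  simpl. eapply Rle_lt_trans; [apply (im_le_Cmod (u n - l)%C)|]. now apply HN.
Qed.

(** Completeness is used for the two real components; the rate [b] survives the passage to the limit
    in the second index. *)
Lemma clim_cauchy (u : nat -> C) (b : nat -> R) : is_lim_seq b 0 ->
  (forall n m, (n <= m)%nat -> Cmod (u m - u n) <= b n) ->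
  exists l, clim u l /\ forall n, Cmod (l - u n) <= b n.
Proof.
  intros Hb H.
  assert (Hc : forall (p : C -> R), (forall z, Rabs (p z) <= Cmod z) -> (forall z w, p (z - w)%C = p z - p w) ->
     ex_finite_lim_seq (fun n => p (u n))).
  { intros p Hp Hm. apply ex_lim_seq_cauchy_corr. intros eps.
    apply is_lim_seq_spec in Hb. destruct (Hb (pos_div_2 eps)) as [N HN].
    exists N. intros n m Hn Hm'. rewrite <- Hm.
    assert (HbN := HN N (Nat.le_refl _)). rewrite Rminus_0_r in HbN. simpl in HbN.
    replace (u n - u m)%C with ((u n - u N) - (u m - u N))%C by ring.
    rewrite Hm. eapply Rle_lt_trans; [apply Rabs_triang|]. rewrite Rabs_Ropp.
    pose proof (Hp (u n - u N)%C). pose proof (Hp (u m - u N)%C).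
    pose proof (H N n ltac:(lia)). pose proof (H N m ltac:(lia)).
    pose proof (Rle_abs (b N)). lra. }
  destruct (Hc Re) as [lr Hr]; [apply re_le_Cmod|reflexivity|].
  destruct (Hc Im) as [li Hi]; [apply im_le_Cmod|reflexivity|].
  exists (lr, li). assert (Hl : clim u (lr, li)) by (apply clim_components; assumption).
  split; [exact Hl|]. intros n.
  apply le_epsilon. intros e He. destruct (Hl e He) as [N HN].
  specialize (HN (N + n)%nat ltac:(lia)). specialize (H n (N + n)%nat ltac:(lia)).
  replace ((lr, li) - u n)%C with ((u (N + n)%nat - u n) - (u (N + n)%nat - (lr, li)))%C by ring.
  eapply Rle_trans; [apply Cmod_triangle|]. rewrite Cmod_opp. lra.
Qed.

Lemma csum_ext n a b : (forall i, (i < n)%nat -> a i = b i) -> csum n a = csum n b.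
Proof. induction n; intros H; simpl; [easy|]. rewrite IHn by (intros; apply H; lia). now rewrite H by lia. Qed.

Lemma csum_plus n a b : csum n (fun i => a i + b i)%C = (csum n a + csum n b)%C.
Proof. induction n; simpl; [ceq|]. rewrite IHn. ring. Qed.

Lemma csum_scal n c a : csum n (fun i => c * a i)%C = (c * csum n a)%C.
Proof. induction n; simpl; [ceq|]. rewrite IHn. ring. Qed.

Lemma csum_0 n a : (forall i, (i < n)%nat -> a i = RtoC 0) -> csum n a = RtoC 0.
Proof. induction n; intros H; simpl; [easy|]. rewrite IHn by (intros; apply H; lia). rewrite H by lia. ceq. Qed.

Lemma csum_split n m a : csum (n + m) a = (csum n a + csum m (fun i => a (n + i)%nat))%C.
Proof.
  induction m; simpl. { rewrite Nat.add_0_r. ring. }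
  rewrite Nat.add_succ_r. simpl. rewrite IHm. ring.
Qed.

Lemma csum_S_first n a : csum (S n) a = (a 0%nat + csum n (fun i => a (S i)))%C.
Proof. replace (S n) with (1 + n)%nat by lia. rewrite csum_split. simpl. ring. Qed.

Lemma csum_exchange n m (a : nat -> nat -> C) :
  csum n (fun i => csum m (a i)) = csum m (fun j => csum n (fun i => a i j)).
Proof.
  induction n; simpl. { symmetry. now apply csum_0. }
  now rewrite IHn, <- csum_plus.
Qed.

Lemma csum_single n j a : (j < n)%nat -> (forall i, (i < n)%nat -> i <> j -> a i = RtoC 0) -> csum n a = a j.
Proof.
  intros Hj H. replace n with (j + S (n - S j))%nat by lia. rewrite csum_split.
  rewrite csum_0 by (intros; apply H; lia). rewrite csum_S_first.
  rewrite (csum_0 (n - S j)) by (intros; apply H; lia). rewrite Nat.add_0_r. ring.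
Qed.

Lemma rsum_ext n a b : (forall i, (i < n)%nat -> a i = b i) -> rsum n a = rsum n b.
Proof. induction n; intros H; simpl; [easy|]. rewrite IHn by (intros; apply H; lia). now rewrite H by lia. Qed.

Lemma rsum_ge_0 n a : (forall i, (i < n)%nat -> 0 <= a i) -> 0 <= rsum n a.
Proof.
  induction n; intros H; simpl; [lra|]. apply Rplus_le_le_0_compat; [apply IHn; intros; apply H; lia|apply H; lia].
Qed.

Lemma rsum_ge_term n a i : (forall i, (i < n)%nat -> 0 <= a i) -> (i < n)%nat -> a i <= rsum n a.
Proof.
  induction n; intros H Hi; [lia|]. simpl. destruct (Nat.eq_dec i n) as [->|].
  - pose proof (rsum_ge_0 n a ltac:(intros; apply H; lia)). lra.
  - pose proof (IHn ltac:(intros; apply H; lia) ltac:(lia)). pose proof (H n ltac:(lia)). lra.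
Qed.

Lemma rsum_plus n a b : rsum n (fun i => a i + b i) = rsum n a + rsum n b.
Proof. induction n; simpl; [ring|]. rewrite IHn. ring. Qed.

Lemma rsum_scal n c a : rsum n (fun i => c * a i) = c * rsum n a.
Proof. induction n; simpl; [ring|]. rewrite IHn. ring. Qed.

Lemma rsum_const n c : rsum n (fun _ => c) = INR n * c.
Proof. induction n; [simpl; ring|]. rewrite S_INR. simpl rsum. rewrite IHn. ring. Qed.

Lemma csum_bound n a b : (forall i, (i < n)%nat -> Cmod (a i) <= b i) -> Cmod (csum n a) <= rsum n b.
Proof.
  induction n; intros H; simpl. { rewrite Cmod_0. lra. }
  eapply Rle_trans; [apply Cmod_triangle|]. apply Rplus_le_compat; [apply IHn; intros; apply H; lia|apply H; lia].
Qed.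

(** * Symmetric sums over the integers *)

Definition zrsum (N : nat) (g : Z -> R) : R :=
  rsum (2 * N + 1) (fun j => g (Z.of_nat j - Z.of_nat N)%Z).

Lemma rsum_S_first n a : rsum (S n) a = (a 0%nat + rsum n (fun i => a (S i))).
Proof. induction n; simpl in *; [ring|]. rewrite IHn. ring. Qed.

Lemma zsum_0 g : zsum 0 g = g 0%Z.
Proof. unfold zsum. simpl. ceq. Qed.

Lemma zsum_S N g : zsum (S N) g = (zsum N g + (g (- Z.of_nat (S N))%Z + g (Z.of_nat (S N))))%C.
Proof.
  unfold zsum. replace (2 * S N + 1)%nat with (S (S (2 * N + 1))) by lia.
  rewrite csum_S_first. cbn [csum].
  rewrite (csum_ext _ _ (fun j => g (Z.of_nat j - Z.of_nat N)%Z)) by (intros; f_equal; lia).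
  replace (Z.of_nat 0 - Z.of_nat (S N))%Z with (- Z.of_nat (S N))%Z by lia.
  replace (Z.of_nat (S (2 * N + 1)) - Z.of_nat (S N))%Z with (Z.of_nat (S N)) by lia. ring.
Qed.

Lemma zrsum_0 g : zrsum 0 g = g 0%Z.
Proof. unfold zrsum. simpl. ring. Qed.

Lemma zrsum_S N g : zrsum (S N) g = zrsum N g + (g (- Z.of_nat (S N))%Z + g (Z.of_nat (S N))).
Proof.
  unfold zrsum. replace (2 * S N + 1)%nat with (S (S (2 * N + 1))) by lia.
  rewrite rsum_S_first. cbn [rsum].
  rewrite (rsum_ext _ _ (fun j => g (Z.of_nat j - Z.of_nat N)%Z)) by (intros; f_equal; lia).
  replace (Z.of_nat 0 - Z.of_nat (S N))%Z with (- Z.of_nat (S N))%Z by lia.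
  replace (Z.of_nat (S (2 * N + 1)) - Z.of_nat (S N))%Z with (Z.of_nat (S N)) by lia. ring.
Qed.

Lemma zsum_ext N g h : (forall k, (Z.abs k <= Z.of_nat N)%Z -> g k = h k) -> zsum N g = zsum N h.
Proof. intros H. apply csum_ext. intros. apply H. lia. Qed.

Lemma zsum_plus N g h : zsum N (fun k => g k + h k)%C = (zsum N g + zsum N h)%C.
Proof. apply csum_plus. Qed.

Lemma zsum_scal N c g : zsum N (fun k => c * g k)%C = (c * zsum N g)%C.
Proof. apply csum_scal. Qed.

Lemma zsum_opp N g : zsum N (fun k => g (- k)%Z) = zsum N g.
Proof.
  induction N. { now rewrite !zsum_0. }
  rewrite !zsum_S, IHN. rewrite Z.opp_involutive. ring.
Qed.

Lemma zsum_csum N n (g : Z -> nat -> C) :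
  zsum N (fun k => csum n (g k)) = csum n (fun i => zsum N (fun k => g k i)).
Proof. apply csum_exchange. Qed.

Lemma zsum_bound N g b : (forall k, (Z.abs k <= Z.of_nat N)%Z -> Cmod (g k) <= b k) -> Cmod (zsum N g) <= zrsum N b.
Proof. intros H. apply csum_bound. intros. apply H. lia. Qed.

Lemma zrsum_ge_0 N a : (forall k, 0 <= a k) -> 0 <= zrsum N a.
Proof. intros H. apply rsum_ge_0. intros. apply H. Qed.

Lemma zrsum_mono N M a : (forall k, 0 <= a k) -> (N <= M)%nat -> zrsum N a <= zrsum M a.
Proof.
  intros H. induction 1; [lra|]. rewrite zrsum_S. pose proof (H (- Z.of_nat (S m))%Z). pose proof (H (Z.of_nat (S m))). lra.
Qed.

Lemma zrsum_plus N a b : zrsum N (fun k => a k + b k) = zrsum N a + zrsum N b.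
Proof. apply rsum_plus. Qed.

Lemma zrsum_scal N c a : zrsum N (fun k => c * a k) = c * zrsum N a.
Proof. apply rsum_scal. Qed.

Lemma zsum_stable N M g : (forall k, (Z.of_nat N < Z.abs k)%Z -> g k = RtoC 0) -> (N <= M)%nat -> zsum M g = zsum N g.
Proof. intros H. induction 1; [easy|]. rewrite zsum_S, IHle, !H by lia. ceq. Qed.

(** Discrete dominated convergence: weights that are 1 on the central block alter only the outer
    terms, so the tail of the majorant bounds the error whatever the weights are. Constant weights 1
    give the plain tail estimate. *)
Lemma zsum_cut_tail K N (a : Z -> C) (th : Z -> R) (b : Z -> R) : (K <= N)%nat ->
  (forall k, Cmod (a k) <= b k) -> (forall k, 0 <= th k <= 1) -> (forall k, (Z.abs k <= Z.of_nat K)%Z -> th k = 1) ->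
  Cmod (zsum N (fun k => RtoC (th k) * a k)%C - zsum K a) <= zrsum N b - zrsum K b.
Proof.
  intros HKN Ha Ht H1. induction HKN as [|N HKN IH].
  - rewrite (zsum_ext K _ a).
    + replace (zsum K a - zsum K a)%C with (RtoC 0) by ring. rewrite Cmod_0. lra.
    + intros k Hk. rewrite H1 by easy. ring.
  - rewrite zsum_S, zrsum_S.
    assert (G : forall k, Cmod (RtoC (th k) * a k) <= b k).
    { intros k. rewrite Cmod_mult, Cmod_R. destruct (Ht k). rewrite Rabs_right by lra.
      pose proof (Cmod_ge_0 (a k)). pose proof (Ha k). nra. }
    match goal with |- Cmod (?p + (?q + ?r) - ?s)%C <= _ => replace (p + (q + r) - s)%C with ((p - s) + (q + r))%C by ring end.
    eapply Rle_trans; [apply Cmod_triangle|].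
    eapply Rle_trans; [apply Rplus_le_compat; [exact IH|apply Cmod_triangle]|].
    pose proof (G (- Z.of_nat (S N))%Z). pose proof (G (Z.of_nat (S N))). lra.
Qed.

(** * Compactly supported functions and their integrals *)

Definition ccont (f : R -> C) := forall x, continuous f x.

Lemma ccont_iff f : ccont f <-> (forall x, continuous (fun t => Re (f t)) x) /\ (forall x, continuous (fun t => Im (f t)) x).
Proof.
  split.
  - intros H. split; intros x; apply (continuous_comp f); try apply H.
    + apply (continuous_fst (U := R_UniformSpace) (V := R_UniformSpace) (fst (f x)) (snd (f x))).
    + apply (continuous_snd (U := R_UniformSpace) (V := R_UniformSpace) (fst (f x)) (snd (f x))).
  - intros [H1 H2] x. apply (continuous_ext (fun t => (Re (f t), Im (f t)))).
    { intros; symmetry; apply surjective_pairing. }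
    apply (continuous_comp_2 (U:=R_UniformSpace) (V:=R_UniformSpace) (W:=R_UniformSpace) (X:=C_UniformSpace)
      (fun t => Re (f t)) (fun t => Im (f t)) (fun a b => (a, b))); auto.
    apply (continuous_ext (fun x => x)); [intros []; reflexivity|apply continuous_id].
Qed.

Lemma ccont_ext f g : (forall x, f x = g x) -> ccont f -> ccont g.
Proof. intros E H x. now apply (continuous_ext f). Qed.

Lemma rcont_mult (f g : R -> R) x : continuous f x -> continuous g x -> continuous (fun t => f t * g t) x.
Proof. apply (continuous_mult (K := R_AbsRing)). Qed.
Lemma rcont_plus (f g : R -> R) x : continuous f x -> continuous g x -> continuous (fun t => f t + g t) x.
Proof. apply (continuous_plus (V := R_NormedModule)). Qed.
Lemma rcont_minus (f g : R -> R) x : continuous f x -> continuous g x -> continuous (fun t => f t - g t) x.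
Proof. apply (continuous_minus (V := R_NormedModule)). Qed.
Lemma rcont_opp (f : R -> R) x : continuous f x -> continuous (fun t => - f t) x.
Proof. apply (continuous_opp (V := R_NormedModule)). Qed.

Lemma ccont_const c : ccont (fun _ => c).
Proof. intros x. apply continuous_const. Qed.

Lemma ccont_RtoC (f : R -> R) : (forall x, continuous f x) -> ccont (fun x => RtoC (f x)).
Proof. intros H. apply ccont_iff. split; [exact H|intros; apply continuous_const]. Qed.

Lemma ccont_plus f g : ccont f -> ccont g -> ccont (fun x => f x + g x)%C.
Proof.
  rewrite !ccont_iff. intros [H1 H2] [H3 H4].
  split; intros x; [apply (rcont_plus (fun t => Re (f t)) (fun t => Re (g t)))
   |apply (rcont_plus (fun t => Im (f t)) (fun t => Im (g t)))]; auto.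
Qed.

Lemma ccont_mult f g : ccont f -> ccont g -> ccont (fun x => f x * g x)%C.
Proof.
  rewrite !ccont_iff. intros [H1 H2] [H3 H4]. split; intros x.
  - apply (rcont_minus (fun t => Re (f t) * Re (g t)) (fun t => Im (f t) * Im (g t))); apply rcont_mult; auto.
  - apply (rcont_plus (fun t => Re (f t) * Im (g t)) (fun t => Im (f t) * Re (g t))); apply rcont_mult; auto.
Qed.

Lemma ccont_conj f : ccont f -> ccont (fun x => Cconj (f x)).
Proof.
  rewrite !ccont_iff. intros [H1 H2]. split; intros x; [apply H1|].
  apply (rcont_opp (fun t => Im (f t))); auto.
Qed.

Lemma ccont_comp f (g : R -> R) : ccont f -> (forall x, continuous g x) -> ccont (fun x => f (g x)).
Proof. intros H G x. apply (continuous_comp g f); auto. Qed.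

Lemma rcont_lin a b x : continuous (fun x => a * x + b) x.
Proof. apply rcont_plus; [apply rcont_mult; [apply continuous_const|apply continuous_id]|apply continuous_const]. Qed.

Lemma ccont_lin f a b : ccont f -> ccont (fun x => f (a * x + b)).
Proof. intros H. apply ccont_comp; [exact H|]. intros; apply rcont_lin. Qed.

Lemma ccont_shift f a : ccont f -> ccont (fun x => f (x + a)).
Proof. intros H. apply (ccont_ext (fun x => f (1 * x + a))); [intros; f_equal; ring|]. now apply ccont_lin. Qed.

Lemma ccont_opp_arg f : ccont f -> ccont (fun x => f (- x)).
Proof. intros H. apply (ccont_ext (fun x => f (-1 * x + 0))); [intros; f_equal; ring|]. now apply ccont_lin. Qed.

Lemma ccont_cexpi : ccont cexpi.
Proof. apply ccont_iff. split; intros x; [apply continuous_cos|apply continuous_sin]. Qed.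

Lemma ccont_cexpi_lin a : ccont (fun x => cexpi (a * x)).
Proof. apply (ccont_ext (fun x => cexpi (a * x + 0))); [intros; f_equal; ring|]. apply ccont_lin, ccont_cexpi. Qed.

Lemma ccont_csum n (F : nat -> R -> C) : (forall i, (i < n)%nat -> ccont (F i)) -> ccont (fun x => csum n (fun i => F i x)).
Proof.
  induction n; intros H; simpl; [apply ccont_const|]. apply ccont_plus; [apply IHn; intros; apply H; lia|apply H; lia].
Qed.

Lemma Cmod_cexpi t : Cmod (cexpi t) = 1.
Proof. unfold Cmod, cexpi. simpl. rewrite !Rmult_1_r. rewrite <- sqrt_1. f_equal. pose proof (sin2_cos2 t). unfold Rsqr in *. lra. Qed.

Lemma cexpi_plus a b : cexpi (a + b) = (cexpi a * cexpi b)%C.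
Proof. ceq; rewrite ?cos_plus, ?sin_plus; ring. Qed.

Lemma cexpi_0 : cexpi 0 = RtoC 1.
Proof. unfold cexpi. now rewrite cos_0, sin_0. Qed.

Lemma cexpi_2PI_nat n : cexpi (2 * PI * INR n) = RtoC 1.
Proof.
  unfold cexpi. replace (2 * PI * INR n) with (0 + 2 * INR n * PI) by ring.
  now rewrite cos_period, sin_period, cos_0, sin_0.
Qed.

Lemma cexpi_opp a : cexpi (- a) = Cconj (cexpi a).
Proof. unfold cexpi, Cconj. simpl. now rewrite cos_neg, sin_neg. Qed.

Lemma cexpi_2PI k : cexpi (2 * PI * IZR k) = RtoC 1.
Proof.
  destruct (Z.le_ge_cases 0 k).
  - rewrite <- (Z2Nat.id k) by lia. rewrite <- INR_IZR_INZ. apply cexpi_2PI_nat.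
  - replace k with (- Z.of_nat (Z.to_nat (- k)))%Z by lia. rewrite opp_IZR, <- INR_IZR_INZ.
    replace (2 * PI * - INR (Z.to_nat (- k))) with (- (2 * PI * INR (Z.to_nat (- k)))) by ring.
    rewrite cexpi_opp, cexpi_2PI_nat. ceq.
Qed.

Lemma cexpi_periodic x k : cexpi (x + 2 * PI * IZR k) = cexpi x.
Proof. rewrite cexpi_plus, cexpi_2PI. ring. Qed.

Definition supp (r : R) (f : R -> C) := forall x, r < Rabs x -> f x = RtoC 0.

Lemma supp_mono r r' f : r <= r' -> supp r f -> supp r' f.
Proof. intros H S x Hx. apply S. lra. Qed.

Lemma Cc_intro f r : ccont f -> supp r f -> Cc f.
Proof. intros; split; eauto. Qed.

Lemma Cc_ccont f : Cc f -> ccont f.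
Proof. now intros []. Qed.

Lemma Cc_supp f : Cc f -> exists r, 0 < r /\ supp r f.
Proof.
  intros [_ [r H]]. exists (Rabs r + 1). split; [pose proof (Rabs_pos r); lra|].
  apply (supp_mono r); [pose proof (Rle_abs r); lra|exact H].
Qed.

Lemma supp_fadd r f g : supp r f -> supp r g -> supp r (fadd f g).
Proof. intros H1 H2 x Hx. unfold fadd. rewrite H1, H2 by easy. ceq. Qed.

Lemma Cc_fadd f g : Cc f -> Cc g -> Cc (fadd f g).
Proof.
  intros H1 H2. destruct (Cc_supp f H1) as (r1 & Hr1 & S1). destruct (Cc_supp g H2) as (r2 & Hr2 & S2).
  apply (Cc_intro _ (r1 + r2)); [apply ccont_plus; now apply Cc_ccont|].
  apply supp_fadd; eapply supp_mono; eauto; lra.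
Qed.

Lemma Cc_mult f g : Cc f -> ccont g -> Cc (fun x => f x * g x)%C.
Proof.
  intros H G. destruct H as [H1 [r H2]]. apply (Cc_intro _ r); [now apply ccont_mult|].
  intros x Hx. rewrite H2 by easy. ring.
Qed.

Lemma Cc_mult_l f g : ccont f -> Cc g -> Cc (fun x => f x * g x)%C.
Proof.
  intros H G. destruct G as [H1 [r H2]]. apply (Cc_intro _ r); [now apply ccont_mult|].
  intros x Hx. rewrite H2 by easy. ring.
Qed.

Lemma Cc_fscal a f : Cc f -> Cc (fscal a f).
Proof. intros H. apply (Cc_mult_l (fun _ => a) f); [apply ccont_const|easy]. Qed.

Lemma Cc_zero : Cc (fun _ => RtoC 0).
Proof. apply (Cc_intro _ 0); [apply ccont_const|easy]. Qed.

Lemma Cc_csum n F : (forall i, (i < n)%nat -> Cc (F i)) -> Cc (fun x => csum n (fun i => F i x)).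
Proof.
  induction n; intros H; simpl; [apply Cc_zero|].
  apply (Cc_fadd (fun x => csum n (fun i => F i x)) (F n)); [apply IHn; intros; apply H; lia|apply H; lia].
Qed.

Lemma Cc_shift f a : Cc f -> Cc (fun x => f (x + a)).
Proof.
  intros H. destruct (Cc_supp f H) as (r & Hr & S).
  apply (Cc_intro _ (r + Rabs a)); [apply ccont_shift; now apply Cc_ccont|].
  intros x Hx. apply S. pose proof (Rabs_triang (x + a) (- a)). rewrite Rabs_Ropp in H0.
  replace (x + a + - a) with x in H0 by ring. lra.
Qed.

Lemma supp_opp_arg r f : supp r f -> supp r (fun x => f (- x)).
Proof. intros S x Hx. apply S. now rewrite Rabs_Ropp. Qed.

Lemma Cc_opp_arg f : Cc f -> Cc (fun x => f (- x)).
Proof.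
  intros H. destruct (Cc_supp f H) as (r & Hr & S).
  apply (Cc_intro _ r); [apply ccont_opp_arg; now apply Cc_ccont|now apply supp_opp_arg].
Qed.

Lemma Cc_conj f : Cc f -> Cc (fun x => Cconj (f x)).
Proof.
  intros [H [r S]]. apply (Cc_intro _ r); [now apply ccont_conj|]. intros x Hx. rewrite S by easy. ceq.
Qed.

Lemma rcont_bounded (f : R -> R) a b : (forall x, continuous f x) -> exists M, 0 < M /\ forall x, a <= x <= b -> Rabs (f x) <= M.
Proof.
  intros H. destruct (Rle_dec a b) as [Hab|Hab].
  - destruct (continuity_ab_maj (fun x => Rabs (f x)) a b Hab) as (x0 & H0 & _).
    + intros c _. apply continuity_pt_filterlim. apply (continuous_comp f Rabs); [apply H|apply continuous_Rabs].
    + exists (Rabs (f x0) + 1). split; [pose proof (Rabs_pos (f x0)); lra|]. intros x Hx. specialize (H0 x Hx). simpl in H0. lra.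
  - exists 1. split; [lra|]. intros. lra.
Qed.

Lemma ccont_bounded f a b : ccont f -> exists M, 0 < M /\ forall x, a <= x <= b -> Cmod (f x) <= M.
Proof.
  intros H. apply ccont_iff in H. destruct H as [H1 H2].
  destruct (rcont_bounded _ a b H1) as (M1 & P1 & B1). destruct (rcont_bounded _ a b H2) as (M2 & P2 & B2).
  exists (M1 + M2). split; [lra|]. intros x Hx. eapply Rle_trans; [apply Cmod_le_Re_Im|].
  specialize (B1 x Hx). specialize (B2 x Hx). lra.
Qed.

Lemma Cc_bounded f : Cc f -> exists M, 0 < M /\ forall x, Cmod (f x) <= M.
Proof.
  intros H. destruct (Cc_supp f H) as (r & Hr & S). destruct (ccont_bounded f (-r) r (Cc_ccont _ H)) as (M & P & B).
  exists M. split; [easy|]. intros x. destruct (Rle_dec (Rabs x) r) as [h|h].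
  - apply B. now apply Rabs_le_between.
  - rewrite S by lra. rewrite Cmod_0. lra.
Qed.

Lemma ccont_unif f a b : ccont f -> forall e, 0 < e -> exists d, 0 < d /\ forall x y, a <= x <= b -> a <= y <= b -> Rabs (x - y) < d -> Cmod (f x - f y) < e.
Proof.
  intros H e He. apply ccont_iff in H. destruct H as [H1 H2].
  assert (He2 : 0 < e / 2) by lra.
  destruct (Heine_cor2 (a := a) (b := b) (fun x _ => proj2 (continuity_pt_filterlim _ x) (H1 x)) (mkposreal _ He2)) as (d1 & D1).
  destruct (Heine_cor2 (a := a) (b := b) (fun x _ => proj2 (continuity_pt_filterlim _ x) (H2 x)) (mkposreal _ He2)) as (d2 & D2).
  exists (Rmin d1 d2). split; [apply Rmin_pos; apply cond_pos|]. intros x y Hx Hy Hxy.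
  eapply Rle_lt_trans; [apply Cmod_le_Re_Im|].
  specialize (D1 x y Hx Hy (Rlt_le_trans _ _ _ Hxy (Rmin_l _ _))).
  specialize (D2 x y Hx Hy (Rlt_le_trans _ _ _ Hxy (Rmin_r _ _))).
  change (Re (f x - f y)%C) with (Re (f x) - Re (f y)). change (Im (f x - f y)%C) with (Im (f x) - Im (f y)).
  simpl in D1, D2. lra.
Qed.

Lemma Cc_unif f : Cc f -> forall e, 0 < e -> exists d, 0 < d /\ forall x y, Rabs (x - y) < d -> Cmod (f x - f y) < e.
Proof.
  intros H e He. destruct (Cc_supp f H) as (r & Hr & S).
  (* With the margin 1 and a step below 1, a point outside this interval forces both points outside
     the support. *)
  destruct (ccont_unif f (-(r+1)) (r+1) (Cc_ccont _ H) e He) as (d & Hd & D).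
  exists (Rmin d 1). split; [apply Rmin_pos; lra|]. intros x y Hxy.
  assert (h1 := Rlt_le_trans _ _ _ Hxy (Rmin_l _ _)). assert (h2 := Rlt_le_trans _ _ _ Hxy (Rmin_r _ _)).
  destruct (Rle_dec (Rabs x) (r + 1)) as [hx|hx]; [destruct (Rle_dec (Rabs y) (r + 1)) as [hy|hy]|].
  - apply D; [now apply Rabs_le_between|now apply Rabs_le_between|easy].
  - rewrite (S y) by lra. rewrite (S x). 2:{ pose proof (Rabs_triang_inv y x). rewrite Rabs_minus_sym in h2. lra. }
    replace (0 - 0)%C with (RtoC 0) by ring. now rewrite Cmod_0.
  - rewrite (S x) by lra. rewrite (S y). 2:{ pose proof (Rabs_triang_inv x y). lra. }
    replace (0 - 0)%C with (RtoC 0) by ring. now rewrite Cmod_0.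
Qed.

Definition CI (f : R -> C) (a b : R) : C := RInt (V := C_R_CompleteNormedModule) f a b.

Arguments CI : simpl never.

Ltac req := match goal with |- @eq _ ?x ?y => change (@eq R x y) end.

Lemma ex_CI f a b : ccont f -> ex_RInt (V := C_R_CompleteNormedModule) f a b.
Proof. intros H. apply ex_RInt_continuous. intros; apply H. Qed.

Lemma ex_RI (f : R -> R) a b : (forall x, continuous f x) -> ex_RInt f a b.
Proof. intros H. apply (ex_RInt_continuous (V := R_CompleteNormedModule)). intros; apply H. Qed.

Lemma RI_plus (f g : R -> R) a b : (forall x, continuous f x) -> (forall x, continuous g x) ->
  RInt (fun x => f x + g x) a b = RInt f a b + RInt g a b.
Proof. intros. apply (RInt_plus (V := R_CompleteNormedModule)); now apply ex_RI. Qed.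

Lemma RI_scal (f : R -> R) k a b : (forall x, continuous f x) -> RInt (fun x => k * f x) a b = k * RInt f a b.
Proof. intros. apply (RInt_scal (V := R_CompleteNormedModule)); now apply ex_RI. Qed.

Lemma RI_Chasles (f : R -> R) a b c : (forall x, continuous f x) -> RInt f a b + RInt f b c = RInt f a c.
Proof. intros. apply (RInt_Chasles (V := R_CompleteNormedModule)); now apply ex_RI. Qed.

Lemma CI_components f a b : ccont f -> CI f a b = (RInt (fun t => Re (f t)) a b, RInt (fun t => Im (f t)) a b).
Proof.
  intros H. apply (is_RInt_unique (V := C_R_CompleteNormedModule)). pose proof (proj1 (ccont_iff f) H) as [H1 H2].
  apply (is_RInt_fct_extend_pair (U := R_NormedModule) (V := R_NormedModule)).
  - apply (RInt_correct (V := R_CompleteNormedModule)). now apply ex_RI.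
  - apply (RInt_correct (V := R_CompleteNormedModule)). now apply ex_RI.
Qed.

Lemma CI_ext f g a b : (forall x, Rmin a b < x < Rmax a b -> f x = g x) -> CI f a b = CI g a b.
Proof. apply (RInt_ext (V := C_R_CompleteNormedModule)). Qed.

Lemma CI_plus f g a b : ccont f -> ccont g -> CI (fun x => f x + g x)%C a b = (CI f a b + CI g a b)%C.
Proof. intros. apply (RInt_plus (V := C_R_CompleteNormedModule)); now apply ex_CI. Qed.

(** The integral takes values in C as a real module, so its linearity covers real factors only. A
    complex factor mixes the two components, hence the combination [p * Re + q * Im]. *)
Lemma CI_scal c f a b : ccont f -> CI (fun x => c * f x)%C a b = (c * CI f a b)%C.
Proof.
  intros H. pose proof (proj1 (ccont_iff f) H) as [H1 H2].
  rewrite !CI_components; [|easy|apply ccont_mult; [apply ccont_const|easy]].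
  assert (E : forall p q, ex_RInt (fun t => p * Re (f t) + q * Im (f t)) a b /\
     RInt (fun t => p * Re (f t) + q * Im (f t)) a b = p * RInt (fun t => Re (f t)) a b + q * RInt (fun t => Im (f t)) a b).
  { intros p q. split.
    - apply ex_RI. intros x. apply rcont_plus; apply rcont_mult; auto using continuous_const.
    - rewrite (RI_plus (fun t => p * Re (f t)) (fun t => q * Im (f t))).
      + now rewrite !RI_scal.
      + intros x. apply rcont_mult; auto using continuous_const.
      + intros x. apply rcont_mult; auto using continuous_const. }
  apply injective_projections; simpl fst; simpl snd.
  - rewrite (RInt_ext (V := R_CompleteNormedModule) _ (fun t => fst c * Re (f t) + (- snd c) * Im (f t))).
    + rewrite (proj2 (E _ _)). unfold Re, Im. ring.
    + intros x _. simpl. unfold Re, Im. ring.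
  - rewrite (RInt_ext (V := R_CompleteNormedModule) _ (fun t => snd c * Re (f t) + fst c * Im (f t))).
    + rewrite (proj2 (E _ _)). unfold Re, Im. ring.
    + intros x _. simpl. unfold Re, Im. ring.
Qed.

Lemma CI_Chasles f a b c : ccont f -> (CI f a b + CI f b c)%C = CI f a c.
Proof. intros. apply (RInt_Chasles (V := C_R_CompleteNormedModule)); now apply ex_CI. Qed.

Lemma C_R_norm (z : C) : norm (K := R_AbsRing) (V := C_R_NormedModule) z = Cmod z.
Proof. exact (eq_sym (Cmod_norm z)). Qed.

Lemma CI_bound f (g : R -> R) a b : a <= b -> ccont f -> ex_RInt g a b -> (forall x, a <= x <= b -> Cmod (f x) <= g x) ->
  Cmod (CI f a b) <= RInt g a b.
Proof.
  intros Hab Hf Hg H. rewrite <- C_R_norm.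
  apply (norm_RInt_le (V := C_R_NormedModule) f g a b); auto.
  - intros x Hx. rewrite C_R_norm. now apply H.
  - apply (RInt_correct (V := C_R_CompleteNormedModule)). now apply ex_CI.
  - now apply (RInt_correct (V := R_CompleteNormedModule)).
Qed.

Lemma CI_bound_const f M a b : a <= b -> ccont f -> (forall x, a <= x <= b -> Cmod (f x) <= M) ->
  Cmod (CI f a b) <= (b - a) * M.
Proof.
  intros Hab Hf H. eapply Rle_trans; [apply (CI_bound f (fun _ => M)); auto|].
  - apply ex_RI. intros; apply continuous_const.
  - rewrite RInt_const. right. reflexivity.
Qed.

Lemma CI_zero f a b : a <= b -> (forall x, a < x < b -> f x = RtoC 0) -> CI f a b = RtoC 0.
Proof.
  intros Hab H. rewrite (CI_ext f (fun _ => RtoC 0)).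
  - unfold CI. rewrite RInt_const. unfold scal; simpl. unfold prod_scal; simpl. unfold scal; simpl. unfold mult; simpl. ceq.
  - rewrite Rmin_left, Rmax_right by lra. exact H.
Qed.

Lemma CI_lin f u v a b : u <> 0 -> ccont f -> CI (fun x => f (u * x + v)) a b = (RtoC (/ u) * CI f (u * a + v) (u * b + v))%C.
Proof.
  intros Hu Hf. unfold CI.
  rewrite <- (RInt_comp_lin (V := C_R_CompleteNormedModule) f u v a b) by now apply ex_CI.
  change (RInt (V := C_R_CompleteNormedModule) (fun x => f (u * x + v)) a b) with (CI (fun x => f (u * x + v)) a b).
  change (RInt (V := C_R_CompleteNormedModule) (fun y => scal u (f (u * y + v)%R)) a b) with (CI (fun y => scal (V:=C_R_CompleteNormedModule) u (f (u * y + v)%R)) a b).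
  rewrite (CI_ext (fun y => scal (V:=C_R_CompleteNormedModule) u (f (u * y + v)%R)) (fun y => RtoC u * f (u * y + v)%R)%C).
  - rewrite CI_scal by now apply ccont_lin. rewrite Cmult_assoc, <- RtoC_mult, Rinv_l by easy. ring.
  - intros x _. unfold scal; simpl. unfold prod_scal; simpl. unfold scal; simpl. unfold mult; simpl. ceq.
Qed.

Lemma CI_outside f r a b : ccont f -> supp r f -> 0 <= r -> r <= a -> a <= b -> CI f a b = RtoC 0 /\ CI f (- b) (- a) = RtoC 0.
Proof.
  intros Hf S Hr Ha Hab. split; apply CI_zero; try lra; intros x Hx; apply S.
  - rewrite Rabs_right; lra.
  - rewrite Rabs_left; lra.
Qed.

Lemma CI_supp f r a b : ccont f -> supp r f -> 0 <= r -> a <= - r -> r <= b -> CI f a b = CI f (-r) r.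
Proof.
  intros Hf S Hr Ha Hb. rewrite <- (CI_Chasles f a (-r) b), <- (CI_Chasles f (-r) r b) by easy.
  destruct (CI_outside f r r b Hf S) as [-> _]; try lra.
  replace a with (- - a) by ring. destruct (CI_outside f r r (- a) Hf S) as [_ ->]; try lra. ring.
Qed.

(** Once an interval contains the support its integral no longer changes, so the limit along the
    filter is attained. *)
Lemma integral_CI f r : ccont f -> supp r f -> 0 <= r -> integral f = CI f (-r) r.
Proof.
  intros Hf S Hr. unfold integral. apply (is_RInt_gen_unique (V := C_R_CompleteNormedModule)).
  intros P HP. unfold filtermapi.
  exists (fun a => a < - r) (fun b => r < b).
  - exists (- r). auto.
  - exists r. auto.
  - intros a b Ha Hb. exists (CI f a b). split.
    + apply (RInt_correct (V := C_R_CompleteNormedModule)). now apply ex_CI.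
    + rewrite (CI_supp f r a b) by (auto; lra). now apply (locally_singleton (T := C_UniformSpace)).
Qed.

Lemma integral_Cc f : Cc f -> exists r0, 0 < r0 /\ forall r, r0 <= r -> integral f = CI f (-r) r.
Proof.
  intros H. destruct (Cc_supp f H) as (r & Hr & S). exists r. split; [easy|]. intros r' Hr'.
  apply integral_CI; [now apply Cc_ccont|now apply (supp_mono r)|lra].
Qed.

Lemma integral_plus f g : Cc f -> Cc g -> integral (fun x => f x + g x)%C = (integral f + integral g)%C.
Proof.
  intros H G. destruct (integral_Cc f H) as (r1 & P1 & E1). destruct (integral_Cc g G) as (r2 & P2 & E2).
  destruct (integral_Cc _ (Cc_fadd f g H G)) as (r3 & P3 & E3). unfold fadd in E3.
  rewrite (E1 (r1 + r2 + r3)), (E2 (r1 + r2 + r3)), (E3 (r1 + r2 + r3)) by lra.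
  apply CI_plus; now apply Cc_ccont.
Qed.

Lemma integral_scal c f : Cc f -> integral (fun x => c * f x)%C = (c * integral f)%C.
Proof.
  intros H. destruct (integral_Cc f H) as (r1 & P1 & E1).
  destruct (integral_Cc _ (Cc_fscal c f H)) as (r3 & P3 & E3). unfold fscal in E3.
  rewrite (E1 (r1 + r3)), (E3 (r1 + r3)) by lra. apply CI_scal; now apply Cc_ccont.
Qed.

Lemma integral_csum n F : (forall i, (i < n)%nat -> Cc (F i)) ->
  integral (fun x => csum n (fun i => F i x)) = csum n (fun i => integral (F i)).
Proof.
  induction n; intros H; simpl.
  - rewrite (integral_CI _ 0); [|apply ccont_const|easy|lra]. now apply CI_zero; [lra|].
  - rewrite (integral_plus (fun x => csum n (fun i => F i x)) (F n)).
    + rewrite IHn; [easy|intros; apply H; lia].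
    + apply Cc_csum; intros; apply H; lia.
    + apply H; lia.
Qed.

Lemma integral_shift f a : Cc f -> integral (fun x => f (x + a)) = integral f.
Proof.
  intros H. destruct (Cc_supp f H) as (r & Hr & S). pose proof (Rabs_pos a).
  rewrite (integral_CI f r) by (auto using Cc_ccont; lra).
  rewrite (integral_CI _ (r + Rabs a)).
  - rewrite (CI_ext _ (fun x => f (1 * x + a))) by (intros; f_equal; ring).
    rewrite CI_lin by (auto using Cc_ccont; lra).
    rewrite (CI_supp f r) ; auto using Cc_ccont; try lra.
    + rewrite Rinv_1. ring.
    + pose proof (Rle_abs a). lra.
    + pose proof (Rle_abs (- a)). rewrite Rabs_Ropp in *. lra.
  - apply ccont_shift; now apply Cc_ccont.
  - intros x Hx. apply S. pose proof (Rabs_triang (x + a) (- a)). rewrite Rabs_Ropp in *.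
    replace (x + a + - a) with x in * by ring. lra.
  - lra.
Qed.

Lemma integral_opp f : Cc f -> integral (fun x => f (- x)) = integral f.
Proof.
  intros H. destruct (Cc_supp f H) as (r & Hr & S).
  rewrite (integral_CI f r) by (auto using Cc_ccont; lra).
  rewrite (integral_CI _ r); [|apply ccont_opp_arg; now apply Cc_ccont|now apply supp_opp_arg|lra].
  rewrite (CI_ext _ (fun x => f (-1 * x + 0))) by (intros; f_equal; ring).
  rewrite CI_lin by (auto using Cc_ccont; lra).
  replace (-1 * - r + 0) with r by ring. replace (-1 * r + 0) with (- r) by ring.
  unfold CI. rewrite <- (opp_RInt_swap (V := C_R_CompleteNormedModule)) by now apply ex_CI, Cc_ccont.
  set (I := RInt _ _ _). change (opp I) with (Copp I). ceq; field.
Qed.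

Lemma integral_bound f r M : ccont f -> supp r f -> 0 <= r -> (forall x, Cmod (f x) <= M) -> Cmod (integral f) <= 2 * r * M.
Proof.
  intros Hf S Hr B. rewrite (integral_CI f r) by auto.
  eapply Rle_trans; [apply (CI_bound_const f M); auto; lra|]. right; ring.
Qed.

Lemma CI_FTC (F f : R -> C) a b : ccont f ->
  (forall x, is_derive (fun t => Re (F t)) x (Re (f x))) -> (forall x, is_derive (fun t => Im (F t)) x (Im (f x))) ->
  CI f a b = (F b - F a)%C.
Proof.
  intros Hf H1 H2. rewrite CI_components by easy. apply ccont_iff in Hf. destruct Hf as [C1 C2].
  apply injective_projections; simpl.
  - apply is_RInt_unique. apply (is_RInt_derive (V := R_CompleteNormedModule) (fun t => Re (F t))); auto.
  - apply is_RInt_unique. apply (is_RInt_derive (V := R_CompleteNormedModule) (fun t => Im (F t))); auto.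
Qed.

(** * Parametric integrals *)

Definition rc2 (f : R -> R -> R) := forall x y, continuity_2d_pt f x y.
Definition c2 (K : R -> R -> C) := rc2 (fun u v => Re (K u v)) /\ rc2 (fun u v => Im (K u v)).

Lemma rc2_slice f x : rc2 f -> forall y, continuous (fun v => f x v) y.
Proof.
  intros H y. apply continuity_pt_filterlim. intros e He.
  destruct (H x y (mkposreal e He)) as [d D]. exists d. split; [apply cond_pos|].
  intros v [_ Hv]. simpl in *. unfold R_dist in *. apply D; [|exact Hv].
  rewrite Rminus_diag, Rabs_R0. apply cond_pos.
Qed.

Lemma rc2_swap f : rc2 f -> rc2 (fun u v => f v u).
Proof. intros H x y e. destruct (H y x e) as [d D]. exists d. intros u v Hu Hv. now apply D. Qed.

Lemma rc2_plus f g : rc2 f -> rc2 g -> rc2 (fun u v => f u v + g u v).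
Proof. intros H G x y. now apply continuity_2d_pt_plus. Qed.
Lemma rc2_minus f g : rc2 f -> rc2 g -> rc2 (fun u v => f u v - g u v).
Proof. intros H G x y. now apply continuity_2d_pt_minus. Qed.
Lemma rc2_mult f g : rc2 f -> rc2 g -> rc2 (fun u v => f u v * g u v).
Proof. intros H G x y. now apply continuity_2d_pt_mult. Qed.
Lemma rc2_fst : rc2 (fun u _ => u).
Proof. intros x y. apply continuity_2d_pt_id1. Qed.
Lemma rc2_snd : rc2 (fun _ v => v).
Proof. intros x y. apply continuity_2d_pt_id2. Qed.
Lemma rc2_const c : rc2 (fun _ _ => c).
Proof. intros x y. apply continuity_2d_pt_const. Qed.

Lemma c2_mult K L : c2 K -> c2 L -> c2 (fun u v => K u v * L u v)%C.
Proof.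
  intros [H1 H2] [H3 H4]. split.
  - apply (rc2_minus (fun u v => Re (K u v) * Re (L u v)) (fun u v => Im (K u v) * Im (L u v))); now apply rc2_mult.
  - apply (rc2_plus (fun u v => Re (K u v) * Im (L u v)) (fun u v => Im (K u v) * Re (L u v))); now apply rc2_mult.
Qed.

Lemma c2_comp f g : ccont f -> rc2 g -> c2 (fun u v => f (g u v)).
Proof.
  intros H G. apply ccont_iff in H. destruct H as [H1 H2].
  split; intros x y; apply (continuity_1d_2d_pt_comp (fun t => _ (f t))); try apply G; apply continuity_pt_filterlim; [apply H1|apply H2].
Qed.

Lemma c2_swap K : c2 K -> c2 (fun u v => K v u).
Proof.
  intros [H1 H2]. split; [apply (rc2_swap (fun u v => Re (K u v)))|apply (rc2_swap (fun u v => Im (K u v)))]; auto.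
Qed.

Lemma c2_slice K x : c2 K -> ccont (K x).
Proof.
  intros [H1 H2]. apply ccont_iff. split; intros y;
  [apply (rc2_slice (fun u v => Re (K u v)))|apply (rc2_slice (fun u v => Im (K u v)))]; auto.
Qed.

Lemma RI_param_cont f a b : a <= b -> rc2 f -> forall x, continuous (fun u => RInt (f u) a b) x.
Proof.
  intros Hab H x. apply continuity_pt_filterlim. intros e He.
  (* The summand 1 keeps the denominator positive when [a = b]. *)
  assert (He' : 0 < e / (b - a + 1)) by (apply Rdiv_lt_0_compat; lra).
  destruct (uniform_continuity_2d f (x - 1) (x + 1) a b (fun u v _ _ => H u v) (mkposreal _ He')) as [d D].
  exists (Rmin d 1). split; [apply Rmin_pos; [apply cond_pos|lra]|].
  intros u [_ Hu]. simpl in Hu. unfold R_dist in Hu. simpl. unfold R_dist.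
  assert (h1 := Rlt_le_trans _ _ _ Hu (Rmin_l _ _)). assert (h2 := Rlt_le_trans _ _ _ Hu (Rmin_r _ _)).
  replace (RInt (f u) a b - RInt (f x) a b) with (RInt (fun t => f u t + -1 * f x t) a b).
  - apply Rle_lt_trans with ((b - a) * (e / (b - a + 1))).
    + apply abs_RInt_le_const; [easy| |].
      * apply ex_RI. intros t. apply rcont_plus; [now apply rc2_slice|].
        apply rcont_mult; [apply continuous_const|now apply rc2_slice].
      * intros t Ht. left. replace (f u t + -1 * f x t) with (f u t - f x t) by ring.
        apply Rabs_lt_between in h2.
        apply (D x t u t); try lra. replace (t - t) with 0 by ring. rewrite Rabs_R0. apply cond_pos.
    + apply Rlt_le_trans with ((b - a + 1) * (e / (b - a + 1))); [|right; field; lra].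
      apply Rmult_lt_compat_r; lra.
  - rewrite (RI_plus (f u) (fun t => -1 * f x t)), RI_scal; [lra|..].
    + now apply rc2_slice.
    + now apply rc2_slice.
    + intros t. apply rcont_mult; [apply continuous_const|now apply rc2_slice].
Qed.

Lemma RI_param_derive f f' a b x : a <= b -> rc2 f' -> (forall y t, continuous (fun s => f y s) t) ->
  (forall y t, is_derive (fun u => f u t) y (f' y t)) ->
  is_derive (fun u => RInt (f u) a b) x (RInt (f' x) a b).
Proof.
  intros Hab H2 Hc Hd.
  replace (RInt (f' x) a b) with (RInt (fun t => Derive (fun u => f u t) x) a b).
  - apply is_derive_RInt_param.
    + exists (mkposreal 1 Rlt_0_1). intros y _ t _. eexists; apply Hd.
    + intros t _. apply (continuity_2d_pt_ext f'); [|apply H2].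
      intros u v. symmetry. apply is_derive_unique, Hd.
    + exists (mkposreal 1 Rlt_0_1). intros y _. now apply ex_RI.
  - apply RInt_ext. intros t _. apply is_derive_unique, Hd.
Qed.

Lemma RI_upper_derive (f : R -> R) a x : (forall t, continuous f t) -> is_derive (fun u => RInt f a u) x (f x).
Proof.
  intros H. apply (is_derive_RInt (V := R_NormedModule) f (fun u => RInt f a u) a x); [|apply H].
  exists (mkposreal 1 Rlt_0_1). intros y _. apply (RInt_correct (V := R_CompleteNormedModule)). now apply ex_RI.
Qed.

(* Both iterated integrals, seen as functions of the upper bound [b], vanish at [a] and have the same derivative. *)
Lemma RI_fubini f a b c d : a <= b -> c <= d -> rc2 f ->
  RInt (fun x => RInt (f x) c d) a b = RInt (fun t => RInt (fun x => f x t) a b) c d.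
Proof.
  intros Hab Hcd H.
  set (P := fun u => RInt (fun x => RInt (f x) c d) a u).
  set (Q := fun u => RInt (fun t => RInt (fun x => f x t) a u) c d).
  assert (HP : forall u, is_derive P u (RInt (f u) c d)).
  { intros u. apply (RI_upper_derive (fun x => RInt (f x) c d)). now apply RI_param_cont. }
  assert (HQ : forall u, is_derive Q u (RInt (f u) c d)).
  { intros u. apply (RI_param_derive (fun u t => RInt (fun x => f x t) a u) f); auto.
    (* The upper bound [y] is arbitrary here, so the interval from [a] to [y] may be reversed. *)
    - intros y t. destruct (Rle_dec a y) as [h|h].
      + apply (RI_param_cont (fun t x => f x t)); [easy|]. now apply rc2_swap.
      + apply (continuous_ext (fun t => - RInt (fun x => f x t) y a)).
        { intros s. apply (opp_RInt_swap (V := R_CompleteNormedModule) (fun x => f x s) y a).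
          apply ex_RI, (rc2_slice (fun v u => f u v) s). now apply rc2_swap. }
        apply rcont_opp. apply (RI_param_cont (fun t x => f x t)); [lra|]. now apply rc2_swap.
    - intros y t. apply (RI_upper_derive (fun x => f x t)). apply (rc2_slice (fun v u => f u v) t). now apply rc2_swap. }
  change (P b = Q b).
  destruct (MVT_gen (fun u => P u - Q u) a b (fun _ => 0)) as (z & _ & Hz).
  - intros x _. replace 0 with (RInt (f x) c d - RInt (f x) c d) by ring.
    apply (is_derive_minus (V := R_NormedModule)); auto.
  - intros x _. apply continuity_pt_filterlim. apply rcont_minus.
    + apply (ex_derive_continuous (V := R_NormedModule)). eexists; apply HP.
    + apply (ex_derive_continuous (V := R_NormedModule)). eexists; apply HQ.
  - assert (Pa : P a = 0) by (apply (RInt_point (V := R_CompleteNormedModule))).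
    assert (Qa : Q a = 0).
    { unfold Q. rewrite (RInt_ext _ (fun _ => 0)); [|intros; apply (RInt_point (V := R_CompleteNormedModule))].
      rewrite RInt_const. apply Rmult_0_r. }
    rewrite Pa, Qa in Hz. lra.
Qed.

Lemma CI_param_cont K a b : a <= b -> c2 K -> ccont (fun x => CI (K x) a b).
Proof.
  intros Hab H. apply (ccont_ext (fun x => (RInt (fun t => Re (K x t)) a b, RInt (fun t => Im (K x t)) a b))).
  - intros x. rewrite CI_components; [easy|now apply c2_slice].
  - destruct H as [H1 H2]. apply ccont_iff. split; intros x; simpl.
    + now apply (RI_param_cont (fun u v => Re (K u v))).
    + now apply (RI_param_cont (fun u v => Im (K u v))).
Qed.

Lemma CI_fubini K a b c d : a <= b -> c <= d -> c2 K ->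
  CI (fun x => CI (K x) c d) a b = CI (fun t => CI (fun x => K x t) a b) c d.
Proof.
  intros Hab Hcd H.
  rewrite CI_components by now apply CI_param_cont.
  rewrite CI_components by now apply (CI_param_cont (fun u v => K v u)), c2_swap.
  assert (E1 : forall x, CI (K x) c d = (RInt (fun t => Re (K x t)) c d, RInt (fun t => Im (K x t)) c d)).
  { intros x. apply CI_components. now apply c2_slice. }
  assert (E2 : forall t, CI (fun x => K x t) a b = (RInt (fun x => Re (K x t)) a b, RInt (fun x => Im (K x t)) a b)).
  { intros t. apply CI_components. apply (c2_slice (fun u v => K v u)). now apply c2_swap. }
  destruct H as [H1 H2]. apply injective_projections; cbn [fst snd].
  - rewrite (RInt_ext _ (fun x => RInt (fun t => Re (K x t)) c d)) by (intros; cbv beta; now rewrite E1).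
    rewrite (RI_fubini (fun u v => Re (K u v))) by easy.
    apply RInt_ext. intros t _. cbv beta. now rewrite E2.
  - rewrite (RInt_ext _ (fun x => RInt (fun t => Im (K x t)) c d)) by (intros; cbv beta; now rewrite E1).
    rewrite (RI_fubini (fun u v => Im (K u v))) by easy.
    apply RInt_ext. intros t _. cbv beta. now rewrite E2.
Qed.

(** The derivative is taken in components, to match [smooth] and [Dn]. *)
Definition cder (f : R -> C) (x : R) (l : C) :=
  is_derive (fun t => Re (f t)) x (Re l) /\ is_derive (fun t => Im (f t)) x (Im l).

Lemma CI_param_derive K K' a b x : a <= b -> c2 K' -> (forall y, ccont (K y)) ->
  (forall y t, cder (fun u => K u t) y (K' y t)) ->
  cder (fun u => CI (K u) a b) x (CI (K' x) a b).
Proof.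
  intros Hab [H1 H2] Hc Hd. rewrite (CI_components (K' x)) by now apply c2_slice.
  split; cbn [Re Im fst snd].
  - apply (is_derive_ext (fun u => RInt (fun t => Re (K u t)) a b)). { intros t. now rewrite CI_components. }
    apply (RI_param_derive (fun u t => Re (K u t)) (fun u t => Re (K' u t))); auto.
    + intros y. exact (proj1 (proj1 (ccont_iff _) (Hc y))).
    + intros y t. apply Hd.
  - apply (is_derive_ext (fun u => RInt (fun t => Im (K u t)) a b)). { intros t. now rewrite CI_components. }
    apply (RI_param_derive (fun u t => Im (K u t)) (fun u t => Im (K' u t))); auto.
    + intros y. exact (proj2 (proj1 (ccont_iff _) (Hc y))).
    + intros y t. apply Hd.
Qed.

Lemma cder_ccont f f' : (forall x, cder f x (f' x)) -> ccont f.
Proof.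
  intros H. apply ccont_iff. split; intros x; apply (ex_derive_continuous (V := R_NormedModule)).
  - exists (Re (f' x)). exact (proj1 (H x)).
  - exists (Im (f' x)). exact (proj2 (H x)).
Qed.

Lemma cder_unique f x a b : cder f x a -> cder f x b -> a = b.
Proof.
  intros [H1 H2] [H3 H4]. apply injective_projections.
  - change (Re a = Re b). now rewrite <- (is_derive_unique _ _ _ H1), <- (is_derive_unique _ _ _ H3).
  - change (Im a = Im b). now rewrite <- (is_derive_unique _ _ _ H2), <- (is_derive_unique _ _ _ H4).
Qed.

Lemma is_derive_eq (f : R -> R) (x a b : R) : is_derive f x a -> a = b -> is_derive f x b.
Proof. now intros H ->. Qed.

Lemma cder_eq f x a b : cder f x a -> a = b -> cder f x b.
Proof. now intros H ->. Qed.

Lemma cder_ext f g x l : (forall t, f t = g t) -> cder f x l -> cder g x l.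
Proof. intros E [H1 H2]. split; [apply (is_derive_ext (fun t => Re (f t)))|apply (is_derive_ext (fun t => Im (f t)))]; auto; intros; now rewrite E. Qed.

Lemma cder_const c x : cder (fun _ => c) x (RtoC 0).
Proof. split; apply (is_derive_const (V := R_NormedModule)). Qed.

Lemma cder_plus f g x a b : cder f x a -> cder g x b -> cder (fun t => f t + g t)%C x (a + b)%C.
Proof. intros [H1 H2] [H3 H4]. split; apply (is_derive_plus (V := R_NormedModule)); auto. Qed.

Lemma rder_mult (f g : R -> R) (x a b : R) : is_derive f x a -> is_derive g x b ->
  is_derive (fun t => f t * g t) x (a * g x + f x * b).
Proof. intros H G. apply (is_derive_mult (K := R_AbsRing) f g x a b H G). exact Rmult_comm. Qed.

Lemma rder_plus (f g : R -> R) (x a b : R) : is_derive f x a -> is_derive g x b -> is_derive (fun t => f t + g t) x (a + b).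
Proof. apply (is_derive_plus (V := R_NormedModule)). Qed.

Lemma rder_minus (f g : R -> R) (x a b : R) : is_derive f x a -> is_derive g x b -> is_derive (fun t => f t - g t) x (a - b).
Proof. apply (is_derive_minus (V := R_NormedModule)). Qed.

Lemma cder_mult f g x a b : cder f x a -> cder g x b -> cder (fun t => f t * g t)%C x (a * g x + f x * b)%C.
Proof.
  intros [H1 H2] [H3 H4]. split.
  - eapply is_derive_eq.
    + apply (rder_minus (fun t => Re (f t) * Re (g t)) (fun t => Im (f t) * Im (g t))); apply rder_mult; eassumption.
    + unfold Re, Im; simpl. ring.
  - eapply is_derive_eq.
    + apply (rder_plus (fun t => Re (f t) * Im (g t)) (fun t => Im (f t) * Re (g t))); apply rder_mult; eassumption.
    + unfold Re, Im; simpl. ring.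
Qed.

Lemma cder_scal c f x a : cder f x a -> cder (fun t => c * f t)%C x (c * a)%C.
Proof. intros H. eapply cder_eq; [apply cder_mult; [apply cder_const|exact H]|]. cbv beta. ring. Qed.

Lemma cder_RtoC (f : R -> R) (x a : R) : is_derive f x a -> cder (fun t => RtoC (f t)) x (RtoC a).
Proof. intros H. split; [exact H|exact (is_derive_const (V := R_NormedModule) (K := R_AbsRing) 0 x)]. Qed.

Lemma cder_comp_lin f u v x a : cder f (u * x + v) a -> cder (fun t => f (u * t + v)) x (RtoC u * a)%C.
Proof.
  assert (L : is_derive (fun t => u * t + v) x u) by (auto_derive; [easy|ring]).
  intros [H1 H2]. split.
  - eapply is_derive_eq; [apply (is_derive_comp (fun t => Re (f t)) (fun t => u * t + v)); [exact H1|exact L]|].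
    unfold scal, mult, Re; simpl. unfold mult; simpl. ring.
  - eapply is_derive_eq; [apply (is_derive_comp (fun t => Im (f t)) (fun t => u * t + v)); [exact H2|exact L]|].
    unfold scal, mult, Im; simpl. unfold mult; simpl. ring.
Qed.

Lemma cder_cexpi_lin a x : cder (fun t => cexpi (a * t)) x (Ci * RtoC a * cexpi (a * x))%C.
Proof.
  split; unfold Re, Im; simpl; auto_derive; try easy; ring.
Qed.

(** * Fourier transform and convolution *)

Lemma ccont_kernel y : ccont (fun x => cexpi (- 2 * PI * x * y)).
Proof. apply (ccont_ext (fun x => cexpi ((- 2 * PI * y) * x))); [intros; f_equal; ring|]. apply ccont_cexpi_lin. Qed.

Lemma Cc_kernel f y : Cc f -> Cc (fun x => f x * cexpi (- 2 * PI * x * y))%C.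
Proof. intros H. apply Cc_mult; [easy|apply ccont_kernel]. Qed.

Lemma supp_mult r f g : supp r f -> supp r (fun x => f x * g x)%C.
Proof. intros S x Hx. rewrite S by easy. ring. Qed.

Lemma fourier_CI f r y : ccont f -> supp r f -> 0 <= r ->
  fourier f y = CI (fun x => f x * cexpi (- 2 * PI * x * y))%C (-r) r.
Proof.
  intros Hf S Hr. apply integral_CI; [|now apply supp_mult|easy].
  apply ccont_mult; [easy|apply ccont_kernel].
Qed.

Lemma fourier_fadd f g : Cc f -> Cc g -> fourier (fadd f g) = fadd (fourier f) (fourier g).
Proof.
  intros H G. extensionality y. unfold fourier, fadd.
  rewrite <- integral_plus by now apply Cc_kernel. f_equal. extensionality x. ring.
Qed.

Lemma fourier_fscal a f : Cc f -> fourier (fscal a f) = fscal a (fourier f).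
Proof.
  intros H. extensionality y. unfold fourier, fscal.
  rewrite <- integral_scal by now apply Cc_kernel. f_equal. extensionality x. ring.
Qed.

Lemma csum_mult_r n a c : (csum n a * c)%C = csum n (fun i => a i * c)%C.
Proof. induction n; simpl; [ring|]. rewrite <- IHn. ring. Qed.

Lemma fourier_csum n F : (forall i, (i < n)%nat -> Cc (F i)) ->
  fourier (fun x => csum n (fun i => F i x)) = fun y => csum n (fun i => fourier (F i) y).
Proof.
  intros H. extensionality y. unfold fourier.
  rewrite <- (integral_csum n (fun i x => F i x * cexpi (- 2 * PI * x * y))%C).
  - f_equal. extensionality x. apply csum_mult_r.
  - intros. apply Cc_kernel. now apply H.
Qed.

Lemma fourier_shift f a y : Cc f -> fourier (fun x => f (x + a)) y = (cexpi (2 * PI * a * y) * fourier f y)%C.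
Proof.
  intros H. unfold fourier. rewrite <- (integral_shift (fun x => f x * cexpi (- 2 * PI * x * y))%C a) by now apply Cc_kernel.
  rewrite <- integral_scal.
  - f_equal. extensionality x.
    replace (- 2 * PI * x * y) with (2 * PI * a * y + - 2 * PI * (x + a) * y) by ring. rewrite cexpi_plus. ring.
  - apply (Cc_shift (fun x => f x * cexpi (- 2 * PI * x * y))%C). now apply Cc_kernel.
Qed.

Lemma fourier_modulate f s y : fourier (fun x => f x * cexpi (- 2 * PI * x * s))%C y = fourier f (s + y).
Proof.
  unfold fourier. f_equal. extensionality x. rewrite <- Cmult_assoc, <- cexpi_plus. do 2 f_equal. ring.
Qed.

Lemma fourier_reflect f y : Cc f -> fourier (fun x => f (- x)) y = fourier f (- y).
Proof.
  intros H. unfold fourier. rewrite <- (integral_opp (fun x => f x * cexpi (- 2 * PI * x * - y))%C) by now apply Cc_kernel.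
  f_equal. extensionality x. do 2 f_equal. ring.
Qed.

Lemma CI_conj f a b : ccont f -> CI (fun x => Cconj (f x)) a b = Cconj (CI f a b).
Proof.
  intros H. rewrite !CI_components; [|easy|now apply ccont_conj].
  apply injective_projections; cbn [fst snd Cconj]; [reflexivity|].
  rewrite (RInt_ext _ (fun x => -1 * Im (f x))) by (intros; unfold Im; simpl; ring).
  rewrite RI_scal by now apply (proj1 (ccont_iff f)). ring.
Qed.

Lemma Cconj_mult a b : Cconj (a * b) = (Cconj a * Cconj b)%C.
Proof. ceq. Qed.

Lemma fourier_conj_reflect f y : Cc f -> fourier (fun x => Cconj (f (- x))) y = Cconj (fourier f y).
Proof.
  intros H. rewrite (fourier_reflect (fun x => Cconj (f x))) by now apply Cc_conj.
  destruct (Cc_supp f H) as (r & Hr & S).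
  rewrite (fourier_CI _ r); [|now apply ccont_conj, Cc_ccont|intros x Hx; rewrite S by easy; ceq|lra].
  rewrite (fourier_CI f r) by (auto using Cc_ccont; lra).
  rewrite <- CI_conj.
  - apply CI_ext. intros x _. rewrite Cconj_mult, <- cexpi_opp. do 2 f_equal. ring.
  - apply ccont_mult; [now apply Cc_ccont|apply ccont_kernel].
Qed.

Lemma fourier_bound f r M y : ccont f -> supp r f -> 0 <= r -> (forall x, Cmod (f x) <= M) -> Cmod (fourier f y) <= 2 * r * M.
Proof.
  intros Hf S Hr B. apply integral_bound; [|now apply supp_mult|easy|].
  - apply ccont_mult; [easy|apply ccont_kernel].
  - intros x. rewrite Cmod_mult, Cmod_cexpi, Rmult_1_r. apply B.
Qed.

(** The constant 4 stands for PI, which bounds [atan r - atan (- r)]. *)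
Lemma RI_inv_1_sqr r : 0 <= r -> ex_RInt (fun x => / (1 + x ^ 2)) (-r) r /\ RInt (fun x => / (1 + x ^ 2)) (-r) r <= 4.
Proof.
  intros Hr.
  assert (G : is_RInt (fun x => / (1 + x ^ 2)) (-r) r (atan r - atan (- r))).
  { apply (is_RInt_derive (V := R_CompleteNormedModule) atan (fun x => / (1 + x ^ 2))).
    - intros x _. replace (x ^ 2) with (Rsqr x) by (unfold Rsqr; ring). apply is_derive_atan.
    - intros x _. apply (ex_derive_continuous (V := R_NormedModule)). auto_derive. nra. }
  split; [eexists; exact G|]. rewrite (is_RInt_unique _ _ _ _ G).
  pose proof (atan_bound r). pose proof (atan_bound (- r)). pose proof PI_4. lra.
Qed.

Lemma CI_bound_decay f B r : 0 <= r -> 0 <= B -> ccont f -> (forall x, -r <= x <= r -> Cmod (f x) <= B / (1 + x ^ 2)) -> Cmod (CI f (-r) r) <= 4 * B.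
Proof.
  intros Hr HB Hf H. destruct (RI_inv_1_sqr r Hr) as [E L].
  eapply Rle_trans; [apply (CI_bound f (fun x => B * / (1 + x ^ 2)))|]; [lra|easy| |exact H|].
  - apply (ex_RInt_scal (V := R_NormedModule) _ _ _ B E).
  - eapply Rle_trans; [right; exact (RInt_scal (V := R_CompleteNormedModule) (fun x => / (1 + x ^ 2)) (-r) r B E)|].
    change (B * RInt (fun x => / (1 + x ^ 2)) (- r) r <= 4 * B). rewrite (Rmult_comm 4). now apply Rmult_le_compat_l.
Qed.

(** Unlike in [fourier_bound], the bound does not involve the support, so it is uniform over the
    cutoffs of a Schwartz function. *)
Lemma fourier_bound_decay f B y : Cc f -> 0 <= B -> (forall x, Cmod (f x) <= B / (1 + x ^ 2)) -> Cmod (fourier f y) <= 4 * B.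
Proof.
  intros H HB Hf. destruct (Cc_supp f H) as (r & Hr & S).
  rewrite (fourier_CI f r) by (auto using Cc_ccont; lra). apply CI_bound_decay; [lra|easy| |].
  - apply ccont_mult; [now apply Cc_ccont|apply ccont_kernel].
  - intros x _. rewrite Cmod_mult, Cmod_cexpi, Rmult_1_r. apply Hf.
Qed.

Lemma Cc_mul_id f : Cc f -> Cc (fun x => (- (2 * PI)) * Ci * RtoC x * f x)%C.
Proof.
  intros H. apply (Cc_mult_l (fun x => (- (2 * PI)) * Ci * RtoC x)%C f); [|easy].
  apply (ccont_mult (fun _ => (- (2 * PI)) * Ci)%C); [apply ccont_const|].
  apply ccont_RtoC. intros; apply continuous_id.
Qed.

Lemma fourier_cder f y : Cc f -> cder (fourier f) y (fourier (fun x => (- (2 * PI)) * Ci * RtoC x * f x)%C y).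
Proof.
  intros H. destruct (Cc_supp f H) as (r & Hr & S).
  set (f1 := (fun x => (- (2 * PI)) * Ci * RtoC x * f x)%C).
  assert (H1 : Cc f1) by now apply Cc_mul_id.
  assert (S1 : supp r f1). { intros x Hx. unfold f1. rewrite S by easy. ring. }
  rewrite (fourier_CI f1 r) by (auto using Cc_ccont; lra).
  apply (cder_ext (fun y => CI (fun x => f x * cexpi (- 2 * PI * x * y))%C (-r) r)).
  { intros t. symmetry. apply fourier_CI; auto using Cc_ccont; lra. }
  apply (CI_param_derive (fun y x => f x * cexpi (- 2 * PI * x * y))%C (fun y x => f1 x * cexpi (- 2 * PI * x * y))%C); [lra|..].
  - apply c2_mult.
    + apply (c2_comp f1 (fun u v => v)); [now apply Cc_ccont|apply rc2_snd].
    + apply c2_comp; [apply ccont_cexpi|]. apply rc2_mult; [apply rc2_mult; [apply rc2_const|apply rc2_snd]|apply rc2_fst].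
  - intros t. apply ccont_mult; [now apply Cc_ccont|apply ccont_kernel].
  - intros t x. eapply cder_eq; [apply cder_scal|].
    + apply (cder_ext (fun u => cexpi ((- 2 * PI * x) * u))); [easy|]. apply cder_cexpi_lin.
    + unfold f1. ceq.
Qed.

Lemma ccont_fourier f : Cc f -> ccont (fourier f).
Proof. intros H. eapply cder_ccont. intros x. now apply fourier_cder. Qed.

Lemma fourier_of_cder f f' y : Cc f -> Cc f' -> (forall x, cder f x (f' x)) ->
  fourier f' y = (2 * PI * Ci * RtoC y * fourier f y)%C.
Proof.
  intros H H' D. destruct (Cc_supp f H) as (r & Hr & S). destruct (Cc_supp f' H') as (r' & Hr' & S').
  set (R0 := r + r' + 1).
  rewrite (fourier_CI f R0), (fourier_CI f' R0); unfold R0;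
    [|now apply Cc_ccont|eapply supp_mono; eauto; lra|lra|now apply Cc_ccont|eapply supp_mono; eauto; lra|lra].
  fold R0.
  set (E := fun x => cexpi (- 2 * PI * x * y)).
  assert (HE : ccont E) by apply ccont_kernel.
  assert (G : forall x, cder (fun x => f x * E x)%C x (f' x * E x + (- (2 * PI) * Ci * RtoC y) * (f x * E x))%C).
  { intros x. eapply cder_eq; [apply cder_mult; [apply D|]|].
    - apply (cder_ext (fun u => cexpi ((- 2 * PI * y) * u))); [intros; unfold E; f_equal; ring|]. apply cder_cexpi_lin.
    - unfold E. replace (- 2 * PI * y * x) with (- 2 * PI * x * y) by ring.
      replace (RtoC (- 2 * PI * y)) with (- (2 * PI) * RtoC y)%C by ceq. ring. }
  (* Integration by parts: [f * E] vanishes at both ends, so its derivative integrates to zero. *)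
  assert (Z : CI (fun x => f' x * E x + (- (2 * PI) * Ci * RtoC y) * (f x * E x))%C (-R0) R0 = RtoC 0).
  { rewrite (CI_FTC (fun x => f x * E x)%C).
    - rewrite (S R0), (S (- R0)); [ring|rewrite Rabs_Ropp|]; rewrite Rabs_right; unfold R0; lra.
    - apply ccont_plus; [|apply ccont_mult; [apply ccont_const|]]; apply ccont_mult; auto using Cc_ccont.
    - intros x. apply G.
    - intros x. apply G. }
  rewrite CI_plus in Z.
  - rewrite CI_scal in Z by (apply ccont_mult; auto using Cc_ccont).
    change (fun x => f' x * cexpi (- 2 * PI * x * y))%C with (fun x => f' x * E x)%C.
    change (fun x => f x * cexpi (- 2 * PI * x * y))%C with (fun x => f x * E x)%C.
    revert Z. generalize (CI (fun x => f' x * E x)%C (- R0) R0) (CI (fun x => f x * E x)%C (- R0) R0). intros a b Z.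
    transitivity ((a + - (2 * PI) * Ci * RtoC y * b) + 2 * PI * Ci * RtoC y * b)%C; [ring|]. rewrite Z. ring.
  - apply ccont_mult; auto using Cc_ccont.
  - apply ccont_mult; [apply ccont_const|]. apply ccont_mult; auto using Cc_ccont.
Qed.

Lemma conv_CI g h r x : ccont g -> ccont h -> supp r h -> 0 <= r -> conv g h x = CI (fun y => g (x - y)%R * h y)%C (-r) r.
Proof.
  intros Hg Hh S Hr. apply integral_CI; [|intros y Hy; rewrite S by easy; ring|easy].
  apply ccont_mult; [|easy]. apply (ccont_ext (fun y => g (-1 * y + x))); [intros; f_equal; ring|]. now apply ccont_lin.
Qed.

Lemma supp_conv g h r s : ccont g -> ccont h -> supp r g -> supp s h -> 0 <= s -> supp (r + s) (conv g h).
Proof.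
  intros Hg Hh S1 S2 Hs x Hx. rewrite (conv_CI g h s) by auto. apply CI_zero; [lra|].
  intros y Hy. rewrite S1; [ring|]. assert (Rabs y <= s) by (apply Rabs_le; lra).
  pose proof (Rabs_triang (x - y) y). replace (x - y + y) with x in * by ring. lra.
Qed.

Lemma rc2_sub : rc2 (fun u v => u - v).
Proof. apply rc2_minus; [apply rc2_fst|apply rc2_snd]. Qed.

Lemma Cc_conv g h : Cc g -> Cc h -> Cc (conv g h).
Proof.
  intros Hg Hh. destruct (Cc_supp g Hg) as (r & Hr & S1). destruct (Cc_supp h Hh) as (s & Hs & S2).
  apply (Cc_intro _ (r + s)).
  - apply (ccont_ext (fun x => CI (fun y => g (x - y)%R * h y)%C (-s) s)).
    + intros x. symmetry. apply conv_CI; auto using Cc_ccont; lra.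
    + apply (CI_param_cont (fun x y => g (x - y)%R * h y)%C); [lra|]. apply c2_mult.
      * apply c2_comp; [now apply Cc_ccont|apply rc2_sub].
      * apply (c2_comp h (fun u v => v)); [now apply Cc_ccont|apply rc2_snd].
  - apply supp_conv; auto using Cc_ccont. lra.
Qed.

Lemma fourier_conv g h y : Cc g -> Cc h -> fourier (conv g h) y = (fourier g y * fourier h y)%C.
Proof.
  intros Hg Hh. destruct (Cc_supp g Hg) as (r & Hr & S1). destruct (Cc_supp h Hh) as (s & Hs & S2).
  assert (Cg := Cc_ccont _ Hg). assert (Ch := Cc_ccont _ Hh).
  set (E := fun x => cexpi (- 2 * PI * x * y)). assert (HE : ccont E) by apply ccont_kernel.
  rewrite (fourier_CI (conv g h) (r + s)); [|now apply Cc_ccont, Cc_conv|apply supp_conv; auto; lra|lra].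
  rewrite (CI_ext _ (fun x => CI (fun t => E x * (g (x - t)%R * h t))%C (-s) s)).
  2:{ intros x _. rewrite (conv_CI g h s) by (auto; lra). fold (E x). rewrite CI_scal; [ring|].
      apply ccont_mult; [|easy]. apply (ccont_ext (fun y => g (-1 * y + x))); [intros; f_equal; ring|]. now apply ccont_lin. }
  rewrite (CI_fubini (fun x t => E x * (g (x - t)%R * h t))%C); [|lra|lra|].
  2:{ apply c2_mult; [apply (c2_comp E (fun u v => u)); [easy|apply rc2_fst]|]. apply c2_mult.
      - apply c2_comp; [easy|apply rc2_sub].
      - apply (c2_comp h (fun u v => v)); [easy|apply rc2_snd]. }
  rewrite (fourier_CI h s y) by (auto; lra). rewrite <- CI_scal by (apply ccont_mult; auto).
  apply CI_ext. rewrite Rmin_left, Rmax_right by lra. intros t Ht.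
  set (G := fun x => (g x * E x)%C). assert (HG : Cc G) by now apply Cc_kernel.
  (* The outer interval has half-length [r + s] so that it contains the support of every translate
     of [g] by some |t| <= s; each inner integral is then the full transform of [g]. *)
  assert (SG : supp (r + s) (fun x => G (x + - t))).
  { intros x Hx. unfold G. rewrite S1; [ring|]. assert (Rabs t <= s) by (apply Rabs_le; lra).
    pose proof (Rabs_triang (x + - t) t). replace (x + - t + t) with x in * by ring. lra. }
  assert (I : fourier g y = CI (fun x => G (x + - t)) (- (r + s)) (r + s)).
  { rewrite <- (integral_CI (fun x => G (x + - t)) (r + s)); [|now apply ccont_shift, Cc_ccont|easy|lra].
    now rewrite (integral_shift G). }
  rewrite (CI_ext _ (fun x => (h t * E t) * G (x + - t)%R)%C).
  - rewrite CI_scal by now apply ccont_shift, Cc_ccont. rewrite <- I. unfold E. ring.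
  - intros x _. unfold G, E. replace (- 2 * PI * x * y) with (- 2 * PI * (x + - t) * y + - 2 * PI * t * y) by ring.
    rewrite cexpi_plus. unfold Rminus. ring.
Qed.

(** * Poisson summation *)

Fixpoint dirichlet (n : nat) (u : R) : R :=
  match n with O => 1 | S m => dirichlet m u + 2 * cos (2 * PI * INR n * u) end.

(** Not divided by [N]: this is [N] times the usual Fejer kernel. *)
Definition fejer (N : nat) (u : R) : R := rsum N (fun n => dirichlet n u).

Lemma zsum_cexpi_dirichlet n u : zsum n (fun k => cexpi (- 2 * PI * u * IZR k)) = RtoC (dirichlet n u).
Proof.
  induction n. { rewrite zsum_0, Rmult_0_r, cexpi_0. reflexivity. }
  rewrite zsum_S, IHn, opp_IZR, <- INR_IZR_INZ. cbn [dirichlet].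
  replace (- 2 * PI * u * - INR (S n)) with (2 * PI * INR (S n) * u) by ring.
  replace (- 2 * PI * u * INR (S n)) with (- (2 * PI * INR (S n) * u)) by ring.
  rewrite cexpi_opp. ceq.
Qed.

(** The identity 2 cos x sin y = sin (x + y) - sin (x - y) makes the sum telescope. *)
Lemma dirichlet_sin n u : dirichlet n u * sin (PI * u) = sin ((2 * INR n + 1) * (PI * u)).
Proof.
  induction n. { simpl. rewrite Rmult_0_r, Rplus_0_l, !Rmult_1_l. reflexivity. }
  cbn [dirichlet]. rewrite Rmult_plus_distr_r, IHn, S_INR.
  replace (2 * PI * (INR n + 1) * u) with ((2 * INR n + 2) * (PI * u)) by ring.
  replace ((2 * INR n + 1) * (PI * u)) with ((2 * INR n + 2) * (PI * u) - PI * u) by ring.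
  replace ((2 * (INR n + 1) + 1) * (PI * u)) with ((2 * INR n + 2) * (PI * u) + PI * u) by ring.
  rewrite sin_minus, sin_plus. ring.
Qed.

(** With a = N t and b = (N + 1) t the new term is sin (a + b) sin (b - a) = sin^2 b - sin^2 a, so
    the sum telescopes. Keeping the factor sin^2 on the left makes the identity valid at integers
    too. *)
Lemma fejer_sin N u : fejer N u * (sin (PI * u)) ^ 2 = (sin (INR N * (PI * u))) ^ 2.
Proof.
  induction N. { unfold fejer; simpl. rewrite !Rmult_0_l, sin_0. ring. }
  unfold fejer in *. cbn [rsum]. rewrite Rmult_plus_distr_r, IHN.
  replace (dirichlet N u * sin (PI * u) ^ 2) with ((dirichlet N u * sin (PI * u)) * sin (PI * u)) by ring.
  rewrite dirichlet_sin, S_INR.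
  set (t := PI * u). set (a := INR N * t).
  replace ((2 * INR N + 1) * t) with (a + (a + t)) by (unfold a; ring).
  replace ((INR N + 1) * t) with (a + t) by (unfold a; ring).
  replace t with ((a + t) - a) at 2 by ring.
  generalize (a + t). intros b. rewrite sin_plus, sin_minus.
  pose proof (sin2_cos2 a). pose proof (sin2_cos2 b). unfold Rsqr in *.
  assert (E1 : cos a * cos a = 1 - sin a * sin a) by lra. assert (E2 : cos b * cos b = 1 - sin b * sin b) by lra.
  transitivity (sin a ^ 2 + (sin b * sin b * (cos a * cos a) - sin a * sin a * (cos b * cos b))); [ring|].
  rewrite E1, E2. ring.
Qed.

Lemma dirichlet_period n u j : dirichlet n (u + IZR j) = dirichlet n u.
Proof.
  induction n; [easy|]. cbn [dirichlet]. rewrite IHn. do 2 f_equal.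
  pose proof (cexpi_periodic (2 * PI * INR (S n) * u) (Z.of_nat (S n) * j)) as H.
  apply (f_equal fst) in H. cbn [fst cexpi] in H. rewrite <- H. f_equal. rewrite mult_IZR, <- INR_IZR_INZ. ring.
Qed.

Lemma fejer_period N u j : fejer N (u + IZR j) = fejer N u.
Proof. apply rsum_ext. intros. apply dirichlet_period. Qed.

Lemma dirichlet_at_0 n : 0 <= dirichlet n 0.
Proof. induction n; cbn [dirichlet]; [lra|]. rewrite Rmult_0_r, cos_0. lra. Qed.

Lemma fejer_nonneg N u : 0 <= fejer N u.
Proof.
  destruct (Req_dec (sin (PI * u)) 0) as [Z|Z].
  (* The closed form says nothing where the sine vanishes. There [u] is an integer, and periodicity
     reduces to 0, where every Dirichlet kernel is nonnegative. *)
  - destruct (sin_eq_0_0 _ Z) as [k Hk].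
    assert (u = 0 + IZR k) as ->. { apply (Rmult_eq_reg_l PI); [lra|]. pose proof PI_RGT_0. lra. }
    rewrite fejer_period. apply rsum_ge_0. intros. apply dirichlet_at_0.
  - assert (0 < sin (PI * u) ^ 2) by (rewrite <- Rsqr_pow2; now apply Rsqr_pos_lt).
    apply (Rmult_le_reg_r (sin (PI * u) ^ 2)); [easy|]. rewrite fejer_sin, Rmult_0_l. apply pow2_ge_0.
Qed.

(** Away from the integers the kernel stays bounded as [N] grows, while its mass over a period grows
    like [N]. *)
Lemma fejer_far N u s : 0 < s -> s <= sin (PI * u) ^ 2 -> fejer N u <= / s.
Proof.
  intros Hs H. apply (Rmult_le_reg_r s); [easy|]. rewrite Rinv_l by lra.
  apply Rle_trans with (fejer N u * sin (PI * u) ^ 2).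
  - apply Rmult_le_compat_l; [apply fejer_nonneg|easy].
  - rewrite fejer_sin. pose proof (SIN_bound (INR N * (PI * u))). nra.
Qed.

Lemma rcont_dirichlet n a x : continuous (fun x => dirichlet n (a * x)) x.
Proof.
  induction n; cbn [dirichlet]; [apply continuous_const|]. apply rcont_plus; [easy|].
  apply rcont_mult; [apply continuous_const|].
  apply (continuous_comp (fun x => 2 * PI * INR (S n) * (a * x)) cos); [|apply continuous_cos].
  apply rcont_mult; [apply continuous_const|]. apply rcont_mult; [apply continuous_const|apply continuous_id].
Qed.

Lemma rcont_fejer N a x : continuous (fun x => fejer N (a * x)) x.
Proof.
  unfold fejer. induction N; simpl; [apply continuous_const|]. apply rcont_plus; [easy|apply rcont_dirichlet].
Qed.

Lemma RI_dirichlet n a : 0 < a -> RInt (fun x => dirichlet n (a * x)) (- (/ (2 * a))) (/ (2 * a)) = / a.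
Proof.
  intros Ha. induction n.
  - cbn [dirichlet]. rewrite RInt_const. unfold scal; simpl; unfold mult; simpl. field. lra.
  - cbn [dirichlet]. rewrite RI_plus, IHn.
    (* Over a full period of length 1/a the added cosine integrates to zero: its primitive is a sine
       vanishing at both ends. *)
    + rewrite (is_RInt_unique (V := R_CompleteNormedModule) _ _ _ 0); [lra|].
      set (c := 2 * PI * INR (S n) * a).
      assert (Hc : c <> 0).
      { unfold c. pose proof PI_RGT_0. assert (0 < INR (S n)) by (apply lt_0_INR; lia). apply Rgt_not_eq. apply Rmult_lt_0_compat; [apply Rmult_lt_0_compat|]; lra. }
      replace 0 with (minus (2 * / c * sin (c * / (2 * a))) (2 * / c * sin (c * - / (2 * a)))).
      * apply (is_RInt_derive (V := R_CompleteNormedModule) (fun x => 2 * / c * sin (c * x))).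
        -- intros x _. auto_derive; [easy|]. replace (2 * PI * INR (S n) * (a * x)) with (c * x) by (unfold c; ring). field. easy.
        -- intros x _. apply rcont_mult; [apply continuous_const|].
           apply (continuous_comp (fun x => 2 * PI * INR (S n) * (a * x)) cos); [|apply continuous_cos].
           apply rcont_mult; [apply continuous_const|]. apply rcont_mult; [apply continuous_const|apply continuous_id].
      * replace (c * - / (2 * a)) with (- (INR (S n) * PI)) by (unfold c; field; lra).
        replace (c * / (2 * a)) with (INR (S n) * PI) by (unfold c; field; lra).
        rewrite sin_neg. replace (sin (INR (S n) * PI)) with 0; [unfold minus, plus, opp; simpl; ring|].
        symmetry. apply sin_eq_0_1. exists (Z.of_nat (S n)). now rewrite <- INR_IZR_INZ.
    + intros. apply rcont_dirichlet.
    + intros x. apply rcont_mult; [apply continuous_const|].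
      apply (continuous_comp (fun x => 2 * PI * INR (S n) * (a * x)) cos); [|apply continuous_cos].
      apply rcont_mult; [apply continuous_const|]. apply rcont_mult; [apply continuous_const|apply continuous_id].
Qed.

Lemma RI_fejer N a : 0 < a -> RInt (fun x => fejer N (a * x)) (- (/ (2 * a))) (/ (2 * a)) = INR N / a.
Proof.
  intros Ha. unfold fejer. induction N.
  - simpl. rewrite RInt_const. unfold scal; simpl; unfold mult; simpl. field. lra.
  - cbn [rsum]. rewrite RI_plus, IHN, RI_dirichlet by (auto; intros; try apply rcont_fejer; apply rcont_dirichlet).
    rewrite S_INR. req. field. lra.
Qed.

(** The kernel is nonnegative with mass N/a. Near 0 continuity of [G] makes the error a small
    multiple of this mass; the rest contributes a constant that division by N removes. *)
Lemma fejer_approx_identity (G : R -> R) a : 0 < a -> (forall x, continuous G x) ->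
  is_lim_seq (fun N => RInt (fun x => G x * fejer (S N) (a * x)) (- (/ (2 * a))) (/ (2 * a)) / INR (S N)) (G 0 / a).
Proof.
  intros Ha HG. set (b := / (2 * a)). assert (Hb : 0 < b) by (apply Rinv_0_lt_compat; lra).
  assert (Hab : a * b = / 2) by (unfold b; field; lra).
  destruct (rcont_bounded G (-b) b HG) as (M & HM & BM).
  apply is_lim_seq_spec. intros [e He]. cbn [pos].
  (* Multiplied by the mass N/a and divided by N, this tolerance contributes e/4. *)
  assert (He' : 0 < e * a / 4) by (apply Rmult_lt_0_compat; [apply Rmult_lt_0_compat|]; lra).
  assert (D : exists d, 0 < d < b /\ forall x, Rabs x < d -> Rabs (G x - G 0) <= e * a / 4).
  { destruct (proj1 (filterlim_locally (U := R_UniformSpace) G (G 0)) (HG 0) (mkposreal _ He')) as [d Hd].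
    exists (Rmin d (b / 2)). pose proof (cond_pos d). split; [split; [apply Rmin_pos; lra|]|].
    - eapply Rle_lt_trans; [apply Rmin_r|lra].
    - intros x Hx. left. apply (Hd x). change (Rabs (x - 0) < d). rewrite Rminus_0_r.
      eapply Rlt_le_trans; [exact Hx|apply Rmin_l]. }
  destruct D as (d & [Hd0 Hdb] & D).
  set (s := sin (PI * (a * d)) ^ 2).
  pose proof PI_RGT_0 as Hpi.
  assert (Had : 0 < a * d) by (apply Rmult_lt_0_compat; lra).
  assert (Had2 : a * d < / 2) by (rewrite <- Hab; apply Rmult_lt_compat_l; lra).
  assert (Hs1 : 0 < sin (PI * (a * d))).
  { apply sin_gt_0; [now apply Rmult_lt_0_compat|]. nra. }
  assert (Hs : 0 < s) by (unfold s; now apply pow_lt).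
  assert (FAR : forall N x, -b <= x <= b -> d <= Rabs x -> fejer N (a * x) <= / s).
  { intros N x Hx Hdx. apply fejer_far; [easy|]. unfold s.
    assert (S1 : sin (PI * (a * x)) ^ 2 = sin (PI * (a * Rabs x)) ^ 2).
    { unfold Rabs. destruct (Rcase_abs x); [|easy].
      replace (PI * (a * - x)) with (- (PI * (a * x))) by ring. rewrite sin_neg. ring. }
    (* As [a * b = / 2], the arguments lie between 0 and PI/2, where the sine increases. *)
    rewrite S1. apply pow_incr. split; [lra|].
    assert (Rabs x <= b) by now apply Rabs_le.
    assert (a * d <= a * Rabs x) by (apply Rmult_le_compat_l; lra).
    assert (a * Rabs x <= / 2) by (rewrite <- Hab; apply Rmult_le_compat_l; lra).
    apply sin_incr_1; nra. }
  (* The far part: length 2 b, oscillation of [G] at most 2 M, kernel at most 1/s. *)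
  set (K := 2 * b * (2 * M / s)).
  assert (HK : 0 < K) by (unfold K; repeat apply Rmult_lt_0_compat; try apply Rinv_0_lt_compat; lra).
  assert (EST : forall N, Rabs (RInt (fun x => G x * fejer N (a * x)) (-b) b - G 0 * (INR N / a)) <= e * a / 4 * (INR N / a) + K).
  { intros N.
    assert (CF : forall x, continuous (fun x => fejer N (a * x)) x) by (intros; apply rcont_fejer).
    replace (RInt (fun x => G x * fejer N (a * x)) (-b) b - G 0 * (INR N / a))
      with (RInt (fun x => G x * fejer N (a * x) + (- G 0) * fejer N (a * x)) (-b) b).
    2:{ pose proof (RI_fejer N a Ha) as RF. fold b in RF. rewrite RI_plus, RI_scal, RF; auto; [req; ring|..]; intros; apply rcont_mult; auto; apply continuous_const. }
    eapply Rle_trans; [apply abs_RInt_le; [lra|]|].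
    { apply ex_RI. intros; apply rcont_plus; apply rcont_mult; auto; apply continuous_const. }
    apply Rle_trans with (RInt (fun x => e * a / 4 * fejer N (a * x) + 2 * M / s) (-b) b).
    - apply RInt_le; [lra|..].
      + apply ex_RI. intros x. apply (continuous_comp (fun x => G x * fejer N (a * x) + (- G 0) * fejer N (a * x)) Rabs); [|apply continuous_Rabs].
        apply rcont_plus; apply rcont_mult; auto; apply continuous_const.
      + apply ex_RI. intros x. apply rcont_plus; [apply rcont_mult; auto|]; apply continuous_const.
      + intros x Hx. replace (G x * fejer N (a * x) + - G 0 * fejer N (a * x)) with ((G x - G 0) * fejer N (a * x)) by ring.
        pose proof (fejer_nonneg N (a * x)) as F0. rewrite Rabs_mult, (Rabs_right (fejer _ _)) by lra.
        assert (Q : 0 < 2 * M / s) by (apply Rdiv_lt_0_compat; lra).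
        destruct (Rlt_le_dec (Rabs x) d) as [h|h].
        * specialize (D x h). assert (Rabs (G x - G 0) * fejer N (a * x) <= e * a / 4 * fejer N (a * x)) by (apply Rmult_le_compat_r; lra). lra.
        * specialize (FAR N x ltac:(lra) h).
          assert (Rabs (G x - G 0) <= 2 * M).
          { eapply Rle_trans; [apply Rabs_triang|]. rewrite Rabs_Ropp. pose proof (BM x ltac:(lra)). pose proof (BM 0 ltac:(lra)). lra. }
          assert (Rabs (G x - G 0) * fejer N (a * x) <= 2 * M * / s) by (apply Rmult_le_compat; auto; apply Rabs_pos).
          assert (0 <= e * a / 4 * fejer N (a * x)) by (apply Rmult_le_pos; lra). unfold Rdiv in *. lra.
    - rewrite RI_plus, RI_scal, RInt_const; auto; try (intros; apply continuous_const).
      + pose proof (RI_fejer N a Ha) as RF. fold b in RF. rewrite RF. right. unfold scal; simpl; unfold mult; simpl. unfold K. ring.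
      + intros; apply rcont_mult; auto; apply continuous_const. }
  destruct (archimed (4 * K / e)) as [HN _].
  exists (Z.to_nat (up (4 * K / e))). intros n Hn.
  assert (Hn' : 4 * K / e < INR (S n)).
  { assert (0 < 4 * K / e) by (apply Rdiv_lt_0_compat; lra).
    assert (0 < up (4 * K / e))%Z by (apply lt_IZR; lra).
    apply Rlt_le_trans with (IZR (up (4 * K / e))); [easy|]. rewrite INR_IZR_INZ. apply IZR_le. lia. }
  specialize (EST (S n)). set (I := RInt _ _ _) in *. set (m := INR (S n)) in *.
  assert (Hm : 0 < m) by (unfold m; apply lt_0_INR; lia).
  replace (I / m - G 0 / a) with ((I - G 0 * (m / a)) * / m) by (field; lra).
  rewrite Rabs_mult, (Rabs_right (/ m)) by (left; now apply Rinv_0_lt_compat).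
  apply (Rmult_lt_reg_r m); [easy|]. rewrite Rmult_assoc, Rinv_l, Rmult_1_r by lra.
  eapply Rle_lt_trans; [exact EST|].
  replace (e * a / 4 * (m / a)) with (e * m / 4) by (field; lra).
  assert (K < e * m / 4). { apply (Rmult_lt_reg_l (4 / e)); [apply Rdiv_lt_0_compat; lra|]. 
    replace (4 / e * K) with (4 * K / e) by (field; lra). replace (4 / e * (e * m / 4)) with m by (field; lra). easy. }
  assert (0 < e * m) by (apply Rmult_lt_0_compat; lra). lra.
Qed.

Lemma clim_csum n (u : nat -> nat -> C) l : (forall i, (i < n)%nat -> clim (fun N => u N i) (l i)) -> clim (fun N => csum n (u N)) (csum n l).
Proof.
  induction n; intros H; simpl; [apply clim_const|]. apply clim_plus; [apply IHn; intros; apply H; lia|apply H; lia].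
Qed.

Lemma clim_zsum n (u : nat -> Z -> C) l : (forall k, clim (fun N => u N k) (l k)) -> clim (fun N => zsum n (u N)) (zsum n l).
Proof. intros H. apply (clim_csum _ (fun N i => u N (Z.of_nat i - Z.of_nat n)%Z)). intros; apply H. Qed.

(** The half period in the bounds comes from using the 2 J + 1 periods centred at the multiples of
    [p]. *)
Lemma CI_unfold_periods f p J : 0 < p -> ccont f ->
  CI f (- (p * (INR J + / 2))) (p * (INR J + / 2)) = zsum J (fun j => CI (fun x => f (x + IZR j * p)) (- (p * / 2)) (p * / 2)).
Proof.
  intros Hp Hf.
  assert (Sh : forall j, CI (fun x => f (x + IZR j * p)) (- (p * / 2)) (p * / 2) = CI f (IZR j * p - p * / 2) (IZR j * p + p * / 2)).
  { intros j. rewrite (CI_ext _ (fun x => f (1 * x + IZR j * p))) by (intros; f_equal; ring).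
    rewrite CI_lin by (auto; lra). rewrite Rinv_1.
    replace (1 * - (p * / 2) + IZR j * p) with (IZR j * p - p * / 2) by ring.
    replace (1 * (p * / 2) + IZR j * p) with (IZR j * p + p * / 2) by ring. ring. }
  induction J.
  - rewrite zsum_0, Sh. simpl. f_equal; ring.
  - rewrite zsum_S, <- IHJ, !Sh. rewrite opp_IZR, <- INR_IZR_INZ, S_INR.
    rewrite <- (CI_Chasles f (- (p * (INR J + 1 + / 2))) (- (p * (INR J + / 2))) (p * (INR J + 1 + / 2))) by easy.
    rewrite <- (CI_Chasles f (- (p * (INR J + / 2))) (p * (INR J + / 2)) (p * (INR J + 1 + / 2))) by easy.
    replace (- (INR J + 1) * p - p * / 2) with (- (p * (INR J + 1 + / 2))) by field.
    replace (- (INR J + 1) * p + p * / 2) with (- (p * (INR J + / 2))) by field.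
    replace ((INR J + 1) * p - p * / 2) with (p * (INR J + / 2)) by field.
    replace ((INR J + 1) * p + p * / 2) with (p * (INR J + 1 + / 2)) by field. ring.
Qed.

Lemma fourier_zsum_dirichlet g a n : Cc g ->
  zsum n (fun k => fourier g (IZR k * a)) = integral (fun x => RtoC (dirichlet n (a * x)) * g x)%C.
Proof.
  intros H. unfold fourier, zsum. rewrite <- (integral_csum _ (fun i x => g x * cexpi (- 2 * PI * x * (IZR (Z.of_nat i - Z.of_nat n) * a)))%C).
  - f_equal. extensionality x. rewrite <- zsum_cexpi_dirichlet. unfold zsum. rewrite csum_mult_r.
    apply csum_ext. intros i _. rewrite Cmult_comm. do 2 f_equal. ring.
  - intros. now apply Cc_kernel.
Qed.

Lemma ccont_dirichlet n a : ccont (fun x => RtoC (dirichlet n (a * x))).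
Proof. apply ccont_RtoC. intros; apply rcont_dirichlet. Qed.

Lemma RtoC_rsum n a : RtoC (rsum n a) = csum n (fun i => RtoC (a i)).
Proof. induction n; simpl; [easy|]. now rewrite RtoC_plus, IHn. Qed.

Lemma fourier_csum_fejer g a N : Cc g ->
  csum N (fun n => zsum n (fun k => fourier g (IZR k * a))) = integral (fun x => RtoC (fejer N (a * x)) * g x)%C.
Proof.
  intros H. rewrite (csum_ext _ _ (fun n => integral (fun x => RtoC (dirichlet n (a * x)) * g x)%C)) by (intros; now apply fourier_zsum_dirichlet).
  rewrite <- (integral_csum _ (fun n x => RtoC (dirichlet n (a * x)) * g x)%C).
  - f_equal. extensionality x. unfold fejer. rewrite RtoC_rsum. symmetry. apply csum_mult_r.
  - intros. apply Cc_mult_l; [apply ccont_dirichlet|easy].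
Qed.

(** The condition on [J] makes 2 J + 1 periods of length 1/a cover the support. As the kernel is
    periodic, each of them reduces to [fejer_approx_identity] for a translate of [g]. No decay of
    the transform enters. *)
Lemma poisson_cesaro g a r J : 0 < a -> ccont g -> supp r g -> 0 <= r -> r <= (INR J + / 2) / a ->
  clim (fun N => RtoC (/ INR (S N)) * csum (S N) (fun n => zsum n (fun k => fourier g (IZR k * a))))%C
       (RtoC (/ a) * zsum J (fun j => g (IZR j / a)%R))%C.
Proof.
  intros Ha Hg S Hr HJ. assert (H : Cc g) by (eapply Cc_intro; eauto).
  assert (E : forall N, (RtoC (/ INR (Datatypes.S N)) * csum (Datatypes.S N) (fun n => zsum n (fun k => fourier g (IZR k * a))))%C =
     zsum J (fun j => RtoC (/ INR (Datatypes.S N)) * CI (fun x => RtoC (fejer (Datatypes.S N) (a * x)) * g (x + IZR j / a)%R)%C (- (/ (2 * a))) (/ (2 * a)))%C).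
  { intros N. rewrite zsum_scal. f_equal. rewrite fourier_csum_fejer by easy.
    assert (CC : ccont (fun x => RtoC (fejer (Datatypes.S N) (a * x)) * g x)%C).
    { apply ccont_mult; [|easy]. apply ccont_RtoC. intros; apply rcont_fejer. }
    rewrite (integral_CI _ ((/ a) * (INR J + / 2))); [|easy| |].
    - rewrite CI_unfold_periods; [|now apply Rinv_0_lt_compat|easy]. apply zsum_ext. intros j _.
      replace (/ a * / 2) with (/ (2 * a)) by (field; lra). apply CI_ext. intros x _.
      replace (a * (x + IZR j * / a)) with (a * x + IZR j) by (field; lra). now rewrite fejer_period.
    - intros x Hx. rewrite S; [ring|]. unfold Rdiv in HJ. lra.
    - unfold Rdiv in HJ. lra. }
  apply (clim_eventually _ _ _ 0 (fun N _ => eq_sym (E N))).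
  rewrite <- zsum_scal. apply (clim_zsum J (fun N j => RtoC (/ INR (Datatypes.S N)) * CI (fun x => RtoC (fejer (Datatypes.S N) (a * x)) * g (x + IZR j / a)%R)%C (- (/ (2 * a))) (/ (2 * a)))%C).
  intros j. assert (Hj : ccont (fun x => g (x + IZR j / a))) by now apply ccont_shift.
  pose proof (proj1 (ccont_iff _) Hj) as [H1 H2].
  assert (CC : forall N, ccont (fun x => RtoC (fejer N (a * x)) * g (x + IZR j / a)%R)%C).
  { intros N. apply ccont_mult; [|easy]. apply ccont_RtoC. intros; apply rcont_fejer. }
  apply clim_components.
  - apply (is_lim_seq_ext (fun N => RInt (fun x => Re (g (x + IZR j / a)) * fejer (Datatypes.S N) (a * x)) (- (/ (2 * a))) (/ (2 * a)) / INR (Datatypes.S N))).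
    + intros N. rewrite CI_components by easy.
      rewrite (RInt_ext (fun x => Re (g (x + IZR j / a)) * fejer (Datatypes.S N) (a * x)) (fun t => Re (RtoC (fejer (Datatypes.S N) (a * t)) * g (t + IZR j / a)%R)%C)) by (intros; unfold Re; simpl; ring).
      unfold Rdiv; unfold Re at 2; cbn [fst snd Cmult RtoC]. ring.
    + replace (Re (RtoC (/ a) * g (IZR j / a)%R)%C) with (Re (g (0 + IZR j / a)) / a) by (rewrite Rplus_0_l; unfold Re, Rdiv; simpl; ring).
      now apply (fejer_approx_identity (fun x => Re (g (x + IZR j / a)))).
  - apply (is_lim_seq_ext (fun N => RInt (fun x => Im (g (x + IZR j / a)) * fejer (Datatypes.S N) (a * x)) (- (/ (2 * a))) (/ (2 * a)) / INR (Datatypes.S N))).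
    + intros N. rewrite CI_components by easy.
      rewrite (RInt_ext (fun x => Im (g (x + IZR j / a)) * fejer (Datatypes.S N) (a * x)) (fun t => Im (RtoC (fejer (Datatypes.S N) (a * t)) * g (t + IZR j / a)%R)%C)) by (intros; unfold Im; simpl; ring).
      unfold Rdiv; unfold Im at 2; cbn [fst snd Cmult RtoC]. ring.
    + replace (Im (RtoC (/ a) * g (IZR j / a)%R)%C) with (Im (g (0 + IZR j / a)) / a) by (rewrite Rplus_0_l; unfold Im, Rdiv; simpl; ring).
      now apply (fejer_approx_identity (fun x => Im (g (x + IZR j / a)))).
Qed.

Lemma csum_Re n a : Re (csum (S n) a) = sum_f_R0 (fun i => Re (a i)) n.
Proof. induction n; [unfold Re; simpl; ring|]. change (csum (S (S n)) a) with (csum (S n) a + a (S n))%C. cbn [sum_f_R0]. now rewrite <- IHn. Qed.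

Lemma csum_Im n a : Im (csum (S n) a) = sum_f_R0 (fun i => Im (a i)) n.
Proof. induction n; [unfold Im; simpl; ring|]. change (csum (S (S n)) a) with (csum (S n) a + a (S n))%C. cbn [sum_f_R0]. now rewrite <- IHn. Qed.

Lemma clim_cesaro u l : clim u l -> clim (fun N => RtoC (/ INR (S N)) * csum (S N) u)%C l.
Proof.
  intros H.
  assert (G : forall v m, is_lim_seq v (Finite m) -> is_lim_seq (fun N => / INR (S N) * sum_f_R0 v N) m).
  { intros v m Hv. apply is_lim_seq_Reals in Hv. apply Cesaro_1 in Hv. apply is_lim_seq_Reals in Hv.
    apply (is_lim_seq_incr_1 (fun n => sum_f_R0 v (Init.Nat.pred n) / INR n)) in Hv.
    revert Hv. apply is_lim_seq_ext. intros n. unfold Rdiv. apply Rmult_comm. }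
  apply clim_components.
  - apply (is_lim_seq_ext (fun N => / INR (S N) * sum_f_R0 (fun i => Re (u i)) N)); [|apply (G _ _ (clim_Re _ _ H))]. intros N. rewrite <- csum_Re. unfold Re. cbn [fst snd Cmult RtoC]. ring.
  - apply (is_lim_seq_ext (fun N => / INR (S N) * sum_f_R0 (fun i => Im (u i)) N)); [|apply (G _ _ (clim_Im _ _ H))]. intros N. rewrite <- csum_Im. unfold Im. cbn [fst snd Cmult RtoC]. ring.
Qed.

Lemma poisson g a r J l : 0 < a -> ccont g -> supp r g -> 0 <= r -> r <= (INR J + / 2) / a ->
  clim (fun n => zsum n (fun k => fourier g (IZR k * a))) l -> l = (RtoC (/ a) * zsum J (fun j => g (IZR j / a)%R))%C.
Proof.
  intros Ha Hg S Hr HJ H. apply clim_cesaro in H. eapply clim_unique; [exact H|]. eapply poisson_cesaro; eauto.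
Qed.

Lemma zsum_RtoC N a : zsum N (fun k => RtoC (a k)) = RtoC (zrsum N a).
Proof. unfold zsum, zrsum. now rewrite RtoC_rsum. Qed.

Lemma nat_above x : exists J, x <= INR J.
Proof.
  exists (Z.to_nat (up x)). destruct (archimed x) as [H _]. rewrite INR_IZR_INZ.
  eapply Rle_trans; [left; exact H|]. apply IZR_le. lia.
Qed.

Lemma nat_above_div x a : 0 < a -> exists J, x <= INR J / a.
Proof.
  intros Ha. destruct (nat_above (x * a)) as [J HJ]. exists J.
  apply (Rmult_le_reg_r a); [easy|]. replace (INR J / a * a) with (INR J) by (field; lra). easy.
Qed.

(* Bessel's inequality: the Fejer means of g * conj(g(-.)) have the nonnegative coefficients |g^|^2,
   so their boundedness bounds the partial sums. *)
Lemma bessel g a : 0 < a -> Cc g -> exists M, 0 <= M /\ forall N, zrsum N (fun k => Cmod (fourier g (IZR k * a)) ^ 2) <= M.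
Proof.
  intros Ha H. set (gt := fun x => Cconj (g (- x))).
  assert (Ht : Cc gt). { apply (Cc_conj (fun x => g (- x))). now apply Cc_opp_arg. }
  set (f := conv g gt). assert (Hf : Cc f) by now apply Cc_conv.
  destruct (Cc_supp f Hf) as (r & Hr & S). destruct (nat_above_div r a Ha) as [J HJ].
  set (b := fun k : Z => Cmod (fourier g (IZR k * a)) ^ 2).
  assert (Eb : forall k, fourier f (IZR k * a) = RtoC (b k)).
  { intros k. unfold f, b, gt. rewrite fourier_conv, fourier_conj_reflect by easy. rewrite <- Cmod2_conj. now rewrite RtoC_pow. }
  set (s := fun n => zrsum n b).
  assert (P := poisson_cesaro f a r J Ha (Cc_ccont _ Hf) S ltac:(lra)
    ltac:(eapply Rle_trans; [exact HJ|]; apply Rmult_le_compat_r; [left; now apply Rinv_0_lt_compat|lra])).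
  set (l := (RtoC (/ a) * _)%C) in P.
  apply clim_Re in P. apply is_lim_seq_spec in P. destruct (P (mkposreal 1 Rlt_0_1)) as [N0 HN0].
  assert (Hb0 : forall k, 0 <= b k) by (intros; apply pow2_ge_0).
  assert (HB : forall N, (N0 <= N)%nat -> rsum (Datatypes.S N) s <= INR (Datatypes.S N) * (Rabs (Re l) + 1)).
  { intros N HN. specialize (HN0 N HN). cbn [pos] in HN0.
    replace (csum (Datatypes.S N) _) with (RtoC (rsum (Datatypes.S N) s)) in HN0.
    2:{ rewrite RtoC_rsum. apply csum_ext. intros i _. unfold s. rewrite <- zsum_RtoC. apply zsum_ext. intros; now rewrite Eb. }
    replace (Re _) with (/ INR (Datatypes.S N) * rsum (Datatypes.S N) s) in HN0 by (unfold Re; cbn [fst snd Cmult RtoC]; ring).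
    assert (0 < INR (Datatypes.S N)) by (apply lt_0_INR; lia).
    apply (Rmult_le_reg_l (/ INR (Datatypes.S N))); [now apply Rinv_0_lt_compat|].
    rewrite <- Rmult_assoc, Rinv_l, Rmult_1_l by lra.
    apply Rabs_lt_between in HN0. pose proof (Rle_abs (Re l)). lra. }
  (* The partial sums increase, so the last n + 1 of the first 2 n + 1 are at least [s n]; a bound
     on their mean therefore bounds [s n] by twice as much. *)
  assert (Hs : forall n, (N0 <= n)%nat -> s n <= 2 * (Rabs (Re l) + 1)).
  { intros n Hn. specialize (HB (n + n)%nat ltac:(lia)).
    assert (L : forall m, INR m * s n <= rsum (n + m) s).
    { induction m; [simpl; rewrite Rmult_0_l; apply rsum_ge_0; intros; now apply zrsum_ge_0|].
      rewrite S_INR, Nat.add_succ_r. cbn [rsum].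
      assert (s n <= s (n + m)%nat) by (apply zrsum_mono; [easy|lia]). lra. }
    specialize (L (Datatypes.S n)). rewrite Nat.add_succ_r in L.
    rewrite S_INR, plus_INR in HB. rewrite S_INR in L. pose proof (pos_INR n). pose proof (Rabs_pos (Re l)).
    apply (Rmult_le_reg_l (INR n + 1)); [lra|]. nra. }
  exists (2 * (Rabs (Re l) + 1)). split; [pose proof (Rabs_pos (Re l)); lra|]. intros N.
  apply Rle_trans with (s (N + N0)%nat); [apply zrsum_mono; [easy|lia]|]. apply Hs. lia.
Qed.

(** * Dominated sums and lattice sums of decaying functions *)

Lemma zrsum_tail b M : (forall k, 0 <= b k) -> (forall N, zrsum N b <= M) ->
  exists tau : nat -> R, is_lim_seq tau 0 /\ forall K N, (K <= N)%nat -> zrsum N b - zrsum K b <= tau K.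
Proof.
  intros Hb HM.
  assert (I : forall n, zrsum n b <= zrsum (S n) b) by (intros; apply zrsum_mono; auto).
  destruct (ex_finite_lim_seq_incr (fun n => zrsum n b) M I HM) as [l Hl].
  exists (fun K => l - zrsum K b). split.
  - replace (Finite 0) with (Finite (l - l)) by (f_equal; ring). apply is_lim_seq_minus'; [apply is_lim_seq_const|easy].
  - intros K N HK. pose proof (is_lim_seq_incr_compare _ _ Hl I N). simpl in *. lra.
Qed.

Lemma zsum_abs_conv a b M : (forall k, Cmod (a k) <= b k) -> (forall N, zrsum N b <= M) ->
  exists l, clim (fun N => zsum N a) l /\ Cmod l <= M.
Proof.
  intros Ha HM.
  assert (Hb : forall k, 0 <= b k) by (intros k; eapply Rle_trans; [apply Cmod_ge_0|apply Ha]).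
  destruct (zrsum_tail b M Hb HM) as (tau & Ht & T).
  destruct (clim_cauchy (fun N => zsum N a) tau Ht) as (l & Hl & _).
  - intros n m Hnm. eapply Rle_trans; [|apply (T n m Hnm)].
    rewrite (zsum_ext m a (fun k => RtoC 1 * a k)%C) by (intros; ring).
    apply (zsum_cut_tail n m a (fun _ => 1)); auto. intros; lra.
  - exists l. split; [easy|]. apply (clim_bound (fun N => zsum N a)); [|easy].
    intros N. eapply Rle_trans; [apply zsum_bound; intros; apply Ha|apply HM].
Qed.

(** Here [c] is the lattice spacing: the weights of radius [r] are 1 at the lattice points within
    distance [r]. Each [v r] is an eventually constant sum, because a cutoff meets finitely many
    lattice points. *)
Lemma zsum_cutoff_lim a b M l (th : nat -> Z -> R) (v : nat -> C) (c : R) : 0 < c ->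
  (forall k, Cmod (a k) <= b k) -> (forall N, zrsum N b <= M) -> clim (fun N => zsum N a) l ->
  (forall r k, 0 <= th r k <= 1) -> (forall r k, IZR (Z.abs k) * c <= INR r -> th r k = 1) ->
  (forall r, exists N0, forall N, (N0 <= N)%nat -> v r = zsum N (fun k => RtoC (th r k) * a k)%C) ->
  clim v l.
Proof.
  intros Hc Ha HM Hl Hth H1 Hv.
  assert (Hb : forall k, 0 <= b k) by (intros k; eapply Rle_trans; [apply Cmod_ge_0|apply Ha]).
  destruct (zrsum_tail b M Hb HM) as (tau & Ht & T).
  intros e He. apply is_lim_seq_spec in Ht. assert (He2 : 0 < e / 2) by lra.
  destruct (Ht (mkposreal _ He2)) as [K1 HK1]. destruct (Hl (e / 2) He2) as [K2 HK2].
  set (K := (K1 + K2)%nat). specialize (HK1 K ltac:(lia)). specialize (HK2 K ltac:(lia)). cbn [pos] in HK1.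
  destruct (nat_above (INR K * c)) as [R0 HR0]. exists R0. intros r Hr.
  destruct (Hv r) as [N0 HN0]. rewrite (HN0 (N0 + K)%nat) by lia.
  pose proof (zsum_cut_tail K (N0 + K) a (th r) b ltac:(lia) Ha (Hth r)) as Q.
  assert (Q' : Cmod (zsum (N0 + K) (fun k => RtoC (th r k) * a k)%C - zsum K a) <= tau K).
  { eapply Rle_trans; [apply Q|apply T; lia]. intros k Hk. apply H1.
    apply Rle_trans with (INR K * c).
    - apply Rmult_le_compat_r; [lra|]. rewrite INR_IZR_INZ. now apply IZR_le.
    - eapply Rle_trans; [exact HR0|]. now apply le_INR. }
  rewrite Rminus_0_r in HK1. pose proof (Rle_abs (tau K)).
  match goal with |- Cmod (?z - l) < _ => replace (z - l)%C with ((z - zsum K a) + (zsum K a - l))%C by ring end.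
  eapply Rle_lt_trans; [apply Cmod_triangle|]. lra.
Qed.

(** The bound is chosen to telescope: with m = N + 1 the new pair adds at most 4/m - 4/(m + 1), and
    5 - 4 = 1 is exact for [N = 0]. *)
Lemma zrsum_inv_sqr N : zrsum N (fun k => / (1 + IZR k ^ 2)) <= 5 - 4 / INR (S N).
Proof.
  induction N. { rewrite zrsum_0. simpl. right; field. }
  rewrite zrsum_S, opp_IZR, <- INR_IZR_INZ. rewrite (S_INR (S N)).
  set (m := INR (S N)) in *. assert (Hm : 1 <= m) by (unfold m; rewrite S_INR; pose proof (pos_INR N); lra).
  replace ((- m) ^ 2) with (m ^ 2) by ring.
  assert (/ (1 + m ^ 2) <= 2 / m - 2 / (m + 1)).
  { replace (2 / m - 2 / (m + 1)) with (/ (m * (m + 1) / 2)) by (field; lra). apply Rinv_le_contravar; nra. }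
  lra.
Qed.

Lemma zrsum_inv_sqr_5 N : zrsum N (fun k => / (1 + IZR k ^ 2)) <= 5.
Proof.
  pose proof (zrsum_inv_sqr N). assert (0 < INR (S N)) by (apply lt_0_INR; lia).
  assert (0 < 4 / INR (S N)) by (apply Rdiv_lt_0_compat; lra). lra.
Qed.

(** With t = x + k a one has (k a)^2 <= 2 (t^2 + x^2), which compares 1 + k^2 with 1 + t^2 uniformly
    for x in a bounded set. *)
Lemma inv_sqr_lattice a X x k : 0 < a -> Rabs x <= X ->
  / (1 + (x + IZR k * a) ^ 2) <= (1 + 2 / a ^ 2 + 2 * X ^ 2 / a ^ 2) * / (1 + IZR k ^ 2).
Proof.
  intros Ha Hx. set (A := 1 + 2 / a ^ 2 + 2 * X ^ 2 / a ^ 2).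
  assert (Ha2 : 0 < a ^ 2) by now apply pow_lt.
  assert (HX : x ^ 2 <= X ^ 2) by (rewrite <- (pow2_abs x); apply pow_incr; split; [apply Rabs_pos|easy]).
  set (t := x + IZR k * a). pose proof (pow2_ge_0 (IZR k)). pose proof (pow2_ge_0 t).
  apply (Rmult_le_reg_r (1 + t ^ 2)); [lra|]. rewrite Rinv_l by lra.
  apply (Rmult_le_reg_r (1 + IZR k ^ 2)); [lra|].
  replace (A * / (1 + IZR k ^ 2) * (1 + t ^ 2) * (1 + IZR k ^ 2)) with (A * (1 + t ^ 2)) by (field; lra).
  assert (Hk : IZR k ^ 2 <= 2 / a ^ 2 * (t ^ 2 + X ^ 2)).
  { apply (Rmult_le_reg_r (a ^ 2)); [easy|].
    replace (2 / a ^ 2 * (t ^ 2 + X ^ 2) * a ^ 2) with (2 * (t ^ 2 + X ^ 2)) by (field; lra).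
    replace (IZR k ^ 2 * a ^ 2) with ((t - x) ^ 2) by (unfold t; ring). pose proof (pow2_ge_0 (t + x)). nra. }
  assert (Q : 0 < / a ^ 2) by now apply Rinv_0_lt_compat. unfold A, Rdiv in *. pose proof (pow2_ge_0 X).
  assert (0 <= X ^ 2 * / a ^ 2) by (apply Rmult_le_pos; lra).
  assert (0 <= t ^ 2 * / a ^ 2) by (apply Rmult_le_pos; lra).
  assert (0 <= t ^ 2 * (X ^ 2 * / a ^ 2)) by (apply Rmult_le_pos; lra). nra.
Qed.

Lemma decay_lattice_bound (F : R -> C) C0 a X x : 0 < a -> 0 <= C0 -> Rabs x <= X ->
  (forall t, Cmod (F t) <= C0 / (1 + t ^ 2)) ->
  let b := fun k : Z => C0 * (1 + 2 / a ^ 2 + 2 * X ^ 2 / a ^ 2) * / (1 + IZR k ^ 2) in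
  (forall k, Cmod (F (x + IZR k * a)) <= b k) /\ forall N, zrsum N b <= C0 * (1 + 2 / a ^ 2 + 2 * X ^ 2 / a ^ 2) * 5.
Proof.
  intros Ha HC Hx HF b. split.
  - intros k. eapply Rle_trans; [apply HF|]. unfold b, Rdiv at 1. rewrite Rmult_assoc. apply Rmult_le_compat_l; [easy|].
    now apply inv_sqr_lattice.
  - intros N. unfold b. rewrite zrsum_scal. apply Rmult_le_compat_l; [|apply zrsum_inv_sqr_5].
    assert (0 < / a ^ 2) by now apply Rinv_0_lt_compat, pow_lt. pose proof (pow2_ge_0 X).
    apply Rmult_le_pos; [easy|]. unfold Rdiv.
    assert (0 <= X ^ 2 * / a ^ 2) by (apply Rmult_le_pos; lra). lra.
Qed.

(** * Smooth functions and cutoffs *)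

(* A single function [w] bounds [f] and all its derivatives up to order N: in this form the
   Leibniz rule [dec_mult] is an induction without binomial sums. *)
Fixpoint dec (N : nat) (f : R -> C) (w : R -> R) : Prop :=
  (forall x, Cmod (f x) <= w x) /\
  match N with O => True | S n => exists f', (forall x, cder f x (f' x)) /\ dec n f' w end.

Lemma dec_bound N f w x : dec N f w -> Cmod (f x) <= w x.
Proof. destruct N; intros [H _]; apply H. Qed.

Lemma dec_pred N : forall f w, dec (S N) f w -> dec N f w.
Proof.
  induction N; intros f w [H (f' & D & H')]; split; auto. exists f'. split; [easy|]. now apply IHN.
Qed.

Lemma dec_weaken N : forall f w w', (forall x, w x <= w' x) -> dec N f w -> dec N f w'.
Proof.
  induction N; intros f w w' L [H D]; split; auto; try (intros x; eapply Rle_trans; [apply H|apply L]).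
  destruct D as (f' & D & H'). exists f'. split; [easy|]. eapply IHN; eauto.
Qed.

Lemma dec_ext N f g w : (forall x, f x = g x) -> dec N f w -> dec N g w.
Proof. intros E. now replace g with f by now extensionality x. Qed.

Lemma dec_plus N : forall f g w v, dec N f w -> dec N g v -> dec N (fun x => f x + g x)%C (fun x => w x + v x).
Proof.
  induction N; intros f g w v [H1 D1] [H2 D2]; (split; [intros x; eapply Rle_trans; [apply Cmod_triangle|now apply Rplus_le_compat]|]); [easy|].
  destruct D1 as (f' & D1 & H1'). destruct D2 as (g' & D2 & H2').
  exists (fun x => f' x + g' x)%C. split; [|now apply IHN]. intros x. now apply cder_plus.
Qed.

(** Each differentiation splits a product into two products, whence the factor [2 ^ N]. *)
Lemma dec_mult N : forall f g w v, dec N f w -> dec N g v -> dec N (fun x => f x * g x)%C (fun x => 2 ^ N * (w x * v x)).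
Proof.
  induction N; intros f g w v Hf Hg.
  - split; [|easy]. intros x. rewrite Cmod_mult. simpl. rewrite Rmult_1_l.
    apply Rmult_le_compat; try apply Cmod_ge_0; now apply (dec_bound 0).
  - assert (Hwv : forall x, 0 <= w x * v x).
    { intros x. apply Rmult_le_pos; (eapply Rle_trans; [apply Cmod_ge_0|]); eapply dec_bound; eauto. }
    split.
    + intros x. rewrite Cmod_mult. apply Rle_trans with (1 * (w x * v x)).
      * rewrite Rmult_1_l. apply Rmult_le_compat; try apply Cmod_ge_0; eapply dec_bound; eauto.
      * apply Rmult_le_compat_r; [easy|]. apply pow_R1_Rle. lra.
    + pose proof (dec_pred _ _ _ Hf) as Hf0. pose proof (dec_pred _ _ _ Hg) as Hg0.
      destruct Hf as [_ (f' & D1 & H1')]. destruct Hg as [_ (g' & D2 & H2')].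
      exists (fun x => f' x * g x + f x * g' x)%C. split.
      * intros x. now apply cder_mult.
      * apply (dec_weaken _ _ (fun x => 2 ^ N * (w x * v x) + 2 ^ N * (w x * v x))).
        { intros x. simpl. lra. }
        apply dec_plus; now apply IHN.
Qed.

Lemma dec_const N c : dec N (fun _ => c) (fun _ => Cmod c).
Proof.
  destruct N; (split; [intros; lra|]); [easy|]. exists (fun _ => RtoC 0). split; [intros; apply cder_const|].
  assert (G : forall n, dec n (fun _ => RtoC 0) (fun _ => Cmod c)).
  { induction n; (split; [intros; rewrite Cmod_0; apply Cmod_ge_0|]); [easy|].
    exists (fun _ => RtoC 0). split; [intros; apply cder_const|easy]. }
  apply G.
Qed.

Lemma dec_scal N c f w : dec N f w -> dec N (fun x => c * f x)%C (fun x => Cmod c * w x).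
Proof.
  revert f. induction N; intros f [H D]; (split; [intros x; rewrite Cmod_mult; apply Rmult_le_compat_l; [apply Cmod_ge_0|apply H]|]); [easy|].
  destruct D as (f' & D & H'). exists (fun x => c * f' x)%C. split; [|now apply IHN]. intros x. now apply cder_scal.
Qed.

Lemma dec_comp_lin N u b : forall f w, dec N f w -> exists K, 0 <= K /\ dec N (fun x => f (u * x + b)) (fun x => K * w (u * x + b)).
Proof.
  induction N; intros f w [H D].
  - exists 1. split; [lra|]. split; [|easy]. intros x. rewrite Rmult_1_l. apply H.
  - destruct D as (f' & D & H'). destruct (IHN f' w H') as (K & HK & G).
    exists (1 + Rabs u * K). pose proof (Rabs_pos u).
    assert (HuK : 0 <= Rabs u * K) by now apply Rmult_le_pos.
    assert (Hw : forall x, 0 <= w x) by (intros x; eapply Rle_trans; [apply Cmod_ge_0|apply H]).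
    split; [lra|]. split.
    + intros x. specialize (H (u * x + b)). specialize (Hw (u * x + b)). nra.
    + exists (fun x => RtoC u * f' (u * x + b)%R)%C. split; [intros x; now apply cder_comp_lin|].
      apply (dec_weaken _ _ (fun x => Cmod (RtoC u) * (K * w (u * x + b)))); [|now apply (dec_scal N (RtoC u) (fun x => f' (u * x + b)))].
      intros x. rewrite Cmod_R. specialize (Hw (u * x + b)). nra.
Qed.

(** [Derive_n] unfolds at the outermost derivative, whereas [dec] exposes the innermost one. *)
Lemma Derive_n_S_inner f n x : Derive_n f (S n) x = Derive_n (Derive f) n x.
Proof. replace (S n) with (n + 1)%nat by lia. now rewrite <- Derive_n_comp. Qed.

Lemma cder_Derive f f' : (forall x, cder f x (f' x)) -> Derive (fun t => Re (f t)) = (fun t => Re (f' t)) /\ Derive (fun t => Im (f t)) = (fun t => Im (f' t)).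
Proof. intros D. split; extensionality x; apply is_derive_unique, D. Qed.

Lemma ex_derive_n_S_inner (f : R -> R) n x : ex_derive f x -> ex_derive_n (Derive f) n x -> ex_derive_n f (S n) x.
Proof.
  destruct n; [now intros|]. intros _ H. cbn [ex_derive_n] in *.
  apply (ex_derive_ext (Derive_n (Derive f) n)); [|exact H]. intros t. symmetry. apply Derive_n_S_inner.
Qed.

Lemma dec_Dn N : forall f w, dec N f w -> forall l x, (l <= N)%nat ->
  ex_derive_n (fun t => Re (f t)) l x /\ ex_derive_n (fun t => Im (f t)) l x /\ Cmod (Dn f l x) <= w x.
Proof.
  induction N; intros f w H l x Hl.
  - replace l with 0%nat by lia. repeat split. apply (dec_bound 0 f w x H).
  - destruct l. { repeat split. apply (dec_bound _ f w x H). }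
    destruct H as [_ (f' & D & H')]. destruct (cder_Derive f f' D) as [E1 E2].
    destruct (IHN f' w H' l x ltac:(lia)) as (G1 & G2 & G3). split; [|split].
    + apply ex_derive_n_S_inner; [exists (Re (f' x)); exact (proj1 (D x))|now rewrite E1].
    + apply ex_derive_n_S_inner; [exists (Im (f' x)); exact (proj2 (D x))|now rewrite E2].
    + unfold Dn. rewrite !Derive_n_S_inner, E1, E2. exact G3.
Qed.

Definition Dc (f : R -> C) (x : R) : C := (Derive (fun t => Re (f t)) x, Derive (fun t => Im (f t)) x).

Lemma smooth_Dc f : smooth f -> (forall x, cder f x (Dc f x)) /\ smooth (Dc f).
Proof.
  intros H. split.
  - intros x. destruct (H 1%nat x) as [H1 H2]. split; now apply Derive_correct.
  - intros k x. destruct (H (S k) x) as [H1 H2]. unfold Dc; cbn [Re Im fst snd].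
    destruct k; [now split|]. cbn [ex_derive_n] in *.
    split; [eapply ex_derive_ext; [|exact H1]|eapply ex_derive_ext; [|exact H2]]; intros t; apply Derive_n_S_inner.
Qed.

Lemma Dn_Dc f l x : Dn (Dc f) l x = Dn f (S l) x.
Proof. unfold Dn. rewrite !Derive_n_S_inner. reflexivity. Qed.

Lemma smooth_dec N : forall f w, smooth f -> (forall l x, (l <= N)%nat -> Cmod (Dn f l x) <= w x) -> dec N f w.
Proof.
  induction N; intros f w H B.
  - split; [|easy]. intros x. specialize (B 0%nat x (Nat.le_refl _)). unfold Dn in B; simpl in B. now rewrite <- surjective_pairing in B.
  - split. { intros x. specialize (B 0%nat x ltac:(lia)). unfold Dn in B; simpl in B. now rewrite <- surjective_pairing in B. }
    destruct (smooth_Dc f H) as [D S]. exists (Dc f). split; [easy|]. apply IHN; [easy|].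
    intros l x Hl. rewrite Dn_Dc. apply B. lia.
Qed.

Lemma dec_smooth f : (forall N, exists w, dec N f w) -> smooth f.
Proof.
  intros H k x. destruct (H k) as [w Hw]. destruct (dec_Dn k f w Hw k x (Nat.le_refl _)) as (H1 & H2 & _). now split.
Qed.

Lemma smooth_dec_some f N : smooth f -> exists w, dec N f w.
Proof.
  intros H. exists (fun x => rsum (S N) (fun l => Cmod (Dn f l x))). apply smooth_dec; [easy|].
  intros l x Hl. apply (rsum_ge_term (S N) (fun l => Cmod (Dn f l x))); [intros; apply Cmod_ge_0|lia].
Qed.

Lemma smooth_mult f g : smooth f -> smooth g -> smooth (fun x => f x * g x)%C.
Proof.
  intros H G. apply dec_smooth. intros N. destruct (smooth_dec_some f N H) as [w Hw]. destruct (smooth_dec_some g N G) as [v Hv].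
  eexists. exact (dec_mult N f g w v Hw Hv).
Qed.

Lemma smooth_ccont f : smooth f -> ccont f.
Proof. intros H. eapply cder_ccont. apply (proj1 (smooth_Dc f H)). Qed.

Lemma test_Cc f : test_fun f -> Cc f.
Proof. intros [H S]. split; [now apply smooth_ccont|exact S]. Qed.

Lemma test_supp f : test_fun f -> exists r, 0 < r /\ supp r f.
Proof. intros. now apply Cc_supp, test_Cc. Qed.

Lemma test_intro f r : smooth f -> supp r f -> test_fun f.
Proof. intros; split; eauto. Qed.

Lemma supp_cder r f f' : supp r f -> (forall x, cder f x (f' x)) -> supp r f'.
Proof.
  intros S D x Hx. apply (cder_unique f x); [apply D|].
  assert (L : locally x (fun t => RtoC 0 = f t)).
  { exists (mkposreal (Rabs x - r) ltac:(lra)). intros y Hy. symmetry. apply S.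
    change (Rabs (y - x) < Rabs x - r) in Hy. pose proof (Rabs_triang_inv x y). rewrite Rabs_minus_sym in Hy. lra. }
  split; [apply (is_derive_ext_loc (fun _ => 0))|apply (is_derive_ext_loc (fun _ => 0))]; try apply (is_derive_const (V := R_NormedModule) 0 x).
  - revert L. apply filter_imp. intros t Ht. now rewrite <- Ht.
  - revert L. apply filter_imp. intros t Ht. now rewrite <- Ht.
Qed.

Lemma test_Dc f : test_fun f -> test_fun (Dc f) /\ (forall x, cder f x (Dc f x)).
Proof.
  intros [H [r S]]. destruct (smooth_Dc f H) as [D H']. split; [|exact D].
  split; [easy|]. exists r. now apply (supp_cder r f).
Qed.

Lemma test_dec f N : test_fun f -> exists M, 0 < M /\ dec N f (fun _ => M).
Proof.
  revert f. induction N; intros f H; destruct (Cc_bounded f (test_Cc f H)) as (M & HM & B).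
  - exists M. split; [easy|]. split; auto.
  - destruct (test_Dc f H) as [H' D]. destruct (IHN _ H') as (M' & HM' & D').
    exists (M + M'). split; [lra|]. split.
    + intros x. specialize (B x). lra.
    + exists (Dc f). split; [easy|]. eapply dec_weaken; [|exact D']. intros; simpl; lra.
Qed.

(** Derivatives vanish wherever the function vanishes on an open set. For [1 - chi r] this means
    that in a product only the region beyond [r] counts. *)
Lemma dec_vanish N r : forall f w, dec N f w -> (forall x, Rabs x < r -> f x = RtoC 0) ->
  dec N f (fun x => if Rlt_dec (Rabs x) r then 0 else w x).
Proof.
  induction N; intros f w [H D] Z.
  - split; [|easy]. intros x. destruct Rlt_dec as [h|h]; [rewrite Z by easy; rewrite Cmod_0; lra|apply H].
  - split. { intros x. destruct Rlt_dec as [h|h]; [rewrite Z by easy; rewrite Cmod_0; lra|apply H]. }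
    destruct D as (f' & D & H'). exists f'. split; [easy|]. apply IHN; [easy|].
    intros x Hx. apply (cder_unique f x); [apply D|].
    assert (L : locally x (fun t => RtoC 0 = f t)).
    { exists (mkposreal (r - Rabs x) ltac:(lra)). intros y Hy. symmetry. apply Z.
      change (Rabs (y - x) < r - Rabs x) in Hy. pose proof (Rabs_triang_inv y x). lra. }
    split; (apply (is_derive_ext_loc (fun _ => 0)); [|apply (is_derive_const (V := R_NormedModule) 0 x)]);
      revert L; apply filter_imp; intros t Ht; now rewrite <- Ht.
Qed.

(** The functions x^(-n) exp (-1/x), extended by 0, have a span closed under differentiation;
    carrying [n] turns smoothness of the case n = 0 into an induction. *)
Definition phi (n : nat) (x : R) : R := if Rlt_dec 0 x then (/ x) ^ n * exp (- / x) else 0.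

(** A single term of the exponential series, whose terms are all nonnegative. *)
Lemma exp_ge_pow n t : 0 <= t -> t ^ n / INR (Factorial.fact n) <= exp t.
Proof.
  intros Ht. destruct (exist_exp t) as [l Hl] eqn:E.
  assert (exp t = l) by (unfold exp; now rewrite E). rewrite H.
  assert (Hl' : is_lim_seq (fun N => sum_f_R0 (fun i => / INR (Factorial.fact i) * t ^ i) N) l) by (apply is_lim_seq_Reals; exact Hl).
  apply (is_lim_seq_le_loc (fun _ => t ^ n / INR (Factorial.fact n)) (fun N => sum_f_R0 (fun i => / INR (Factorial.fact i) * t ^ i) N) (t ^ n / INR (Factorial.fact n)) l); [|apply is_lim_seq_const|exact Hl'].
  exists n. intros N HN. 
  assert (P : forall i, 0 <= / INR (Factorial.fact i) * t ^ i).
  { intros i. apply Rmult_le_pos; [left; apply Rinv_0_lt_compat, INR_fact_lt_0|now apply pow_le]. }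
  induction HN as [|N HN IH].
  - destruct n; cbn [sum_f_R0]; unfold Rdiv; rewrite Rmult_comm; [lra|].
    pose proof (cond_pos_sum _ n P). lra.
  - cbn [sum_f_R0]. pose proof (P (S N)). lra.
Qed.

(** The square leaves a factor [x] in the difference quotient at 0, so the derivative there is 0. *)
Lemma phi_small n x : 0 < x -> phi n x <= INR (Factorial.fact (n + 2)) * x ^ 2.
Proof.
  intros Hx. unfold phi. destruct (Rlt_dec 0 x); [|easy].
  assert (Ht : 0 < / x) by now apply Rinv_0_lt_compat.
  pose proof (exp_ge_pow (n + 2) (/ x) ltac:(lra)) as E. pose proof (INR_fact_lt_0 (n + 2)) as F.
  rewrite exp_Ropp. set (t := / x) in *. replace x with (/ t) by (unfold t; field; lra).
  assert (Hp : 0 < t ^ (n + 2)) by now apply pow_lt.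
  set (c := INR (Factorial.fact (n + 2))) in *.
  assert (E2 : / exp t <= / (t ^ (n + 2) / c)) by (apply Rinv_le_contravar; [now apply Rdiv_lt_0_compat|easy]).
  eapply Rle_trans; [apply Rmult_le_compat_l; [left; now apply pow_lt|exact E2]|].
  right. rewrite pow_add. field. assert (0 < t ^ n) by now apply pow_lt. repeat split; lra.
Qed.

Lemma phi_pos n x : 0 < x -> 0 < phi n x.
Proof. intros H. unfold phi. destruct Rlt_dec; [|easy]. apply Rmult_lt_0_compat; [now apply pow_lt, Rinv_0_lt_compat|apply exp_pos]. Qed.

Lemma phi_neg n x : x <= 0 -> phi n x = 0.
Proof. intros H. unfold phi. destruct Rlt_dec; [lra|easy]. Qed.

Lemma phi_nonneg n x : 0 <= phi n x.
Proof. destruct (Rlt_dec 0 x); [left; now apply phi_pos|rewrite phi_neg; lra]. Qed.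

Lemma phi_derive n x : is_derive (phi n) x (phi (n + 2) x - INR n * phi (n + 1) x).
Proof.
  destruct (Rtotal_order x 0) as [h|[h|h]].
  - rewrite !phi_neg by lra. replace (0 - INR n * 0) with 0 by ring.
    apply (is_derive_ext_loc (fun _ => 0)); [|apply (is_derive_const (V := R_NormedModule) 0 x)].
    exists (mkposreal (- x) ltac:(lra)). intros y Hy. change (Rabs (y - x) < - x) in Hy. apply Rabs_lt_between in Hy.
    rewrite phi_neg; [easy|lra].
  - subst x. rewrite !phi_neg by lra. replace (0 - INR n * 0) with 0 by ring.
    apply is_derive_Reals. intros e He. set (c := INR (Factorial.fact (n + 2))).
    assert (Hc : 0 < c) by apply INR_fact_lt_0.
    exists (mkposreal (e / c) (Rdiv_lt_0_compat _ _ He Hc)). intros h Hh Hd. cbn [pos] in Hd.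
    rewrite Rplus_0_l, (phi_neg n 0) by lra. rewrite !Rminus_0_r.
    destruct (Rlt_dec 0 h) as [hp|hn].
    + pose proof (phi_small n h hp) as B. pose proof (phi_nonneg n h) as P. fold c in B. rewrite Rabs_right in Hd by lra.
      rewrite Rabs_right. 2:{ apply Rle_ge, Rmult_le_pos; [easy|left; now apply Rinv_0_lt_compat]. }
      apply Rle_lt_trans with (c * h).
      * apply (Rmult_le_reg_r h); [easy|]. unfold Rdiv. rewrite Rmult_assoc, Rinv_l by lra. nra.
      * apply (Rmult_lt_reg_l (/ c)); [now apply Rinv_0_lt_compat|]. rewrite <- Rmult_assoc, Rinv_l by lra. unfold Rdiv in Hd. lra.
    + rewrite phi_neg by lra. unfold Rdiv. rewrite Rmult_0_l, Rabs_R0. easy.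
  - apply (is_derive_ext_loc (fun t => (/ t) ^ n * exp (- / t))).
    + exists (mkposreal x h). intros y Hy. change (Rabs (y - x) < x) in Hy. apply Rabs_lt_between in Hy.
      unfold phi. destruct Rlt_dec; [easy|lra].
    + auto_derive; [lra|]. unfold phi. destruct Rlt_dec; [|easy]. rewrite !pow_add.
      destruct n; [simpl; field; lra|]. cbn [Nat.pred]. rewrite <- tech_pow_Rmult. simpl pow. field. lra.
Qed.

Lemma dec_phi N : forall n, exists w, dec N (fun x => RtoC (phi n x)) w.
Proof.
  induction N; intros n.
  - exists (fun x => Cmod (RtoC (phi n x))). split; [intros; lra|easy].
  - destruct (IHN (n + 2)%nat) as [w1 H1]. destruct (IHN (n + 1)%nat) as [w2 H2].
    set (w := fun x => Cmod (RtoC (phi n x)) + (w1 x + Cmod (- RtoC (INR n)) * w2 x)).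
    assert (P1 : forall x, 0 <= w1 x + Cmod (- RtoC (INR n)) * w2 x).
    { intros x. apply Rplus_le_le_0_compat; [|apply Rmult_le_pos; [apply Cmod_ge_0|]];
      (eapply Rle_trans; [apply Cmod_ge_0|eapply dec_bound; eauto]). }
    exists w. split.
    + intros x. unfold w. specialize (P1 x). lra.
    + exists (fun x => RtoC (phi (n + 2) x) + (- RtoC (INR n)) * RtoC (phi (n + 1) x))%C. split.
      * intros x. eapply cder_eq; [apply cder_RtoC, phi_derive|]. ceq.
      * apply (dec_weaken _ _ (fun x => w1 x + Cmod (- RtoC (INR n)) * w2 x)).
        { intros x. unfold w. pose proof (Cmod_ge_0 (RtoC (phi n x))). lra. }
        apply dec_plus; [easy|]. now apply dec_scal.
Qed.

Lemma smooth_phi n : smooth (fun x => RtoC (phi n x)).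
Proof. apply dec_smooth. intros N. apply dec_phi. Qed.

Lemma smooth_comp_lin f u b : smooth f -> smooth (fun x => f (u * x + b)).
Proof.
  intros H. apply dec_smooth. intros N. destruct (smooth_dec_some f N H) as [w Hw].
  destruct (dec_comp_lin N u b f w Hw) as (K & _ & G). eexists; exact G.
Qed.

Lemma smooth_scal c f : smooth f -> smooth (fun x => c * f x)%C.
Proof. intros H. apply dec_smooth. intros N. destruct (smooth_dec_some f N H) as [w Hw]. eexists. exact (dec_scal N c f w Hw). Qed.

(* The affine arguments are written [u * x + b] to match [dec_comp_lin]. *)
Definition bump0 (x : R) : R := phi 0 (1 * x + 1) * phi 0 (-1 * x + 1).

Lemma bump0_nonneg x : 0 <= bump0 x.
Proof. apply Rmult_le_pos; apply phi_nonneg. Qed.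

Lemma bump0_smooth : smooth (fun x => RtoC (bump0 x)).
Proof.
  replace (fun x => RtoC (bump0 x)) with (fun x => RtoC (phi 0 (1 * x + 1)) * RtoC (phi 0 (-1 * x + 1)))%C.
  - apply smooth_mult; apply (smooth_comp_lin (fun x => RtoC (phi 0 x))); apply smooth_phi.
  - extensionality x. unfold bump0. now rewrite RtoC_mult.
Qed.

Lemma bump0_out x : 1 <= Rabs x -> bump0 x = 0.
Proof.
  intros H. unfold bump0. unfold Rabs in H. destruct (Rcase_abs x).
  - rewrite (phi_neg 0 (1 * x + 1)) by lra. ring.
  - rewrite (phi_neg 0 (-1 * x + 1)) by lra. ring.
Qed.

Lemma rcont_bump0 x : continuous bump0 x.
Proof. apply (proj1 (proj1 (ccont_iff _) (smooth_ccont _ bump0_smooth))). Qed.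

Lemma bump0_mass : 0 < RInt bump0 (-1) 1.
Proof.
  apply RInt_gt_0; [lra| |intros; apply rcont_bump0].
  intros x Hx. unfold bump0. apply Rmult_lt_0_compat; apply phi_pos; lra.
Qed.

Definition bump (x : R) : R := / RInt bump0 (-1) 1 * bump0 x.

Lemma bump_nonneg x : 0 <= bump x.
Proof. apply Rmult_le_pos; [left; apply Rinv_0_lt_compat, bump0_mass|apply bump0_nonneg]. Qed.

Lemma bump_out x : 1 <= Rabs x -> bump x = 0.
Proof. intros H. unfold bump. rewrite bump0_out by easy. ring. Qed.

Lemma bump_test : test_fun (fun x => RtoC (bump x)).
Proof.
  split.
  - replace (fun x => RtoC (bump x)) with (fun x => RtoC (/ RInt bump0 (-1) 1) * RtoC (bump0 x))%C.
    + apply smooth_scal, bump0_smooth.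
    + extensionality x. unfold bump. now rewrite RtoC_mult.
  - exists 1. intros x Hx. rewrite bump_out by lra. easy.
Qed.

Lemma rcont_bump x : continuous bump x.
Proof. apply rcont_mult; [apply continuous_const|apply rcont_bump0]. Qed.

Lemma bump_mass : RInt bump (-1) 1 = 1.
Proof. unfold bump. rewrite RI_scal by apply rcont_bump0. pose proof bump0_mass. req. field. lra. Qed.

Definition step (x : R) : R := RInt bump (-1) x.

Lemma step_left x : x <= -1 -> step x = 0.
Proof.
  intros H. unfold step. rewrite (RInt_ext _ (fun _ => 0)).
  - rewrite RInt_const. apply Rmult_0_r.
  - rewrite Rmin_right, Rmax_left by lra. intros t Ht. apply bump_out. rewrite Rabs_left by lra. lra.
Qed.

Lemma step_right x : 1 <= x -> step x = 1.
Proof.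
  intros H. unfold step. rewrite <- (RI_Chasles bump (-1) 1 x) by apply rcont_bump.
  rewrite bump_mass, (RInt_ext _ (fun _ => 0)).
  - rewrite RInt_const. unfold scal; simpl; unfold mult; simpl. ring.
  - rewrite Rmin_left, Rmax_right by lra. intros t Ht. apply bump_out. rewrite Rabs_right by lra. lra.
Qed.

Lemma step_range x : 0 <= step x <= 1.
Proof.
  destruct (Rle_dec x (-1)); [rewrite step_left; lra|]. destruct (Rle_dec 1 x); [rewrite step_right; lra|].
  assert (P : forall a b, a <= b -> 0 <= RInt bump a b).
  { intros a b H. apply RInt_ge_0; [easy|apply ex_RI, rcont_bump|intros; apply bump_nonneg]. }
  pose proof (P (-1) x ltac:(lra)). pose proof (P x 1 ltac:(lra)).
  pose proof (RI_Chasles bump (-1) x 1 rcont_bump) as E. rewrite bump_mass in E. unfold step. lra.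
Qed.

Lemma step_dec N : exists M, 0 < M /\ dec N (fun x => RtoC (step x)) (fun _ => M).
Proof.
  assert (B : forall x, Cmod (RtoC (step x)) <= 1).
  { intros x. rewrite Cmod_R. pose proof (step_range x). rewrite Rabs_right; lra. }
  destruct N.
  - exists 1. split; [lra|]. split; [exact B|easy].
  - destruct (test_dec _ N bump_test) as (M & HM & D). exists (1 + M). split; [lra|]. split.
    + intros x. specialize (B x). lra.
    + exists (fun x => RtoC (bump x)). split.
      * intros x. apply cder_RtoC. apply RI_upper_derive. apply rcont_bump.
      * eapply dec_weaken; [|exact D]. intros; simpl; lra.
Qed.

(** Changing [r] merely translates the two flanks, so every derivative is bounded independently of
    [r]; a rescaled bump would not keep the flanks fixed. *)
Definition chi (r x : R) : R := step (1 * x + (r + 1)) * step (-1 * x + (r + 1)).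

Lemma chi_range r x : 0 <= chi r x <= 1.
Proof.
  unfold chi. pose proof (step_range (1 * x + (r + 1))). pose proof (step_range (-1 * x + (r + 1))). nra.
Qed.

Lemma chi_in r x : Rabs x <= r -> chi r x = 1.
Proof. intros H. apply Rabs_le_between in H. unfold chi. rewrite !step_right by lra. ring. Qed.

Lemma chi_out r x : r + 2 <= Rabs x -> chi r x = 0.
Proof.
  intros H. unfold chi. unfold Rabs in H. destruct (Rcase_abs x).
  - rewrite (step_left (1 * x + (r + 1))) by lra. ring.
  - rewrite (step_left (-1 * x + (r + 1))) by lra. ring.
Qed.

(** For |u| <= 1 the chain rule does not enlarge the constant, which is how the bound on [chi r]
    becomes independent of [r]. *)
Lemma dec_comp_lin_const N u b f M : Rabs u <= 1 -> dec N f (fun _ => M) -> dec N (fun x => f (u * x + b)) (fun _ => M).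
Proof.
  intros Hu. revert f. induction N; intros f [H D].
  - split; [|easy]. intros x; apply H.
  - split; [intros x; apply H|]. destruct D as (f' & D & H').
    exists (fun x => RtoC u * f' (u * x + b)%R)%C. split; [intros x; now apply cder_comp_lin|].
    assert (0 <= M) by (eapply Rle_trans; [apply Cmod_ge_0|apply (H 0)]).
    apply (dec_weaken _ _ (fun x => Cmod (RtoC u) * M)); [intros; rewrite Cmod_R; nra|].
    apply (dec_scal N (RtoC u) (fun x => f' (u * x + b))). now apply IHN.
Qed.

Lemma chi_dec N : exists M, 0 < M /\ forall r, dec N (fun x => RtoC (chi r x)) (fun _ => M).
Proof.
  destruct (step_dec N) as (M & HM & D). exists (2 ^ N * (M * M)). split.
  { apply Rmult_lt_0_compat; [apply pow_lt; lra|now apply Rmult_lt_0_compat]. }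
  intros r. apply (dec_ext _ (fun x => RtoC (step (1 * x + (r + 1))) * RtoC (step (-1 * x + (r + 1))))%C).
  - intros x. unfold chi. now rewrite RtoC_mult.
  - apply (dec_mult N (fun x => RtoC (step (1 * x + (r + 1)))) (fun x => RtoC (step (-1 * x + (r + 1)))) (fun _ => M) (fun _ => M)).
    + apply (dec_comp_lin_const N 1 (r + 1) (fun x => RtoC (step x))); [rewrite Rabs_R1; lra|easy].
    + apply (dec_comp_lin_const N (-1) (r + 1) (fun x => RtoC (step x))); [rewrite Rabs_left; lra|easy].
Qed.

Lemma chi_smooth r : smooth (fun x => RtoC (chi r x)).
Proof. apply dec_smooth. intros N. destruct (chi_dec N) as (M & _ & D). exists (fun _ => M). apply D. Qed.

Lemma chi_mult_test r f : smooth f -> test_fun (fun x => RtoC (chi r x) * f x)%C.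
Proof.
  intros H. split; [apply smooth_mult; [apply chi_smooth|easy]|].
  exists (r + 2). intros x Hx. rewrite chi_out by lra. ring.
Qed.

Lemma chi_compl_dec N : exists M, 0 < M /\ forall r, dec N (fun x => 1 - RtoC (chi r x))%C (fun x => if Rlt_dec (Rabs x) r then 0 else M).
Proof.
  destruct (chi_dec N) as (M & HM & D). exists (1 + M). split; [lra|]. intros r.
  apply (dec_vanish N r _ (fun _ => 1 + M)).
  - apply (dec_ext _ (fun x => RtoC 1 + (-1) * RtoC (chi r x))%C); [intros; ring|].
    eapply dec_weaken; [|apply dec_plus; [apply dec_const|apply dec_scal, (D r)]].
    intros x; simpl. rewrite Cmod_1. replace (Cmod (-1)) with 1; [lra|]. rewrite Cmod_R, Rabs_left; lra.
  - intros x Hx. rewrite chi_in by lra. ring.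
Qed.

(** * Schwartz functions *)

Lemma sqr1_pos x : 1 <= 1 + x ^ 2.
Proof. pose proof (pow2_ge_0 x). lra. Qed.

Lemma abs_pow_le_weight x j N : (j <= N)%nat -> Rabs x ^ j <= (1 + x ^ 2) ^ N.
Proof.
  intros H. pose proof (sqr1_pos x). apply Rle_trans with ((1 + x ^ 2) ^ j); [|now apply Rle_pow].
  apply pow_incr. split; [apply Rabs_pos|]. rewrite <- (pow2_abs x). pose proof (Rabs_pos x). nra.
Qed.

Lemma weight_le_abs_pow x p : (1 + x ^ 2) ^ p <= 2 ^ p * (1 + Rabs x ^ (2 * p)).
Proof.
  rewrite pow_mult, <- (pow2_abs x). set (t := Rabs x ^ 2). assert (Ht : 0 <= t) by apply pow2_ge_0.
  assert (Htp : 0 <= t ^ p) by now apply pow_le. assert (H2 : 1 <= 2 ^ p) by (apply pow_R1_Rle; lra).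
  destruct (Rle_dec t 1).
  - apply Rle_trans with (2 ^ p); [apply pow_incr; lra|]. nra.
  - apply Rle_trans with ((2 * t) ^ p); [apply pow_incr; lra|]. rewrite Rpow_mult_distr. nra.
Qed.

Lemma schwartz_of_dec f : (forall N p, exists B, dec N f (fun x => B / (1 + x ^ 2) ^ p)) -> schwartz f.
Proof.
  intros H. split.
  - apply dec_smooth. intros N. destruct (H N 0%nat) as [B D]. eexists; exact D.
  - intros j l. destruct (H l j) as [B D]. exists B. intros x.
    destruct (dec_Dn l f _ D l x (Nat.le_refl _)) as (_ & _ & E).
    pose proof (abs_pow_le_weight x j j (Nat.le_refl _)) as W. assert (P : 0 < (1 + x ^ 2) ^ j) by (apply pow_lt; pose proof (sqr1_pos x); lra).
    pose proof (Cmod_ge_0 (Dn f l x)).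
    apply Rle_trans with ((1 + x ^ 2) ^ j * (B / (1 + x ^ 2) ^ j)); [|right; field; lra].
    apply Rmult_le_compat; auto. apply pow_le, Rabs_pos.
Qed.

(** The weight (1 + x^2)^p is controlled by the powers 0 and 2 p of |x|, so two seminorms for each
    derivative suffice. *)
Lemma dec_of_schwartz f : schwartz f -> forall N p, exists B, 0 <= B /\ dec N f (fun x => B / (1 + x ^ 2) ^ p).
Proof.
  intros [S H] N p.
  assert (G : exists B, 0 <= B /\ forall l x, (l <= N)%nat -> (1 + x ^ 2) ^ p * Cmod (Dn f l x) <= B).
  { induction N.
    - destruct (H 0%nat 0%nat) as [B0 H0]. destruct (H (2 * p)%nat 0%nat) as [B1 H1].
      exists (2 ^ p * (Rabs B0 + Rabs B1)).
      assert (0 < 2 ^ p) by (apply pow_lt; lra). pose proof (Rabs_pos B0). pose proof (Rabs_pos B1). split; [nra|].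
      intros l x Hl. replace l with 0%nat by lia. pose proof (weight_le_abs_pow x p) as W. specialize (H0 x). specialize (H1 x).
      pose proof (Cmod_ge_0 (Dn f 0 x)). pose proof (Rle_abs B0). pose proof (Rle_abs B1).
      simpl pow in H0. eapply Rle_trans; [apply Rmult_le_compat_r; eassumption|]. rewrite Rmult_assoc. apply Rmult_le_compat_l; lra.
    - destruct IHN as (B & HB & IH). destruct (H 0%nat (Datatypes.S N)) as [B0 H0]. destruct (H (2 * p)%nat (Datatypes.S N)) as [B1 H1].
      exists (B + 2 ^ p * (Rabs B0 + Rabs B1)).
      assert (0 < 2 ^ p) by (apply pow_lt; lra). pose proof (Rabs_pos B0). pose proof (Rabs_pos B1).
      assert (0 <= 2 ^ p * (Rabs B0 + Rabs B1)) by (apply Rmult_le_pos; lra). split; [lra|].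
      intros l x Hl. destruct (Nat.eq_dec l (Datatypes.S N)) as [->|].
      + pose proof (weight_le_abs_pow x p) as W. specialize (H0 x). specialize (H1 x).
        pose proof (Cmod_ge_0 (Dn f (Datatypes.S N) x)). pose proof (Rle_abs B0). pose proof (Rle_abs B1).
        simpl pow in H0. apply Rle_trans with (2 ^ p * (Rabs B0 + Rabs B1)); [|lra].
        eapply Rle_trans; [apply Rmult_le_compat_r; eassumption|]. rewrite Rmult_assoc. apply Rmult_le_compat_l; lra.
      + specialize (IH l x ltac:(lia)). lra. }
  destruct G as (B & HB & G). exists B. split; [easy|]. apply smooth_dec; [easy|]. intros l x Hl.
  assert (P : 0 < (1 + x ^ 2) ^ p) by (apply pow_lt; pose proof (sqr1_pos x); lra).
  apply (Rmult_le_reg_l ((1 + x ^ 2) ^ p)); [easy|].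
  replace ((1 + x ^ 2) ^ p * (B / (1 + x ^ 2) ^ p)) with B by (field; lra). now apply G.
Qed.

Lemma schwartz_bounded_mult g f : (forall N, exists M, dec N g (fun _ => M)) -> schwartz f -> schwartz (fun x => g x * f x)%C.
Proof.
  intros G H. apply schwartz_of_dec. intros N p. destruct (G N) as [M HM].
  destruct (dec_of_schwartz f H N p) as (B & HB & D). exists (2 ^ N * (M * B)).
  eapply dec_weaken; [|apply dec_mult; eassumption]. intros x; simpl. right. unfold Rdiv. ring.
Qed.

Lemma test_schwartz f : test_fun f -> schwartz f.
Proof.
  intros [S [r H]]. split; [easy|]. intros j l.
  assert (G : forall l, test_fun (fun x => Dn f l x)).
  { induction l0.
    - replace (fun x => Dn f 0 x) with f; [split; eauto|]. extensionality x. unfold Dn. simpl. apply surjective_pairing.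
    - destruct (test_Dc _ IHl0) as [T _]. exact T. }
  destruct (test_supp _ (G l)) as (s & Hs & Sl). destruct (Cc_bounded _ (test_Cc _ (G l))) as (M & HM & B).
  exists (s ^ j * M). intros x. destruct (Rle_dec (Rabs x) s) as [h|h].
  - apply Rmult_le_compat; [apply pow_le, Rabs_pos|apply Cmod_ge_0|apply pow_incr; split; [apply Rabs_pos|easy]|apply B].
  - rewrite Sl by lra. rewrite Cmod_0, Rmult_0_r. apply Rmult_le_pos; [apply pow_le; lra|lra].
Qed.

Lemma schwartz_decay f : schwartz f -> exists B, 0 <= B /\ forall x, Cmod (f x) <= B / (1 + x ^ 2).
Proof.
  intros H. destruct (dec_of_schwartz f H 0 1) as (B & HB & [D _]). exists B. split; [easy|]. intros x. specialize (D x). now rewrite pow_1 in D.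
Qed.

Lemma test_fadd f g : test_fun f -> test_fun g -> test_fun (fadd f g).
Proof.
  intros H G. destruct (Cc_supp _ (Cc_fadd f g (test_Cc _ H) (test_Cc _ G))) as (r & _ & S).
  apply (test_intro _ r); [|easy]. apply dec_smooth. intros N.
  destruct (smooth_dec_some f N (proj1 H)) as [w Hw]. destruct (smooth_dec_some g N (proj1 G)) as [v Hv].
  exists (fun x => w x + v x). now apply dec_plus.
Qed.

Lemma test_fscal c f : test_fun f -> test_fun (fscal c f).
Proof.
  intros [H [r S]]. apply (test_intro _ r); [now apply smooth_scal|]. intros x Hx. unfold fscal. rewrite S by easy. ring.
Qed.

Lemma smooth_id_scal c : smooth (fun x => c * RtoC x)%C.
Proof.
  apply smooth_scal. apply dec_smooth. intros N. destruct N.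
  - exists (fun x => Cmod (RtoC x)). split; [intros; lra|easy].
  - exists (fun x => Cmod (RtoC x) + Cmod (RtoC 1)). split; [intros x; pose proof (Cmod_ge_0 (RtoC 1)); lra|].
    exists (fun _ => RtoC 1). split.
    + intros x. apply cder_RtoC. apply (is_derive_id (K := R_AbsRing)).
    + eapply dec_weaken; [|apply dec_const]. intros x. simpl. pose proof (Cmod_ge_0 (RtoC x)). lra.
Qed.

Lemma test_mul_id c f : test_fun f -> test_fun (fun x => c * RtoC x * f x)%C.
Proof.
  intros [H [r S]]. apply (test_intro _ r).
  - apply smooth_mult; [apply smooth_id_scal|easy].
  - intros x Hx. rewrite S by easy. ring.
Qed.

Lemma RtoC_neq_0 x : x <> 0 -> RtoC x <> RtoC 0.
Proof. intros H E. apply H. now apply RtoC_inj. Qed.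

(** The operator 1 - D^2 / (4 PI^2) becomes multiplication by 1 + y^2; each application trades two
    derivatives for one more power of decay. *)
Lemma fourier_Dc2 f y : test_fun f ->
  fourier (fadd f (fscal (RtoC (- / (4 * PI ^ 2))) (Dc (Dc f)))) y = (RtoC (1 + y ^ 2) * fourier f y)%C.
Proof.
  intros H. destruct (test_Dc f H) as [H1 D1]. destruct (test_Dc _ H1) as [H2 D2].
  rewrite fourier_fadd by (auto using test_Cc, Cc_fscal). unfold fadd.
  rewrite fourier_fscal by auto using test_Cc. unfold fscal.
  rewrite (fourier_of_cder (Dc f) (Dc (Dc f))) by auto using test_Cc.
  rewrite (fourier_of_cder f (Dc f)) by auto using test_Cc.
  assert (E : (RtoC (- / (4 * PI ^ 2)) * (2 * PI * Ci * RtoC y * (2 * PI * Ci * RtoC y)))%C = RtoC (y ^ 2)).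
  { pose proof PI_RGT_0. apply injective_projections; simpl; field; lra. }
  transitivity (fourier f y + (RtoC (- / (4 * PI ^ 2)) * (2 * PI * Ci * RtoC y * (2 * PI * Ci * RtoC y))) * fourier f y)%C; [ring|].
  rewrite E, RtoC_plus. ring.
Qed.

Lemma fourier_test_weight p : forall f, test_fun f -> exists B, 0 <= B /\ forall y, Cmod (fourier f y) <= B / (1 + y ^ 2) ^ p.
Proof.
  induction p; intros f H.
  - destruct (test_supp f H) as (r & Hr & S). destruct (Cc_bounded f (test_Cc f H)) as (M & HM & B).
    exists (2 * r * M). split; [nra|]. intros y. simpl. unfold Rdiv. rewrite Rinv_1, Rmult_1_r.
    apply fourier_bound; auto using Cc_ccont, test_Cc; lra.
  - destruct (test_Dc f H) as [H1 D1]. destruct (test_Dc _ H1) as [H2 D2].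
    destruct (IHp (fadd f (fscal (RtoC (- / (4 * PI ^ 2))) (Dc (Dc f))))) as (B & HB & IH).
    { apply test_fadd; [easy|now apply test_fscal]. }
    exists B. split; [easy|]. intros y. specialize (IH y). rewrite fourier_Dc2 in IH by easy.
    pose proof (sqr1_pos y). rewrite Cmod_mult, Cmod_R, Rabs_right in IH by lra.
    assert (P : 0 < (1 + y ^ 2) ^ p) by (apply pow_lt; lra).
    apply (Rmult_le_reg_l (1 + y ^ 2)); [lra|]. eapply Rle_trans; [exact IH|]. rewrite <- (tech_pow_Rmult (1 + y ^ 2) p).
    revert P H0. generalize ((1 + y ^ 2) ^ p) (1 + y ^ 2). intros P q HP Hq. right. field. lra.
Qed.

(** A derivative of the transform is the transform of a multiple of x f, which is again a test
    function. *)
Lemma fourier_test_dec N p : forall f, test_fun f -> exists B, dec N (fourier f) (fun y => B / (1 + y ^ 2) ^ p).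
Proof.
  induction N; intros f H; destruct (fourier_test_weight p f H) as (B & HB & HW).
  - exists B. split; auto.
  - destruct (IHN _ (test_mul_id (- (2 * PI) * Ci)%C f H)) as [B' D].
    exists (B + Rabs B'). pose proof (Rabs_pos B').
    assert (L : forall b y, b <= B + Rabs B' -> b / (1 + y ^ 2) ^ p <= (B + Rabs B') / (1 + y ^ 2) ^ p).
    { intros b y Hb. apply Rmult_le_compat_r; [|easy]. left. apply Rinv_0_lt_compat, pow_lt. pose proof (sqr1_pos y). lra. }
    split.
    + intros y. eapply Rle_trans; [apply HW|]. apply L. lra.
    + eexists. split.
      * intros y. apply fourier_cder. now apply test_Cc.
      * eapply dec_weaken; [|exact D]. intros y. apply L. pose proof (Rle_abs B'). lra.
Qed.

Lemma fourier_test_schwartz f : test_fun f -> schwartz (fourier f).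
Proof. intros H. apply schwartz_of_dec. intros N p. now apply fourier_test_dec. Qed.

Lemma chi_bdd r N : exists M, dec N (fun x => RtoC (chi r x)) (fun _ => M).
Proof. destruct (chi_dec N) as (M & _ & D). exists M. apply D. Qed.

Lemma chi_compl_bdd r N : exists M, dec N (fun x => 1 - RtoC (chi r x))%C (fun _ => M).
Proof.
  destruct (chi_compl_dec N) as (M & HM & D). exists M. eapply dec_weaken; [|apply (D r)].
  intros x; simpl. destruct Rlt_dec; lra.
Qed.

Lemma is_lim_seq_inv_sqr c : is_lim_seq (fun r => c / (1 + INR r ^ 2)) 0.
Proof.
  apply is_lim_seq_spec. intros [e He]. cbn [pos]. destruct (nat_above (Rabs c / e)) as [N HN]. exists N. intros n Hn.
  assert (N1 : INR N <= INR n) by now apply le_INR. pose proof (pos_INR n). pose proof (Rabs_pos c).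
  rewrite Rminus_0_r. unfold Rdiv. rewrite Rabs_mult, (Rabs_right (/ _)).
  2:{ left. apply Rinv_0_lt_compat. pose proof (sqr1_pos (INR n)). lra. }
  pose proof (sqr1_pos (INR n)).
  apply (Rmult_lt_reg_r (1 + INR n ^ 2)); [lra|]. rewrite Rmult_assoc, Rinv_l, Rmult_1_r by lra.
  assert (Rabs c <= INR n * e).
  { apply (Rmult_le_reg_r (/ e)); [now apply Rinv_0_lt_compat|]. rewrite Rmult_assoc, Rinv_r by lra. unfold Rdiv in HN. lra. }
  assert (INR n < 1 + INR n ^ 2) by nra. nra.
Qed.

Lemma chi_compl_decay r B M x : 0 <= B -> 0 <= M -> 0 <= r ->
  (if Rlt_dec (Rabs x) r then 0 else M) * (B / (1 + x ^ 2)) <= M * B / (1 + r ^ 2).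
Proof.
  intros HB HM Hr. pose proof (sqr1_pos r). pose proof (sqr1_pos x). assert (HMB : 0 <= M * B) by now apply Rmult_le_pos.
  destruct Rlt_dec as [h|h].
  - rewrite Rmult_0_l. apply Rmult_le_pos; [easy|left; apply Rinv_0_lt_compat; lra].
  - unfold Rdiv. rewrite <- Rmult_assoc. apply Rmult_le_compat_l; [easy|]. apply Rinv_le_contravar; [lra|].
    rewrite <- (pow2_abs x). assert (r ^ 2 <= Rabs x ^ 2) by (apply pow_incr; lra). lra.
Qed.

(** [T] is tied to [mu] on test functions only. Its seminorm bound makes the far part
    [(1 - chi) * f] negligible, so [mu] determines [T] on all Schwartz functions. *)
Lemma tempered_cutoff_lim mu T f : tempered_extension mu T -> schwartz f ->
  clim (fun r => mu (fun x => RtoC (chi (INR r) x) * f x)%C) (T f).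
Proof.
  intros (TA & TS & (N & K & TB) & TE) H.
  (* Of the N + 1 powers of decay, N absorb the factor |x|^j of the seminorms and the last gives
     1/(1 + r^2). *)
  destruct (chi_compl_dec N) as (M & HM & DM). destruct (dec_of_schwartz f H N (N + 1)) as (B & HB & DB).
  set (c := 2 ^ N * (M * B)).
  assert (Hc : 0 <= c) by (unfold c; apply Rmult_le_pos; [apply pow_le; lra|nra]).
  apply clim_diff. apply (clim_0_of_bound _ (fun r => (K * (INR (S N) * (INR (S N) * c))) / (1 + INR r ^ 2))); [|apply is_lim_seq_inv_sqr].
  intros r. set (f1 := fun x => (RtoC (chi (INR r) x) * f x)%C). set (f2 := fun x => ((1 - RtoC (chi (INR r) x)) * f x)%C).
  assert (S1 : schwartz f1) by (apply schwartz_bounded_mult; [apply chi_bdd|easy]).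
  assert (S2 : schwartz f2) by (apply (schwartz_bounded_mult (fun x => 1 - RtoC (chi (INR r) x))%C); [apply chi_compl_bdd|easy]).
  assert (E : f = fadd f1 f2). { extensionality x. unfold fadd, f1, f2. ring. }
  fold f1. rewrite <- (TE f1 (chi_mult_test (INR r) f (proj1 H))).
  rewrite E at 1. rewrite TA by easy. replace (T f1 - (T f1 + T f2))%C with (- T f2)%C by ring. rewrite Cmod_opp.
  eapply Rle_trans; [apply (TB f2 (fun _ _ => c / (1 + INR r ^ 2)) S2)|].
  - intros j l x Hj Hl.
    assert (D2 : dec N f2 (fun x => 2 ^ N * ((if Rlt_dec (Rabs x) (INR r) then 0 else M) * (B / (1 + x ^ 2) ^ (N + 1))))) by (apply (dec_mult N (fun x => 1 - RtoC (chi (INR r) x))%C f); auto).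
    destruct (dec_Dn N f2 _ D2 l x Hl) as (_ & _ & BD). pose proof (abs_pow_le_weight x j N Hj) as W.
    pose proof (sqr1_pos x). assert (P : 0 < (1 + x ^ 2) ^ N) by (apply pow_lt; lra).
    eapply Rle_trans; [apply Rmult_le_compat; [apply pow_le, Rabs_pos|apply Cmod_ge_0|exact W|exact BD]|].
    pose proof (chi_compl_decay (INR r) B M x HB ltac:(lra) (pos_INR r)) as Q.
    apply Rle_trans with (2 ^ N * ((if Rlt_dec (Rabs x) (INR r) then 0 else M) * (B / (1 + x ^ 2)))).
    + right. rewrite pow_add, pow_1. revert P H0. generalize ((1 + x ^ 2) ^ N) (1 + x ^ 2). intros P q HP Hq. field. lra.
    + apply Rle_trans with (2 ^ N * (M * B / (1 + INR r ^ 2))); [apply Rmult_le_compat_l; [apply pow_le; lra|easy]|].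
      right. unfold c, Rdiv. ring.
  - right. rewrite (rsum_ext (S N) _ (fun _ => INR (S N) * (c / (1 + INR r ^ 2)))) by (intros; apply rsum_const).
    rewrite rsum_const. unfold Rdiv. ring.
Qed.

(** * Periodic measures *)

(** All derivatives fall on the smooth factor, under the integral sign. *)
Lemma dec_conv N h g : test_fun h -> Cc g -> exists w, dec N (conv h g) w.
Proof.
  revert h. induction N; intros h Hh Hg.
  - exists (fun x => Cmod (conv h g x)). split; [intros; lra|easy].
  - destruct (test_Dc h Hh) as [Hh' D]. destruct (IHN _ Hh' Hg) as [w Hw].
    destruct (Cc_supp g Hg) as (r & Hr & S).
    assert (Ch : ccont h) by now apply Cc_ccont, test_Cc. assert (Ch' : ccont (Dc h)) by now apply Cc_ccont, test_Cc.
    assert (Cg := Cc_ccont g Hg).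
    assert (Hw0 : forall x, 0 <= w x) by (intros x; eapply Rle_trans; [apply Cmod_ge_0|eapply dec_bound; eauto]).
    exists (fun x => Cmod (conv h g x) + w x). split; [intros x; specialize (Hw0 x); lra|].
    exists (conv (Dc h) g). split.
    + intros x. rewrite (conv_CI (Dc h) g r) by (auto; lra).
      apply (cder_ext (fun x => CI (fun y => h (x - y)%R * g y)%C (- r) r)). { intros t. symmetry. apply conv_CI; auto; lra. }
      apply (CI_param_derive (fun x y => h (x - y)%R * g y)%C (fun x y => Dc h (x - y)%R * g y)%C); [lra|..].
      * apply c2_mult; [apply c2_comp; [easy|apply rc2_sub]|apply (c2_comp g (fun u v => v)); [easy|apply rc2_snd]].
      * intros y. apply ccont_mult; [|easy]. apply (ccont_ext (fun t => h (-1 * t + y))); [intros; f_equal; ring|]. now apply ccont_lin.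
      * intros y t. eapply cder_eq; [apply cder_mult; [|apply cder_const]|].
        -- apply (cder_ext (fun u => h (1 * u + - t))); [intros; f_equal; ring|]. apply (cder_comp_lin h 1 (- t) y (Dc h (y - t))).
           replace (1 * y + - t) with (y - t) by ring. apply D.
        -- cbv beta. ring.
    + eapply dec_weaken; [|exact Hw]. intros x. simpl. pose proof (Cmod_ge_0 (conv h g x)). lra.
Qed.

Lemma conv_test h g : test_fun h -> Cc g -> test_fun (conv h g).
Proof.
  intros Hh Hg. split; [apply dec_smooth; intros N; now apply dec_conv|].
  exact (proj2 (Cc_conv h g (test_Cc _ Hh) Hg)).
Qed.

Lemma conv_comm h g x : Cc h -> Cc g -> conv h g x = integral (fun u => h u * g (x - u)%R)%C.
Proof.
  intros Hh Hg. unfold conv. set (F := fun y => (h (x - y)%R * g y)%C).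
  assert (HF : Cc F).
  { apply Cc_mult_l; [|easy]. apply (ccont_ext (fun t => h (-1 * t + x))); [intros; f_equal; ring|]. apply ccont_lin. now apply Cc_ccont. }
  rewrite <- (integral_shift F x HF), <- (integral_opp (fun y => F (y + x))) by now apply Cc_shift.
  f_equal. extensionality u. unfold F. f_equal; f_equal; ring.
Qed.

Lemma mollify g r eta : Cc g -> supp r g -> 0 < eta -> exists h, test_fun h /\ supp (r + 1) (conv h g) /\ forall x, Cmod (conv h g x - g x) <= eta.
Proof.
  intros Hg Sg He. destruct (Cc_unif g Hg eta He) as (d & Hd & U).
  (* Width below [d] gives accuracy [eta]. Width at most 1 keeps all supports within [r + 1], so
     that one bound of a measure serves every [eta]. *)
  set (e := Rmin (d / 2) 1). assert (He0 : 0 < e) by (apply Rmin_pos; lra).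
  assert (Hed : e < d) by (eapply Rle_lt_trans; [apply Rmin_l|lra]). assert (He1 : e <= 1) by apply Rmin_r.
  assert (Hie : 0 < / e) by now apply Rinv_0_lt_compat.
  set (b := fun x => / e * bump (/ e * x + 0)).
  set (h := fun x => RtoC (b x)).
  assert (Hb0 : forall x, 0 <= b x) by (intros; apply Rmult_le_pos; [lra|apply bump_nonneg]).
  assert (Hb : forall x, continuous b x).
  { intros x. apply rcont_mult; [apply continuous_const|]. apply (continuous_comp (fun x => / e * x + 0) bump); [apply rcont_lin|apply rcont_bump]. }
  assert (Sh : forall x, e <= Rabs x -> b x = 0).
  { intros x Hx. unfold b. rewrite bump_out; [ring|]. rewrite Rplus_0_r, Rabs_mult, (Rabs_right (/ e)) by lra.
    apply (Rmult_le_reg_l e); [easy|]. rewrite <- Rmult_assoc, Rinv_r by lra. lra. }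
  assert (S1 : supp e h) by (intros x Hx; unfold h; rewrite Sh by lra; easy).
  assert (Th : test_fun h).
  { apply (test_intro _ e); [|easy]. unfold h, b.
    replace (fun x => RtoC (/ e * bump (/ e * x + 0))) with (fun x => RtoC (/ e) * RtoC (bump (/ e * x + 0)))%C by (extensionality x; now rewrite RtoC_mult).
    apply smooth_scal. apply (smooth_comp_lin (fun x => RtoC (bump x))). apply bump_test. }
  assert (Ib : RInt b (- e) e = 1).
  { rewrite <- bump_mass. etransitivity; [exact (RInt_comp_lin (V := R_CompleteNormedModule) bump (/ e) 0 (- e) e (ex_RI _ _ _ rcont_bump))|].
    f_equal; field; lra. }
  assert (Ih : integral h = RtoC 1).
  { rewrite (integral_CI h e); [|now apply Cc_ccont, test_Cc|easy|lra]. rewrite CI_components by now apply Cc_ccont, test_Cc.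
    change (RInt (fun t => Re (h t)) (- e) e) with (RInt b (- e) e). rewrite Ib.
    unfold RtoC. f_equal. rewrite (RInt_ext _ (fun _ => 0)) by easy. rewrite RInt_const. apply Rmult_0_r. }
  exists h. split; [easy|]. assert (Ch := test_Cc h Th). split.
  - rewrite Rplus_comm. apply (supp_mono (e + r)); [lra|].
    destruct (Rle_dec 0 r) as [hr|hr].
    + apply supp_conv; auto using Cc_ccont.
    (* For negative [r] the support condition forces [g] to vanish everywhere. *)
    + assert (Z : g = fun _ => RtoC 0). { extensionality x. apply Sg. pose proof (Rabs_pos x). lra. }
      intros x _. rewrite (conv_CI h g 0); [|now apply Cc_ccont|now apply Cc_ccont|intros y _; now rewrite Z|lra].
      apply CI_zero; [lra|]. intros. lra.
  - intros x. rewrite conv_comm by easy.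
    assert (Cg : Cc (fun u => h u * g (x - u)%R)%C).
    { apply Cc_mult; [easy|]. apply (ccont_ext (fun t => g (-1 * t + x))); [intros; f_equal; ring|]. apply ccont_lin. now apply Cc_ccont. }
    replace (g x) with (integral (fun u => g x * h u)%C) by (rewrite integral_scal, Ih by easy; ring).
    replace (integral (fun u => h u * g (x - u)%R)%C - integral (fun u => g x * h u)%C)%C
      with (integral (fun u => h u * g (x - u)%R)%C + (-1) * integral (fun u => g x * h u)%C)%C by ring.
    assert (Cgx : Cc (fun u => g x * h u)%C) by now apply (Cc_fscal (g x) h).
    rewrite <- integral_scal, <- integral_plus; [|easy|now apply (Cc_fscal (-1) (fun u => g x * h u)%C)|easy].
    set (P := fun u => _).
    assert (CP : Cc P) by (apply (Cc_fadd (fun u => h u * g (x - u)%R)%C (fun u => (-1) * (g x * h u))%C); [easy|now apply (Cc_fscal (-1) (fun u => g x * h u)%C)]).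
    assert (EP : forall u, P u = (h u * (g (x - u)%R - g x))%C) by (intros; unfold P; ring).
    rewrite (integral_CI P e); [|now apply Cc_ccont|intros u Hu; rewrite EP, S1 by easy; ring|lra].
    eapply Rle_trans; [apply (CI_bound P (fun u => eta * b u)); [lra|now apply Cc_ccont| |]|].
    + apply ex_RI. intros u. apply rcont_mult; [apply continuous_const|apply Hb].
    + intros u Hu. rewrite EP, Cmod_mult. unfold h at 1. rewrite Cmod_R, Rabs_right by (apply Rle_ge, Hb0).
      rewrite Rmult_comm. apply Rmult_le_compat_r; [apply Hb0|]. left. apply U.
      replace (x - u - x) with (- u) by ring. rewrite Rabs_Ropp. apply Rle_lt_trans with e; [now apply Rabs_le|easy].
    + rewrite RI_scal by apply Hb. rewrite Ib. right; req; ring.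
Qed.

(** * Measures as functionals, and density of convolutions *)

Lemma mu_zero mu : is_measure mu -> mu (fun _ => RtoC 0) = RtoC 0.
Proof.
  intros (_ & S & _). replace (fun _ : R => RtoC 0) with (fscal (RtoC 0) (fun _ => RtoC 0)).
  - rewrite S by apply Cc_zero. ring.
  - extensionality x. unfold fscal. ring.
Qed.

Lemma mu_csum mu n F : is_measure mu -> (forall i, (i < n)%nat -> Cc (F i)) -> mu (fun x => csum n (fun i => F i x)) = csum n (fun i => mu (F i)).
Proof.
  intros Hm. induction n; intros H; simpl; [now apply mu_zero|].
  pose proof Hm as (A & _). change (mu (fadd (fun x => csum n (fun i => F i x)) (F n)) = (csum n (fun i => mu (F i)) + mu (F n))%C).
  rewrite A; [|apply Cc_csum; intros; apply H; lia|apply H; lia]. rewrite IHn; [easy|intros; apply H; lia].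
Qed.

Lemma mu_zsum mu N F : is_measure mu -> (forall k, Cc (F k)) -> mu (fun x => zsum N (fun k => F k x)) = zsum N (fun k => mu (F k)).
Proof. intros Hm H. apply (mu_csum mu _ (fun i => F (Z.of_nat i - Z.of_nat N)%Z)); auto. Qed.

Lemma mu_sub mu f g : is_measure mu -> Cc f -> Cc g -> mu (fun x => f x - g x)%C = (mu f - mu g)%C.
Proof.
  intros (A & S & _) Hf Hg. replace (fun x => f x - g x)%C with (fadd f (fscal (-1) g)) by (extensionality x; unfold fadd, fscal; ring).
  rewrite A, S; auto using Cc_fscal. ring.
Qed.

Lemma is_measure_scal c mu : is_measure mu -> is_measure (fun f => c * mu f)%C.
Proof.
  intros (A & S & B). split; [|split].
  - intros f g Hf Hg. rewrite A by easy. ring.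
  - intros a f Hf. rewrite S by easy. ring.
  - intros r. destruct (B r) as [M HM]. exists (Cmod c * M). intros f b Hf Sf Bf. rewrite Cmod_mult, Rmult_assoc.
    apply Rmult_le_compat_l; [apply Cmod_ge_0|now apply HM].
Qed.

Lemma is_measure_deltas J (w : Z -> C) (p : Z -> R) : is_measure (fun f => zsum J (fun j => w j * f (p j))%C).
Proof.
  split; [|split].
  - intros f g _ _. rewrite <- zsum_plus. apply zsum_ext. intros. unfold fadd. ring.
  - intros a f _. rewrite <- zsum_scal. apply zsum_ext. intros. unfold fscal. ring.
  - intros r. exists (zrsum J (fun j => Cmod (w j))). intros f B _ _ Hf. rewrite Rmult_comm, <- zrsum_scal.
    apply zsum_bound. intros k _. rewrite Cmod_mult, Rmult_comm. apply Rmult_le_compat_r; [apply Cmod_ge_0|apply Hf].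
Qed.

(** By [mollify] the convolutions approximate [g] uniformly with supports in one ball, where both
    measures are bounded by a constant times the supremum norm. *)
Lemma measures_agree mu1 mu2 r : is_measure mu1 -> is_measure mu2 ->
  (forall h g, test_fun h -> Cc g -> supp (r + 1) (conv h g) -> mu1 (conv h g) = mu2 (conv h g)) ->
  forall g, Cc g -> supp r g -> mu1 g = mu2 g.
Proof.
  intros H1 H2 E g Hg Sg.
  destruct (proj2 (proj2 H1) (r + 1)) as [M1 B1]. destruct (proj2 (proj2 H2) (r + 1)) as [M2 B2].
  assert (Z : (mu1 g - mu2 g)%C = RtoC 0).
  { apply Cmod_arbitrarily_small. intros eps Heps.
    set (eta := eps / (Rabs M1 + Rabs M2 + 1)). pose proof (Rabs_pos M1). pose proof (Rabs_pos M2).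
    assert (He : 0 < eta) by (apply Rdiv_lt_0_compat; lra).
    destruct (mollify g r eta Hg Sg He) as (h & Th & S & B). specialize (E h g Th Hg S).
    set (f := conv h g) in *. assert (Cf : Cc f) by (apply Cc_conv; [now apply test_Cc|easy]).
    assert (C0 : Cc (fun x => f x - g x)%C).
    { replace (fun x => f x - g x)%C with (fadd f (fscal (-1) g)) by (extensionality x; unfold fadd, fscal; ring). auto using Cc_fadd, Cc_fscal. }
    assert (S0 : forall x, r + 1 < Rabs x -> (f x - g x)%C = RtoC 0). { intros x Hx. rewrite S, Sg by lra. ring. }
    specialize (B1 _ eta C0 S0 B). specialize (B2 _ eta C0 S0 B). rewrite mu_sub in B1, B2 by easy.
    replace (mu1 g - mu2 g)%C with ((mu2 f - mu2 g) - (mu1 f - mu1 g))%C by (rewrite E; ring).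
    eapply Rle_trans; [apply Cmod_triangle|]. rewrite Cmod_opp.
    apply Rle_trans with ((Rabs M1 + Rabs M2 + 1) * eta); [|unfold eta; right; field; lra].
    pose proof (Rle_abs M1). pose proof (Rle_abs M2). nra. }
  replace (mu1 g) with ((mu1 g - mu2 g) + mu2 g)%C by ring. rewrite Z. ring.
Qed.

(** * Tents and periodization *)

Definition tent (x : R) : R := Rmax 0 (1 - Rabs x).

Lemma tent_sum N x : zrsum N (fun k => tent (x - IZR k)) = Rmax 0 (Rmin 1 (INR N + 1 - Rabs x)).
Proof.
  induction N.
  - rewrite zrsum_0. unfold tent, Rmax, Rmin, Rabs. simpl. repeat (destruct Rle_dec || destruct Rcase_abs); lra.
  - rewrite zrsum_S, IHN, opp_IZR, <- INR_IZR_INZ, S_INR. pose proof (pos_INR N). set (n := INR N) in *.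
    unfold tent, Rmax, Rmin, Rabs. repeat (destruct Rle_dec || destruct Rcase_abs); lra.
Qed.

Lemma tent_range x : 0 <= tent x <= 1.
Proof. unfold tent, Rmax. pose proof (Rabs_pos x). destruct Rle_dec; lra. Qed.

Lemma tent_out x : 1 <= Rabs x -> tent x = 0.
Proof. intros H. unfold tent, Rmax. destruct Rle_dec; lra. Qed.

Lemma rcont_Rmax_Rmin (f : R -> R) x : continuous f x -> continuous (fun t => Rmax 0 (f t)) x /\ continuous (fun t => Rmin 1 (f t)) x.
Proof.
  intros H. split.
  - apply (continuous_ext (fun t => (f t + Rabs (f t)) * / 2)).
    + intros t. unfold Rmax, Rabs. destruct Rle_dec, Rcase_abs; simpl; lra.
    + apply rcont_mult; [|apply continuous_const]. apply rcont_plus; [easy|]. apply (continuous_comp f Rabs); [easy|apply continuous_Rabs].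
  - apply (continuous_ext (fun t => (f t + 1 - Rabs (f t - 1)) * / 2)).
    + intros t. unfold Rmin, Rabs. destruct Rle_dec, Rcase_abs; simpl; lra.
    + apply rcont_mult; [|apply continuous_const]. apply rcont_minus; [apply rcont_plus; [easy|apply continuous_const]|].
      apply (continuous_comp (fun t => f t - 1) Rabs); [|apply continuous_Rabs]. apply rcont_minus; [easy|apply continuous_const].
Qed.

Lemma rcont_tent x : continuous tent x.
Proof. apply rcont_Rmax_Rmin. apply rcont_minus; [apply continuous_const|apply continuous_Rabs]. Qed.

Lemma rcont_cutoff r x : continuous (cutoff r) x.
Proof.
  apply (rcont_Rmax_Rmin (fun t => Rmin 1 (r + 1 - Rabs t))). apply (rcont_Rmax_Rmin (fun t => r + 1 - Rabs t)).
  apply rcont_minus; [apply continuous_const|apply continuous_Rabs].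
Qed.

Definition Ctent (p x : R) : C := RtoC (tent (/ p * x + 0)).

Lemma Ctent_supp p : 0 < p -> supp p (Ctent p).
Proof.
  intros Hp x Hx. unfold Ctent. rewrite tent_out; [easy|]. assert (0 < / p) by now apply Rinv_0_lt_compat.
  rewrite Rplus_0_r, Rabs_mult, (Rabs_right (/ p)) by lra. apply (Rmult_le_reg_l p); [easy|]. rewrite <- Rmult_assoc, Rinv_r by lra. lra.
Qed.

Lemma Ctent_Cc p : 0 < p -> Cc (Ctent p).
Proof.
  intros Hp. apply (Cc_intro _ p); [|now apply Ctent_supp]. apply (ccont_lin (fun x => RtoC (tent x))). apply ccont_RtoC, rcont_tent.
Qed.

Lemma Ctent_mod p x : Cmod (Ctent p x) <= 1.
Proof. unfold Ctent. rewrite Cmod_R. pose proof (tent_range (/ p * x + 0)). rewrite Rabs_right; lra. Qed.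

Lemma Ctent_partition p N x : 0 < p -> Rabs x <= INR N * p -> zsum N (fun k => Ctent p (x + - (IZR k * p))%R) = RtoC 1.
Proof.
  intros Hp Hx. unfold Ctent. rewrite zsum_RtoC.
  unfold zrsum. rewrite (rsum_ext _ _ (fun i => tent (/ p * x - IZR (Z.of_nat i - Z.of_nat N)))) by (intros; f_equal; field; lra).
  change (RtoC (zrsum N (fun k => tent (/ p * x - IZR k))) = RtoC 1). rewrite tent_sum. f_equal.
  assert (Rabs (/ p * x) <= INR N).
  { rewrite Rabs_mult, Rabs_right by (left; now apply Rinv_0_lt_compat). apply (Rmult_le_reg_l p); [easy|].
    rewrite <- Rmult_assoc, Rinv_r by lra. lra. }
  rewrite Rmin_left, Rmax_right; lra.
Qed.

Lemma periodic_Z alpha mu f k : periodic alpha mu -> Cc f -> mu (fun x => f (x + IZR k * alpha)%R) = mu f.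
Proof.
  intros P Hf.
  assert (N : forall n g, Cc g -> mu (fun x => g (x + INR n * alpha)) = mu g).
  { induction n; intros g Hg.
    - simpl. f_equal. extensionality x. f_equal. ring.
    - rewrite <- (IHn g) by easy. rewrite <- (P (fun x => g (x + INR n * alpha))) by now apply Cc_shift.
      f_equal. extensionality x. f_equal. rewrite S_INR. ring. }
  destruct (Z.le_ge_cases 0 k).
  - rewrite <- (Z2Nat.id k), <- INR_IZR_INZ by lia. now apply N.
  - rewrite <- (N (Z.to_nat (- k)) (fun x => f (x + IZR k * alpha)%R)) by now apply Cc_shift.
    f_equal. extensionality x. f_equal. rewrite INR_IZR_INZ, Z2Nat.id, opp_IZR by lia. ring.
Qed.

(** The partition of unity is inserted into [mu f], and periodicity moves each piece back to the
    central tent. *)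
Lemma mu_periodize alpha mu f N r : 0 < alpha -> is_measure mu -> periodic alpha mu -> Cc f -> supp r f -> r <= INR N * alpha ->
  mu f = mu (fun x => Ctent alpha x * zsum N (fun k => f (x + IZR k * alpha)%R))%C.
Proof.
  intros Ha Hm P Hf S Hr. set (F := fun k x => (Ctent alpha (x + - (IZR k * alpha))%R * f x)%C).
  assert (HF : forall k, Cc (F k)).
  { intros k. apply Cc_mult_l; [|easy]. apply (ccont_shift (Ctent alpha)). now apply Cc_ccont, Ctent_Cc. }
  replace f with (fun x => zsum N (fun k => F k x)) at 1.
  - rewrite mu_zsum by easy.
    replace (fun x => Ctent alpha x * zsum N (fun k => f (x + IZR k * alpha)%R))%C with (fun x => zsum N (fun k => F k (x + IZR k * alpha)%R))%C.
    + rewrite (mu_zsum mu N (fun k x => F k (x + IZR k * alpha)%R)); [|easy|intros; now apply (Cc_shift (F k))].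
      apply zsum_ext. intros k _. symmetry. now apply (periodic_Z alpha mu (F k)).
    + extensionality x. rewrite <- zsum_scal. apply zsum_ext. intros k _. unfold F. do 2 f_equal. ring.
  - extensionality x. destruct (Rle_dec (Rabs x) r) as [h|h].
    + unfold F. rewrite (zsum_ext N _ (fun k => f x * Ctent alpha (x + - (IZR k * alpha))%R))%C by (intros; ring).
      rewrite zsum_scal, Ctent_partition by lra. ring.
    + rewrite (zsum_ext N _ (fun k => 0 * RtoC 0)%C). { rewrite zsum_scal, S by lra. ring. }
      intros k _. unfold F. rewrite S by lra. ring.
Qed.

(* The tents of width [alpha] form a partition of unity along the translates by [alpha], so these
   are the Fourier coefficients of [mu] viewed on the circle R/(alpha Z). *)
Definition mcoef (alpha : R) (mu : (R -> C) -> C) (j : Z) : C :=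
  mu (fun x => Ctent alpha x * cexpi (- 2 * PI * (IZR j / alpha) * x)%R)%C.

Lemma zsum_full_tail K (a : Z -> C) b tau l : (forall k, Cmod (a k) <= b k) ->
  (forall K N, (K <= N)%nat -> zrsum N b - zrsum K b <= tau K) -> clim (fun N => zsum N a) l -> Cmod (l - zsum K a) <= tau K.
Proof.
  intros Ha T Hl. apply le_epsilon. intros e He. destruct (Hl e He) as [N HN]. specialize (HN (N + K)%nat ltac:(lia)).
  pose proof (zsum_cut_tail K (N + K) a (fun _ => 1) b ltac:(lia) Ha ltac:(intros; lra) ltac:(easy)) as Q.
  rewrite (zsum_ext (N + K) _ a) in Q by (intros; ring). specialize (T K (N + K)%nat ltac:(lia)).
  replace (l - zsum K a)%C with ((zsum (N + K) a - zsum K a) - (zsum (N + K) a - l))%C by ring.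
  eapply Rle_trans; [apply Cmod_triangle|]. rewrite Cmod_opp. lra.
Qed.

(* Periodization moves the translates onto [f^], where Poisson summation gives
   sum_k f^(x + k alpha) = (1/alpha) sum_j f(j/alpha) e(-j x/alpha), uniformly on the support of the tent. *)
Lemma periodic_mu_fourier alpha mu f r0 J C0 (theta : nat -> R -> R) :
  0 < alpha -> is_measure mu -> periodic alpha mu -> Cc f -> supp r0 f -> 0 <= r0 -> r0 <= (INR J + / 2) / alpha ->
  0 <= C0 -> (forall y, Cmod (fourier f y) <= C0 / (1 + y ^ 2)) ->
  (forall r x, continuous (theta r) x) -> (forall r x, 0 <= theta r x <= 1) ->
  (forall r x, Rabs x <= INR r -> theta r x = 1) -> (forall r x, INR r + 2 < Rabs x -> theta r x = 0) ->
  clim (fun r => mu (fun x => RtoC (theta r x) * fourier f x)%C)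
       (RtoC (/ alpha) * zsum J (fun j => mcoef alpha mu j * f (IZR j / alpha)%R)%C)%C.
Proof.
  intros Ha Hm P Hf S Hr0 HJ HC HD Tc T01 T1 T0.
  set (G := fun x => (RtoC (/ alpha) * zsum J (fun j => f (IZR j / alpha)%R * cexpi (- 2 * PI * (IZR j / alpha) * x)%R))%C).
  assert (CG : ccont G).
  { apply (ccont_mult (fun _ => RtoC (/ alpha))); [apply ccont_const|].
    apply (ccont_csum _ (fun i x => f (IZR (Z.of_nat i - Z.of_nat J) / alpha)%R * cexpi (- 2 * PI * (IZR (Z.of_nat i - Z.of_nat J) / alpha) * x)%R)%C).
    intros i _. apply (ccont_mult (fun _ => f (IZR (Z.of_nat i - Z.of_nat J) / alpha)%R)); [apply ccont_const|apply ccont_cexpi_lin]. }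
  assert (EG : mu (fun x => Ctent alpha x * G x)%C = (RtoC (/ alpha) * zsum J (fun j => mcoef alpha mu j * f (IZR j / alpha)%R)%C)%C).
  { set (F := fun j x => fscal (RtoC (/ alpha) * f (IZR j / alpha)%R)%C (fun x => Ctent alpha x * cexpi (- 2 * PI * (IZR j / alpha) * x)%R)%C x).
    assert (HF0 : forall j, Cc (fun x => Ctent alpha x * cexpi (- 2 * PI * (IZR j / alpha) * x)%R)%C).
    { intros j. apply Cc_mult; [now apply Ctent_Cc|apply ccont_cexpi_lin]. }
    replace (fun x => Ctent alpha x * G x)%C with (fun x => zsum J (fun j => F j x)).
    - rewrite mu_zsum by (auto; intros; apply Cc_fscal; auto). rewrite <- zsum_scal. apply zsum_ext. intros j _.
      unfold F. rewrite (proj1 (proj2 Hm)) by auto. unfold mcoef. ring.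
    - extensionality x. unfold G. rewrite <- !zsum_scal. apply zsum_ext. intros j _. unfold F, fscal. ring. }
  rewrite <- EG. clear EG.
  destruct (proj2 (proj2 Hm) alpha) as [M HM].
  set (b := fun k : Z => C0 * (1 + 2 / alpha ^ 2 + 2 * alpha ^ 2 / alpha ^ 2) * / (1 + IZR k ^ 2)).
  destruct (fun x Hx => decay_lattice_bound (fourier f) C0 alpha alpha x Ha HC Hx HD) with (x := 0) as [_ Hb2]; [rewrite Rabs_R0; lra|].
  fold b in Hb2.
  assert (Hb : forall x k, Rabs x <= alpha -> Cmod (fourier f (x + IZR k * alpha)%R) <= b k).
  { intros x k Hx. apply (proj1 (decay_lattice_bound (fourier f) C0 alpha alpha x Ha HC Hx HD)). }
  assert (Hb0 : forall k, 0 <= b k). { intros k. eapply Rle_trans; [apply Cmod_ge_0|apply (Hb 0)]. rewrite Rabs_R0; lra. }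
  destruct (zrsum_tail b _ Hb0 Hb2) as (tau & Ht & TT).
  assert (PS : forall x, Rabs x <= alpha -> clim (fun N => zsum N (fun k => fourier f (x + IZR k * alpha)%R)) (G x)).
  { intros x Hx. destruct (zsum_abs_conv (fun k => fourier f (x + IZR k * alpha)%R) b _ (fun k => Hb x k Hx) Hb2) as (l & Hl & _).
    (* The character shifts the transform by [x], so Poisson summation for [g] evaluates the sum
       over the translates of [x]. *)
    set (g := fun t => (f t * cexpi (- 2 * PI * t * x)%R)%C).
    assert (El : l = (RtoC (/ alpha) * zsum J (fun j => g (IZR j / alpha)%R))%C).
    { apply (poisson g alpha r0); auto.
      - apply ccont_mult; [now apply Cc_ccont|apply ccont_kernel].
      - now apply supp_mult.
      - revert Hl. apply (clim_eventually _ _ _ 0). intros n _. apply zsum_ext. intros k _. unfold g. rewrite fourier_modulate. easy. }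
    rewrite El in Hl. exact Hl. }
  intros e He. apply is_lim_seq_spec in Ht.
  (* The factor 2 anticipates two tails, and |M| + 1 the bound of [mu] on the support of the
     tent. *)
  assert (He' : 0 < e / (2 * (Rabs M + 1))) by (apply Rdiv_lt_0_compat; pose proof (Rabs_pos M); lra).
  destruct (Ht (mkposreal _ He')) as [K HK]. specialize (HK K (Nat.le_refl _)). cbn [pos] in HK. rewrite Rminus_0_r in HK.
  (* From this radius on the cutoff is 1 at all points x + k alpha with |x| <= alpha and |k| <=
     K. *)
  destruct (nat_above (INR K * alpha + alpha)) as [R0 HR0]. exists R0. intros r Hr.
  assert (HRr : INR K * alpha + alpha <= INR r) by (eapply Rle_trans; [exact HR0|now apply le_INR]).
  set (phir := fun x => (RtoC (theta r x) * fourier f x)%C).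
  assert (Sphi : supp (INR r + 2) phir) by (intros x Hx; unfold phir; rewrite T0 by easy; ring).
  assert (Cphi : Cc phir).
  { apply (Cc_intro _ (INR r + 2)); [|easy]. apply ccont_mult; [apply ccont_RtoC; intros; apply Tc|now apply ccont_fourier]. }
  (* [N] translates on either side cover the support of the cut function, and [N] is at least [K]
     for the comparison of tails. *)
  destruct (nat_above ((INR r + 2) / alpha)) as [N0 HN0]. set (N := (N0 + K)%nat).
  assert (HN : INR r + 2 <= INR N * alpha).
  { apply (Rmult_le_reg_r (/ alpha)); [now apply Rinv_0_lt_compat|]. rewrite Rmult_assoc, Rinv_r, Rmult_1_r by lra.
    unfold N. rewrite plus_INR. pose proof (pos_INR K). unfold Rdiv in HN0. lra. }
  rewrite (mu_periodize alpha mu phir N (INR r + 2)) by easy.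
  set (Q := fun x => zsum N (fun k => phir (x + IZR k * alpha)%R)).
  assert (CQ : ccont Q).
  { apply (ccont_csum _ (fun i x => phir (x + IZR (Z.of_nat i - Z.of_nat N) * alpha)%R)). intros; apply ccont_shift. now apply Cc_ccont. }
  change (fun x => (Ctent alpha x * zsum N (fun k => phir (x + IZR k * alpha)%R))%C) with (fun x => (Ctent alpha x * Q x)%C).
  rewrite <- mu_sub; [|easy|apply Cc_mult; [now apply Ctent_Cc|easy]|apply Cc_mult; [now apply Ctent_Cc|easy]].
  (* Both [Q] and [G] are compared with the uncut sum over |k| <= K; each differs from it by at most
     [tau K] on the support of the tent. *)
  assert (B : Cmod (mu (fun x => (Ctent alpha x * Q x - Ctent alpha x * G x)%C)) <= M * (2 * tau K)).
  { apply HM.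
    - replace (fun x => (Ctent alpha x * Q x - Ctent alpha x * G x)%C) with (fun x => Ctent alpha x * (Q x + (-1) * G x))%C by (extensionality x; ring).
      apply Cc_mult; [now apply Ctent_Cc|]. apply ccont_plus; [easy|]. now apply (ccont_mult (fun _ => RtoC (-1))); [apply ccont_const|].
    - intros x Hx. rewrite Ctent_supp by easy. ring.
    - intros x. assert (Ht0 : 0 <= tau K) by (specialize (TT K K (Nat.le_refl _)); lra).
      destruct (Rle_dec (Rabs x) alpha) as [h|h].
      + replace (Ctent alpha x * Q x - Ctent alpha x * G x)%C with (Ctent alpha x * (Q x - G x))%C by ring.
        rewrite Cmod_mult. apply Rle_trans with (1 * (2 * tau K)); [|lra]. apply Rmult_le_compat; try apply Cmod_ge_0; [apply Ctent_mod|].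
        pose proof (zsum_full_tail K _ b tau (G x) (fun k => Hb x k h) TT (PS x h)) as Q1.
        assert (Q2 : Cmod (Q x - zsum K (fun k => fourier f (x + IZR k * alpha)%R))%C <= tau K).
        { eapply Rle_trans; [apply (zsum_cut_tail K N _ (fun k => theta r (x + IZR k * alpha)) b)|apply TT].
          - unfold N; lia.
          - intros k. now apply Hb.
          - intros; apply T01.
          - intros k Hk. apply T1. eapply Rle_trans; [apply Rabs_triang|]. rewrite Rabs_mult, (Rabs_right alpha) by lra.
            assert (Rabs (IZR k) <= INR K). { rewrite <- abs_IZR, INR_IZR_INZ. now apply IZR_le. }
            assert (Rabs (IZR k) * alpha <= INR K * alpha) by (apply Rmult_le_compat_r; lra). lra.
          - unfold N; lia. }
        replace (Q x - G x)%C with ((Q x - zsum K (fun k => fourier f (x + IZR k * alpha)%R)) - (G x - zsum K (fun k => fourier f (x + IZR k * alpha)%R)))%C by ring.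
        eapply Rle_trans; [apply Cmod_triangle|]. rewrite Cmod_opp. lra.
      + rewrite Ctent_supp by lra. replace (0 * Q x - 0 * G x)%C with (RtoC 0) by ring. rewrite Cmod_0. lra. }
  eapply Rle_lt_trans; [exact B|].
  pose proof (Rabs_pos M). pose proof (Rle_abs M). pose proof (Rle_abs (tau K)). pose proof (Rabs_pos (tau K)).
  assert (0 <= tau K) by (specialize (TT K K (Nat.le_refl _)); lra).
  apply Rle_lt_trans with ((Rabs M + 1) * (2 * Rabs (tau K))); [nra|].
  apply Rlt_le_trans with ((Rabs M + 1) * (2 * (e / (2 * (Rabs M + 1))))); [apply Rmult_lt_compat_l; lra|].
  right. field. lra.
Qed.

(** * Measures on a lattice *)

(* mu = sum_j w_j delta_(j/alpha); every [J] covering the support of [f] gives the same finite sum. *)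
Definition lattice_measure (alpha : R) (w : Z -> C) (mu : (R -> C) -> C) : Prop :=
  forall f r J, Cc f -> supp r f -> r <= INR J / alpha -> mu f = zsum J (fun j => w j * f (IZR j / alpha)%R)%C.

Lemma zsum_single N j g : (Z.abs j <= Z.of_nat N)%Z -> (forall k, k <> j -> g k = RtoC 0) -> zsum N g = g j.
Proof.
  intros Hj H. unfold zsum. rewrite (csum_single _ (Z.to_nat (j + Z.of_nat N))).
  - f_equal. lia.
  - lia.
  - intros i Hi Hne. apply H. lia.
Qed.

Lemma lattice_point_out alpha r J j : 0 < alpha -> r <= INR J / alpha -> (Z.of_nat J < Z.abs j)%Z -> r < Rabs (IZR j / alpha).
Proof.
  intros Ha Hr Hj. eapply Rle_lt_trans; [exact Hr|]. unfold Rdiv. rewrite Rabs_mult, (Rabs_right (/ alpha)).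
  2:{ left. now apply Rinv_0_lt_compat. }
  apply Rmult_lt_compat_r; [now apply Rinv_0_lt_compat|]. rewrite <- abs_IZR, INR_IZR_INZ. now apply IZR_lt.
Qed.

Lemma lattice_sum_stable alpha w f r J J' : 0 < alpha -> supp r f -> r <= INR J / alpha -> (J <= J')%nat ->
  zsum J' (fun j => w j * f (IZR j / alpha)%R)%C = zsum J (fun j => w j * f (IZR j / alpha)%R)%C.
Proof.
  intros Ha S Hr HJ. apply zsum_stable; [|easy]. intros k Hk. rewrite S; [ring|]. eapply lattice_point_out; eauto.
Qed.

Lemma lattice_measure_of_dense alpha w mu : 0 < alpha -> is_measure mu ->
  (forall h g r J, test_fun h -> Cc g -> supp r (conv h g) -> 0 <= r -> r <= INR J / alpha ->
     mu (conv h g) = zsum J (fun j => w j * conv h g (IZR j / alpha)%R)%C) ->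
  lattice_measure alpha w mu.
Proof.
  intros Ha Hm H f r J Hf S Hr.
  (* The summand 1 makes room for the supports of mollified functions; [r] itself may be
     negative. *)
  destruct (nat_above_div (Rabs r + 1) alpha Ha) as [J1 HJ1].
  assert (E : mu f = zsum (J1 + J) (fun j => w j * f (IZR j / alpha)%R)%C).
  { apply (measures_agree mu (fun f => zsum (J1 + J) (fun j => w j * f (IZR j / alpha)%R)%C) (Rabs r)); auto.
    - apply is_measure_deltas.
    - intros h g Th Hg Sc. apply (H h g (Rabs r + 1)); auto; [pose proof (Rabs_pos r); lra|].
      eapply Rle_trans; [exact HJ1|]. apply Rmult_le_compat_r; [left; now apply Rinv_0_lt_compat|]. apply le_INR. lia.
    - apply (supp_mono r); [apply Rle_abs|easy]. }
  rewrite E. apply (lattice_sum_stable alpha w f r); auto. lia.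
Qed.

Lemma Ctent_0 d : Ctent d 0 = RtoC 1.
Proof. unfold Ctent, tent. rewrite Rmult_0_r, Rplus_0_l, Rabs_R0, Rminus_0_r. now rewrite Rmax_right by lra. Qed.

Lemma Ctent_far d x : 0 < d -> d <= Rabs x -> Ctent d x = RtoC 0.
Proof.
  intros Hd Hx. unfold Ctent. rewrite tent_out; [easy|]. assert (0 < / d) by now apply Rinv_0_lt_compat.
  rewrite Rplus_0_r, Rabs_mult, (Rabs_right (/ d)) by lra. apply (Rmult_le_reg_l d); [easy|].
  rewrite <- Rmult_assoc, Rinv_r by lra. lra.
Qed.

Lemma Ctent_shift_supp d p : 0 < d -> supp (d + Rabs p) (fun x => Ctent d (x + - p)).
Proof.
  intros Hd x Hx. apply Ctent_far; [easy|]. pose proof (Rabs_triang (x + - p) p). replace (x + - p + p) with x in * by ring. lra.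
Qed.

Lemma Rabs_IZR_ge_1 k : k <> 0%Z -> 1 <= Rabs (IZR k).
Proof. intros H. rewrite <- abs_IZR. apply IZR_le. lia. Qed.

(** A tent no wider than the spacing 1/alpha meets a single lattice point, so continuous functions
    suffice to read off an atom. *)
Lemma lattice_measure_atom alpha w mu j d : 0 < alpha -> lattice_measure alpha w mu -> 0 < d -> d <= / alpha ->
  mu (fun x => Ctent d (x + - (IZR j / alpha))) = w j.
Proof.
  intros Ha L Hd Hda. destruct (nat_above_div (d + Rabs (IZR j / alpha)) alpha Ha) as [J HJ].
  (* Adding |j| to [J] puts the index [j] visibly inside the summation range. *)
  assert (HJ' : d + Rabs (IZR j / alpha) <= INR (J + Z.to_nat (Z.abs j)) / alpha).
  { eapply Rle_trans; [exact HJ|]. apply Rmult_le_compat_r; [left; now apply Rinv_0_lt_compat|]. apply le_INR. lia. }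
  rewrite (L _ (d + Rabs (IZR j / alpha)) (J + Z.to_nat (Z.abs j))%nat).
  - rewrite (zsum_single _ j); [rewrite Rplus_opp_r, Ctent_0; ring|lia|].
    intros k Hk. rewrite Ctent_far; [ring|easy|].
    replace (IZR k / alpha + - (IZR j / alpha)) with (IZR (k - j) * / alpha) by (rewrite minus_IZR; field; lra).
    rewrite Rabs_mult, (Rabs_right (/ alpha)) by (left; now apply Rinv_0_lt_compat).
    pose proof (Rabs_IZR_ge_1 (k - j) ltac:(lia)). assert (0 < / alpha) by now apply Rinv_0_lt_compat. nra.
  - apply (Cc_shift (Ctent d)). now apply Ctent_Cc.
  - now apply Ctent_shift_supp.
  - easy.
Qed.

(** A nonzero atom at j/alpha is repeated at j/alpha + alpha, which must again be a point of
    (1/alpha)Z; multiplying by alpha makes alpha^2 an integer. *)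
Lemma lattice_measure_periodic alpha w mu : 0 < alpha -> lattice_measure alpha w mu -> periodic alpha mu -> nontrivial mu ->
  exists n, (0 < n)%nat /\ alpha = sqrt (INR n) /\ forall j, w (j + Z.of_nat n)%Z = w j.
Proof.
  intros Ha L P (f & Hf & Nf). assert (Hia : 0 < / alpha) by now apply Rinv_0_lt_compat.
  assert (Ex : exists j, w j <> RtoC 0).
  { apply NNPP. intros N. apply Nf. destruct (Cc_supp f Hf) as (r & _ & S). destruct (nat_above_div r alpha Ha) as [J HJ].
    rewrite (L f r J) by easy. rewrite (zsum_ext J _ (fun j => 0 * RtoC 0)%C); [rewrite zsum_scal; ring|].
    intros k _. replace (w k) with (RtoC 0); [ring|]. symmetry. apply NNPP. intros Hk. apply N. now exists k. }
  assert (Sh : forall j d, 0 < d -> mu (fun x => Ctent d (x + - (IZR j / alpha + alpha))) = mu (fun x => Ctent d (x + - (IZR j / alpha)))).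
  { intros j d Hd. rewrite <- (periodic_Z alpha mu (fun x => Ctent d (x + - (IZR j / alpha))) (-1)) by (auto; apply (Cc_shift (Ctent d)); now apply Ctent_Cc).
    f_equal. extensionality x. f_equal. ring. }
  destruct Ex as [j0 Hj0].
  assert (Int : exists z, alpha ^ 2 = IZR z).
  { set (z := Int_part (alpha ^ 2)). exists z. destruct (base_Int_part (alpha ^ 2)) as [I1 I2]. fold z in I1, I2.
    apply NNPP. intros Hne. set (t := alpha ^ 2 - IZR z). assert (Ht : 0 < t < 1) by (unfold t; lra).
    set (m := Rmin t (1 - t)). assert (Hm : 0 < m) by (apply Rmin_pos; lra).
    assert (Hm1 : m <= t) by apply Rmin_l. assert (Hm2 : m <= 1 - t) by apply Rmin_r.
    (* With [t] the fractional part of alpha^2, every lattice point is at distance at least min(t, 1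
       - t)/alpha from the shifted atom. A tent of this half-width sees no mass there, contradicting
       the nonzero atom. *)
    set (d := m * / alpha). assert (Hd : 0 < d) by now apply Rmult_lt_0_compat.
    assert (Hda : d <= / alpha) by (unfold d; nra).
    apply Hj0. rewrite <- (lattice_measure_atom alpha w mu j0 d) by easy. rewrite <- Sh by easy.
    destruct (nat_above_div (d + Rabs (IZR j0 / alpha + alpha)) alpha Ha) as [J HJ].
    rewrite (L _ _ J (Cc_shift (Ctent d) _ (Ctent_Cc d Hd)) (Ctent_shift_supp d _ Hd) HJ).
    rewrite (zsum_ext J _ (fun j => 0 * RtoC 0)%C); [rewrite zsum_scal; ring|].
    intros k _. rewrite Ctent_far; [ring|easy|].
    replace (IZR k / alpha + - (IZR j0 / alpha + alpha)) with ((IZR (k - j0 - z) - t) * / alpha) by (unfold t; rewrite !minus_IZR; field; lra).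
    rewrite Rabs_mult, (Rabs_right (/ alpha)) by lra. unfold d. apply Rmult_le_compat_r; [lra|].
    destruct (Z.le_gt_cases (k - j0 - z) 0) as [h|h].
    - apply IZR_le in h. rewrite Rabs_left; lra.
    - assert (1 <= IZR (k - j0 - z)) by (apply IZR_le; lia). rewrite Rabs_right; lra. }
  destruct Int as [z Hz]. assert (Ha2 : 0 < alpha ^ 2) by now apply pow_lt.
  assert (Hz0 : (0 < z)%Z) by (apply lt_IZR; lra).
  assert (En : INR (Z.to_nat z) = alpha ^ 2) by (rewrite INR_IZR_INZ, Z2Nat.id by lia; easy).
  exists (Z.to_nat z). split; [lia|]. split.
  - rewrite En. symmetry. apply sqrt_pow2. lra.
  - intros j. rewrite <- (lattice_measure_atom alpha w mu j (/ alpha)) by (auto; lra). rewrite <- Sh by lra.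
    rewrite <- (lattice_measure_atom alpha w mu _ (/ alpha)) by (auto; lra).
    f_equal. extensionality x. do 3 f_equal. rewrite plus_IZR, <- INR_IZR_INZ, En. field. lra.
Qed.

(** * Finite Fourier analysis modulo n *)

Definition zperiodic (n : nat) (g : Z -> C) := forall j, g (j + Z.of_nat n)%Z = g j.

Lemma zperiodic_mult n g j k : zperiodic n g -> g (j + k * Z.of_nat n)%Z = g j.
Proof.
  intros P. assert (N : forall m j, g (j + Z.of_nat m * Z.of_nat n)%Z = g j).
  { induction m; intros i; [f_equal; lia|]. replace (i + Z.of_nat (S m) * Z.of_nat n)%Z with ((i + Z.of_nat m * Z.of_nat n) + Z.of_nat n)%Z by lia. now rewrite P. }
  destruct (Z.le_ge_cases 0 k).
  - replace k with (Z.of_nat (Z.to_nat k)) by lia. apply N.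
  - rewrite <- (N (Z.to_nat (- k)) (j + k * Z.of_nat n)%Z). f_equal. rewrite Z2Nat.id; lia.
Qed.

Lemma zperiodic_mod n g j : (0 < n)%nat -> zperiodic n g -> g (Z.of_nat (Z.to_nat (j mod Z.of_nat n))) = g j.
Proof.
  intros Hn P. pose proof (Z.mod_pos_bound j (Z.of_nat n) ltac:(lia)). rewrite Z2Nat.id by lia.
  rewrite <- (zperiodic_mult n g _ (j / Z.of_nat n) P). f_equal. pose proof (Z.div_mod j (Z.of_nat n) ltac:(lia)). lia.
Qed.

(** In the window from -n to n, the positions l and l - n carry the same value with tent weights
    that add up to 1, so one full period remains. *)
Lemma tent_period_sum n g : (0 < n)%nat -> zperiodic n g ->
  zsum n (fun l => RtoC (tent (IZR l / INR n)) * g l)%C = csum n (fun l => g (Z.of_nat l)).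
Proof.
  intros Hn P. unfold zsum. replace (2 * n + 1)%nat with (n + (n + 1))%nat by lia. rewrite !csum_split. cbn [csum].
  assert (Hn0 : 0 < INR n) by (apply lt_0_INR; lia).
  replace (Z.of_nat (n + (n + 0)) - Z.of_nat n)%Z with (Z.of_nat n) by lia. rewrite <- INR_IZR_INZ.
  rewrite (tent_out (INR n / INR n)) by (rewrite Rabs_right; [right; field; lra|apply Rle_ge; left; apply Rdiv_lt_0_compat; lra]).
  rewrite (Cmult_0_l (g _)), !Cplus_0_l, Cplus_0_r, <- csum_plus. apply csum_ext. intros i Hi.
  replace (Z.of_nat (n + i) - Z.of_nat n)%Z with (Z.of_nat i) by lia.
  rewrite <- (P (Z.of_nat i - Z.of_nat n)%Z). replace (Z.of_nat i - Z.of_nat n + Z.of_nat n)%Z with (Z.of_nat i) by lia.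
  rewrite minus_IZR, <- !INR_IZR_INZ. apply lt_INR in Hi. pose proof (pos_INR i).
  assert (E1 : INR i / INR n < 1). { apply (Rmult_lt_reg_r (INR n)); [easy|]. unfold Rdiv. rewrite Rmult_assoc, Rinv_l; lra. }
  assert (E0 : 0 <= INR i / INR n) by (apply Rmult_le_pos; [easy|left; now apply Rinv_0_lt_compat]).
  replace ((INR i - INR n) / INR n) with (INR i / INR n - 1) by (field; lra).
  unfold tent. rewrite (Rabs_left (_ - 1)), (Rabs_right (_ / _)), !Rmax_right by lra.
  rewrite <- Cmult_plus_distr_r, <- RtoC_plus. replace (1 - - (INR i / INR n - 1) + (1 - INR i / INR n)) with 1 by ring. ring.
Qed.

Definition char (n : nat) (j l : Z) : C := cexpi (2 * PI * IZR j * IZR l / INR n).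

Lemma char_period n j l : (0 < n)%nat -> char n j (l + Z.of_nat n) = char n j l.
Proof.
  intros Hn. assert (0 < INR n) by (apply lt_0_INR; lia). unfold char. rewrite <- (cexpi_periodic (2 * PI * IZR j * IZR l / INR n) j). f_equal.
  rewrite plus_IZR, <- INR_IZR_INZ. field. lra.
Qed.

Lemma char_sym n j l : char n j l = char n l j.
Proof. unfold char. f_equal. unfold Rdiv. ring. Qed.

Lemma char_period_l n j l : (0 < n)%nat -> char n (j + Z.of_nat n) l = char n j l.
Proof. intros. rewrite char_sym, char_period by easy. apply char_sym. Qed.

Lemma char_plus n j k l : char n j (k + l) = (char n j k * char n j l)%C.
Proof. unfold char. rewrite <- cexpi_plus. f_equal. rewrite plus_IZR. unfold Rdiv. ring. Qed.

Lemma cexpi_eq_1 q : cexpi (2 * PI * q) = RtoC 1 -> exists k, q = IZR k.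
Proof.
  intros H. apply (f_equal fst) in H. cbn [fst cexpi RtoC] in H.
  replace (2 * PI * q) with (2 * (PI * q)) in H by ring. rewrite cos_2a_sin in H.
  assert (Z : sin (PI * q) = 0) by nra. destruct (sin_eq_0_0 _ Z) as [k Hk]. exists k.
  pose proof PI_RGT_0. apply (Rmult_eq_reg_l PI); lra.
Qed.

Lemma geometric_unit n (z : C) : (z <> 1)%C -> (Cpow z n = 1)%C -> csum n (fun j => Cpow z j) = RtoC 0.
Proof.
  intros Hz Hn. assert (E : ((z - 1) * csum n (fun j => Cpow z j) = Cpow z n - 1)%C).
  { clear. induction n; cbn [csum Cpow]; [ring|]. rewrite Cmult_plus_distr_l, IHn. ring. }
  assert (Hz' : (z - 1 <> 0)%C). { intros Q. apply Hz. replace z with (z - 1 + 1)%C by ring. rewrite Q. ring. }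
  apply (f_equal (Cmult (/ (z - 1)))) in E. rewrite Cmult_assoc, Cinv_l, Cmult_1_l in E by easy. rewrite E, Hn. ring.
Qed.

Lemma char_pow n j k : Cpow (char n 1 k) j = char n (Z.of_nat j) k.
Proof.
  induction j; simpl Cpow.
  - unfold char. replace (2 * PI * IZR (Z.of_nat 0) * IZR k / INR n) with 0 by (simpl; unfold Rdiv; ring). now rewrite cexpi_0.
  - rewrite IHj. unfold char. rewrite <- cexpi_plus. f_equal. rewrite <- !INR_IZR_INZ, S_INR. unfold Rdiv. ring.
Qed.

Lemma char_orthogonal n l m : (l < n)%nat -> (m < n)%nat ->
  csum n (fun j => char n (Z.of_nat j) (Z.of_nat l - Z.of_nat m)) = if Nat.eq_dec l m then RtoC (INR n) else RtoC 0.
Proof.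
  intros Hl Hm. assert (Hn : 0 < INR n) by (apply lt_0_INR; lia).
  rewrite (csum_ext _ _ (fun j => Cpow (char n 1 (Z.of_nat l - Z.of_nat m)) j)) by (intros; now rewrite char_pow).
  destruct Nat.eq_dec as [->|Hne].
  - rewrite Z.sub_diag. assert (E : char n 1 0 = RtoC 1) by (unfold char; rewrite Rmult_0_r; unfold Rdiv; rewrite Rmult_0_l; apply cexpi_0).
    rewrite E. clear. induction n; [easy|]. cbn [csum]. rewrite IHn, S_INR, RtoC_plus, Cpow_1_l. easy.
  - apply geometric_unit.
    + unfold char. intros E. replace (2 * PI * 1 * IZR (Z.of_nat l - Z.of_nat m) / INR n) with (2 * PI * (IZR (Z.of_nat l - Z.of_nat m) / INR n)) in E by (unfold Rdiv; ring).
      apply cexpi_eq_1 in E. destruct E as [k Hk].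
      assert (E2 : IZR (Z.of_nat l - Z.of_nat m) = IZR (k * Z.of_nat n)).
      { rewrite mult_IZR, <- INR_IZR_INZ, <- Hk. field. lra. }
      (* Here k n = l - m with |l - m| < n forces k = 0, hence l = m. *)
      apply eq_IZR in E2. assert (k = 0 \/ 1 <= k \/ k <= -1)%Z by lia. nia.
    + rewrite char_pow, char_sym. rewrite <- (Z.add_0_l (Z.of_nat n)), char_period by lia.
      unfold char. rewrite Rmult_0_r. unfold Rdiv. rewrite Rmult_0_l. apply cexpi_0.
Qed.

(** The sign [s] covers both kernels: the strict equation is inverted with s = 1, the eigenvector
    equation with s = -1. *)
Lemma dft_inverse n (u v : nat -> C) s : (s = 1 \/ s = -1)%Z ->
  (forall j, (j < n)%nat -> v j = csum n (fun l => u l * char n (Z.of_nat j) (s * Z.of_nat l))%C) ->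
  forall m, (m < n)%nat -> csum n (fun j => v j * char n (Z.of_nat j) (- (s * Z.of_nat m)))%C = (RtoC (INR n) * u m)%C.
Proof.
  intros Hs Hv m Hm.
  rewrite (csum_ext _ _ (fun j => csum n (fun l => u l * char n (Z.of_nat j) (s * Z.of_nat l - s * Z.of_nat m))%C)).
  - rewrite csum_exchange. rewrite (csum_single _ m); [|easy|].
    + rewrite csum_scal, Z.sub_diag. replace 0%Z with (Z.of_nat m - Z.of_nat m)%Z by lia. rewrite char_orthogonal by easy.
      destruct Nat.eq_dec; [ring|easy].
    + intros l Hl Hne. rewrite csum_scal. destruct Hs as [->| ->].
      * rewrite (csum_ext _ _ (fun j => char n (Z.of_nat j) (Z.of_nat l - Z.of_nat m))) by (intros; f_equal; lia).
        rewrite char_orthogonal by easy. destruct Nat.eq_dec; [easy|ring].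
      * rewrite (csum_ext _ _ (fun j => char n (Z.of_nat j) (Z.of_nat m - Z.of_nat l))) by (intros; f_equal; lia).
        rewrite char_orthogonal by easy. destruct Nat.eq_dec; [now subst|ring].
  - intros j Hj. rewrite Hv by easy. rewrite csum_mult_r. apply csum_ext. intros l _. unfold Z.sub. rewrite char_plus. ring.
Qed.

Lemma csum_blocks a n (F : nat -> C) : csum (a * n) F = csum a (fun k => csum n (fun m => F (k * n + m)%nat)).
Proof.
  induction a; [easy|]. replace (S a * n)%nat with (a * n + n)%nat by lia. now rewrite csum_split, IHa.
Qed.

Lemma csum_window J L a (F : Z -> C) : (forall j, (Z.of_nat J < Z.abs j)%Z -> F j = RtoC 0) ->
  (a <= - Z.of_nat J)%Z -> (Z.of_nat J < a + Z.of_nat L)%Z -> csum L (fun i => F (a + Z.of_nat i)%Z) = zsum J F.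
Proof.
  intros H Ha HL. set (p := Z.to_nat (- Z.of_nat J - a)). set (q := (L - p - (2 * J + 1))%nat).
  replace L with (p + ((2 * J + 1) + q))%nat by (unfold p, q; lia). rewrite (csum_split p), (csum_split (2 * J + 1)).
  rewrite (csum_0 p) by (intros; apply H; unfold p in *; lia).
  rewrite (csum_0 q) by (intros; apply H; unfold p in *; lia).
  unfold zsum. rewrite Cplus_0_l, Cplus_0_r. apply csum_ext. intros i Hi. f_equal. unfold p. lia.
Qed.

(** Since alpha^2 = n, the point m/alpha + k alpha is j/alpha with j = m + k n: division with
    remainder by n turns one sum into the other. *)
Lemma lattice_regroup n alpha w f r J N : (0 < n)%nat -> alpha = sqrt (INR n) -> zperiodic n w -> supp r f ->
  r <= INR J / alpha -> (J <= N)%nat ->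
  csum n (fun m => w (Z.of_nat m) * zsum N (fun k => f (INR m / alpha + IZR k * alpha)%R))%C = zsum J (fun j => w j * f (IZR j / alpha)%R)%C.
Proof.
  intros Hn Ea P S HJ HN. assert (Hn0 : 0 < INR n) by (apply lt_0_INR; lia).
  assert (Ha : 0 < alpha) by (rewrite Ea; now apply sqrt_lt_R0).
  assert (Ha2 : alpha * alpha = INR n) by (rewrite Ea; apply sqrt_sqrt; lra).
  set (F := fun j => (w j * f (IZR j / alpha)%R)%C).
  assert (HF : forall j, (Z.of_nat J < Z.abs j)%Z -> F j = RtoC 0).
  { intros j Hj. unfold F. rewrite S; [ring|]. eapply lattice_point_out; eauto. }
  (* The window runs from -N n to (N + 1) n - 1, which is 2 N + 1 blocks of length n and contains
     all |j| <= J. *)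
  rewrite <- (csum_window J ((2 * N + 1) * n) (- Z.of_nat N * Z.of_nat n) F HF) by nia.
  rewrite csum_blocks, csum_exchange. apply csum_ext. intros m Hm. unfold zsum. rewrite <- csum_scal. apply csum_ext. intros i Hi.
  unfold F. replace (- Z.of_nat N * Z.of_nat n + Z.of_nat (i * n + m))%Z with (Z.of_nat m + (Z.of_nat i - Z.of_nat N) * Z.of_nat n)%Z by lia.
  rewrite zperiodic_mult by easy. do 2 f_equal. rewrite plus_IZR, mult_IZR, <- !INR_IZR_INZ, <- Ha2. field. lra.
Qed.

(** * Eigenmeasures are supported on a lattice *)

(** The hub of the equivalence: both kinds of eigenmeasure and [comb_form] are compared with it.
    Masses indexed by all integers make translation by alpha a shift of the index by n. *)
Definition lattice_eigen (alpha : R) (mu : (R -> C) -> C) (lam : C) : Prop :=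
  exists (n : nat) (w : Z -> C), (0 < n)%nat /\ alpha = sqrt (INR n) /\ zperiodic n w /\ lattice_measure alpha w mu /\
  forall j, (lam * w j = RtoC (/ alpha) * csum n (fun l => w (Z.of_nat l) * char n j (- Z.of_nat l)))%C.

Lemma sqrt_INR_facts n alpha : (0 < n)%nat -> alpha = sqrt (INR n) -> 0 < INR n /\ 0 < alpha /\ alpha * alpha = INR n.
Proof.
  intros Hn ->. assert (0 < INR n) by (apply lt_0_INR; lia). split; [easy|]. split; [now apply sqrt_lt_R0|apply sqrt_sqrt; lra].
Qed.

(** The tent of width alpha covers the lattice points from -n to n, and [tent_period_sum] folds this
    window to one period: a Fourier coefficient becomes a discrete Fourier transform. *)
Lemma mcoef_lattice alpha mu n w j : (0 < n)%nat -> alpha = sqrt (INR n) -> zperiodic n w -> lattice_measure alpha w mu ->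
  mcoef alpha mu j = csum n (fun l => w (Z.of_nat l) * char n j (- Z.of_nat l))%C.
Proof.
  intros Hn Ea P L. destruct (sqrt_INR_facts n alpha Hn Ea) as (Hn0 & Ha & Ha2).
  unfold mcoef. rewrite (L _ alpha n).
  - rewrite <- (tent_period_sum n (fun l => w l * char n j (- l))%C); [|easy|].
    + apply zsum_ext. intros l _. unfold Ctent. replace (/ alpha * (IZR l / alpha) + 0) with (IZR l / INR n) by (rewrite <- Ha2; field; lra).
      replace (cexpi (- 2 * PI * (IZR j / alpha) * (IZR l / alpha))) with (char n j (- l)); [ring|].
      unfold char. f_equal. rewrite opp_IZR, <- Ha2. field. lra.
    + intros l. rewrite P. f_equal. rewrite <- (char_period n j (- (l + Z.of_nat n))) by easy. f_equal. lia.
  - apply Cc_mult; [now apply Ctent_Cc|apply ccont_cexpi_lin].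
  - apply supp_mult. now apply Ctent_supp.
  - rewrite <- Ha2. right. field. lra.
Qed.

Lemma dft_entry_char n k l : dft_entry n k l = (RtoC (/ sqrt (INR n)) * char n (Z.of_nat k) (- Z.of_nat l))%C.
Proof.
  unfold dft_entry. rewrite Cmult_comm. f_equal. unfold char. f_equal. rewrite opp_IZR, <- !INR_IZR_INZ. unfold Rdiv. ring.
Qed.

Lemma lattice_eigen_comb alpha mu lam : lattice_eigen alpha mu lam -> comb_form alpha mu lam.
Proof.
  intros (n & w & Hn & Ea & P & L & E). destruct (sqrt_INR_facts n alpha Hn Ea) as (Hn0 & Ha & Ha2).
  exists n. split; [easy|]. exists (fun m => w (Z.of_nat m)). split.
  - intros k _. rewrite E, <- csum_scal. apply csum_ext. intros l _. rewrite dft_entry_char, Ea. ring.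
  - intros f Hf. apply clim_filterlim. destruct (Cc_supp f Hf) as (r & Hr & S). destruct (nat_above_div r alpha Ha) as [J HJ].
    rewrite (L f r J) by easy.
    apply (clim_eventually (fun _ => zsum J (fun j => w j * f (IZR j / alpha)%R)%C) _ _ J); [|apply clim_const].
    intros N HN. symmetry. now apply (lattice_regroup n alpha w f r J N).
Qed.

Lemma char_mod n j l : (0 < n)%nat -> char n (Z.of_nat (Z.to_nat (j mod Z.of_nat n))) l = char n j l.
Proof. intros Hn. apply (zperiodic_mod n (fun j => char n j l)); [easy|]. intros k. now apply char_period_l. Qed.

Lemma comb_lattice_eigen alpha mu lam : 0 < alpha -> comb_form alpha mu lam -> lattice_eigen alpha mu lam.
Proof.
  intros Ha (n & Ea & c & D & Lm).
  (* [comb_form] admits n = 0, where [sqrt 0 = 0] contradicts [0 < alpha]. *)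
  assert (Hn : (0 < n)%nat). { destruct n; [|lia]. simpl in Ea. rewrite sqrt_0 in Ea. lra. }
  destruct (sqrt_INR_facts n alpha Hn Ea) as (Hn0 & _ & Ha2).
  set (w := fun j => c (Z.to_nat (j mod Z.of_nat n))).
  assert (P : zperiodic n w). { intros j. unfold w. do 2 f_equal. replace (j + Z.of_nat n)%Z with (j + 1 * Z.of_nat n)%Z by lia. apply Z_mod_plus_full. }
  assert (W : forall m, (m < n)%nat -> w (Z.of_nat m) = c m). { intros m Hm. unfold w. rewrite Z.mod_small, Nat2Z.id by lia. easy. }
  exists n, w. split; [easy|]. split; [easy|]. split; [easy|]. split.
  - intros f r J Hf S Hr. specialize (Lm f Hf). apply clim_filterlim in Lm. apply (clim_unique _ _ _ Lm).
    apply (clim_eventually (fun _ => zsum J (fun j => w j * f (IZR j / alpha)%R)%C) _ _ J); [|apply clim_const].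
    intros N HN. rewrite <- (lattice_regroup n alpha w f r J N) by easy. apply csum_ext. intros m Hm. now rewrite W.
  - intros j. set (k := Z.to_nat (j mod Z.of_nat n)).
    assert (Hk : (k < n)%nat) by (unfold k; pose proof (Z.mod_pos_bound j (Z.of_nat n)); lia).
    change (w j) with (c k). rewrite <- D by easy. rewrite <- csum_scal. apply csum_ext. intros l Hl.
    rewrite dft_entry_char, W, Ea by easy. unfold k. rewrite char_mod by easy. ring.
Qed.

Lemma Cpow4_neq_0 lam : Cpow lam 4 = RtoC 1 -> lam <> RtoC 0.
Proof. intros H ->. apply (RtoC_neq_0 1); [lra|]. rewrite <- H. simpl. ring. Qed.

Lemma le_half_shift r J alpha : 0 < alpha -> r <= INR J / alpha -> r <= (INR J + / 2) / alpha.
Proof. intros Ha H. eapply Rle_trans; [exact H|]. apply Rmult_le_compat_r; [left; now apply Rinv_0_lt_compat|lra]. Qed.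

Lemma fourier_test_decay2 f : test_fun f -> exists B, 0 <= B /\ forall y, Cmod (fourier f y) <= B / (1 + y ^ 2).
Proof.
  intros H. destruct (fourier_test_weight 1 f H) as (B & HB & D). exists B. split; [easy|]. intros y. specialize (D y). now rewrite pow_1 in D.
Qed.

Lemma eigenmeasure_lattice alpha mu lam : 0 < alpha -> Cpow lam 4 = RtoC 1 -> periodic alpha mu ->
  eigenmeasure mu lam -> lattice_eigen alpha mu lam.
Proof.
  intros Ha Hl Per (Hm & Nt & T & TE & TF). assert (L0 := Cpow4_neq_0 lam Hl).
  (* Forced by the equation: both cutoff limits agree, so lam times [mu f] is (1/alpha) sum_j m_j
     f(j/alpha). *)
  set (w := fun j => (/ lam * (RtoC (/ alpha) * mcoef alpha mu j))%C).
  assert (L : lattice_measure alpha w mu).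
  { apply lattice_measure_of_dense; [easy|easy|]. intros h g r J Th Hg S Hr HJ. set (f := conv h g) in *.
    assert (Tf : test_fun f) by now apply conv_test. assert (Hf := test_Cc f Tf).
    destruct (fourier_test_decay2 f Tf) as (B & HB & D).
    pose proof (periodic_mu_fourier alpha mu f r J B (fun r => chi (INR r)) Ha Hm Per Hf S Hr (le_half_shift _ _ _ Ha HJ) HB D) as Q1.
    pose proof (tempered_cutoff_lim mu T (fourier f) TE (fourier_test_schwartz f Tf)) as Q2.
    assert (E := clim_unique _ _ _ Q2 (Q1 (fun r => proj1 (proj1 (ccont_iff _) (smooth_ccont _ (chi_smooth (INR r)))))
       (fun r => chi_range (INR r)) (fun r => chi_in (INR r)) (fun r x h => chi_out (INR r) x (Rlt_le _ _ h)))).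
    rewrite TF in E by now apply test_schwartz. rewrite (proj2 (proj2 (proj2 TE))) in E by easy.
    transitivity (/ lam * (lam * mu f))%C; [rewrite Cmult_assoc, Cinv_l by easy; ring|]. rewrite E, <- !zsum_scal.
    apply zsum_ext. intros j _. unfold w. ring. }
  destruct (lattice_measure_periodic alpha w mu Ha L Per Nt) as (n & Hn & Ea & P).
  (* With the coefficients expressed through the masses, the definition of [w] is the eigenvector
     equation. *)
  exists n, w. repeat (split; [easy|]). intros j. rewrite <- (mcoef_lattice alpha mu n w j) by easy.
  unfold w. rewrite Cmult_assoc, Cinv_r by easy. ring.
Qed.

Lemma in_span_conv_single g h : Cc g -> Cc h -> in_span_conv (conv g h).
Proof.
  intros Hg Hh. exists 1%nat, (fun _ => RtoC 1), (fun _ => g), (fun _ => h). split; [easy|].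
  intros x. simpl csum. ring.
Qed.

Lemma cutoff_range r x : 0 <= cutoff r x <= 1.
Proof. unfold cutoff, Rmax, Rmin. repeat destruct Rle_dec; lra. Qed.
Lemma cutoff_in r x : Rabs x <= r -> cutoff r x = 1.
Proof. intros. unfold cutoff. rewrite Rmin_left, Rmax_right; lra. Qed.
Lemma cutoff_out r x : r + 1 <= Rabs x -> cutoff r x = 0.
Proof. intros. unfold cutoff. rewrite Rmax_left; [easy|]. eapply Rle_trans; [apply Rmin_r|lra]. Qed.

Lemma fcheck_fourier f : Cc f -> fcheck f = fourier (fun x => f (- x)).
Proof. intros H. extensionality y. unfold fcheck. now rewrite fourier_reflect. Qed.

Lemma ccont_fcheck f : Cc f -> ccont (fcheck f).
Proof. intros H. rewrite fcheck_fourier by easy. now apply ccont_fourier, Cc_opp_arg. Qed.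

Lemma Cc_cutoff_mult r F : ccont F -> Cc (fun x => RtoC (cutoff r x) * F x)%C.
Proof.
  intros H. apply (Cc_intro _ (r + 1)).
  - apply ccont_mult; [apply ccont_RtoC, rcont_cutoff|easy].
  - intros x Hx. rewrite cutoff_out by lra. ring.
Qed.

Lemma strict_eigenmeasure_lattice alpha mu lam : 0 < alpha -> periodic alpha mu ->
  strict_eigenmeasure mu lam -> lattice_eigen alpha mu lam.
Proof.
  intros Ha Per (Hm & Nt & _ & nu & (Hnu & St) & El).
  (* The inverse transform [fcheck] reflects the argument, hence the index -j; and [nu = lam mu]
     puts [lam] on this side. *)
  set (w := fun j => (lam * (RtoC (/ alpha) * mcoef alpha mu (- j)))%C).
  assert (L : lattice_measure alpha w mu).
  { apply lattice_measure_of_dense; [easy|easy|]. intros h g r J Th Hg S Hr HJ.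
    destruct (St _ (in_span_conv_single h g (test_Cc h Th) Hg)) as [_ I]. set (f := conv h g) in *.
    assert (Tf : test_fun f) by now apply conv_test. assert (Hf := test_Cc f Tf).
    destruct (fourier_test_decay2 f Tf) as (B & HB & D).
    assert (D' : forall y, Cmod (fourier (fun x => f (- x)) y) <= B / (1 + y ^ 2)).
    { intros y. rewrite fourier_reflect by easy. eapply Rle_trans; [apply D|]. right. f_equal. ring. }
    pose proof (periodic_mu_fourier alpha mu (fun x => f (- x)) r J B (fun r => cutoff (INR r)) Ha Hm Per (Cc_opp_arg f Hf) (supp_opp_arg r f S)
      Hr (le_half_shift _ _ _ Ha HJ) HB D' (fun r => rcont_cutoff (INR r)) (fun r => cutoff_range (INR r)) (fun r => cutoff_in (INR r))
      (fun r x h => cutoff_out (INR r) x ltac:(lra))) as Q1.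
    apply clim_filterlim in I. rewrite fcheck_fourier in I by easy.
    apply (clim_scal lam) in Q1. assert (E := clim_unique _ _ _ I
      (clim_eventually _ _ _ 0 (fun r _ => eq_sym (El _ (Cc_cutoff_mult (INR r) _ (ccont_fourier _ (Cc_opp_arg f Hf))))) Q1)).
    rewrite E, <- !zsum_scal, <- zsum_opp. apply zsum_ext. intros j _. unfold w.
    rewrite opp_IZR. replace (- (- IZR j / alpha)) with (IZR j / alpha) by (field; lra). ring. }
  destruct (lattice_measure_periodic alpha w mu Ha L Per Nt) as (n & Hn & Ea & P).
  destruct (sqrt_INR_facts n alpha Hn Ea) as (Hn0 & _ & Ha2).
  exists n, w. repeat (split; [easy|]).
  (* The system obtained has the conjugate kernel and [lam] on the right. *)
  assert (W : forall j, w j = (lam * (RtoC (/ alpha) * csum n (fun l => w (Z.of_nat l) * char n j (Z.of_nat l))))%C).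
  { intros j. unfold w at 1. rewrite (mcoef_lattice alpha mu n w) by easy. do 2 f_equal. apply csum_ext. intros l _. f_equal.
    unfold char. f_equal. rewrite !opp_IZR. unfold Rdiv. ring. }
  (* Discrete inversion contributes the factor n = alpha^2, which cancels against 1/alpha and leaves
     the eigenvector equation up to a factor alpha. *)
  assert (Inv : forall m, (m < n)%nat -> csum n (fun j => w (Z.of_nat j) * char n (Z.of_nat j) (- Z.of_nat m))%C = (lam * RtoC alpha * w (Z.of_nat m))%C).
  { intros m Hm'.
    pose proof (dft_inverse n (fun l => lam * RtoC (/ alpha) * w (Z.of_nat l))%C (fun j => w (Z.of_nat j)) 1 (or_introl eq_refl)) as I.
    rewrite (csum_ext _ _ (fun j => w (Z.of_nat j) * char n (Z.of_nat j) (- (1 * Z.of_nat m)))%C) by (intros; do 2 f_equal; lia).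
    rewrite I; [|intros j Hj; rewrite W, Cmult_assoc, <- csum_scal; apply csum_ext; intros; rewrite Z.mul_1_l; ring|easy].
    rewrite <- Ha2. transitivity (lam * RtoC (alpha * alpha * / alpha) * w (Z.of_nat m))%C; [rewrite !RtoC_mult; ring|].
    do 2 f_equal. f_equal. field. lra. }
  intros j. rewrite <- (zperiodic_mod n w j) by easy. set (k := Z.to_nat (j mod Z.of_nat n)).
  assert (Hk : (k < n)%nat) by (unfold k; pose proof (Z.mod_pos_bound j (Z.of_nat n)); lia).
  transitivity (RtoC (/ alpha) * (lam * RtoC alpha * w (Z.of_nat k)))%C.
  - transitivity (RtoC (/ alpha * alpha) * (lam * w (Z.of_nat k)))%C; [rewrite Rinv_l by lra; ring|rewrite RtoC_mult; ring].
  - rewrite <- Inv by easy. f_equal. apply csum_ext. intros l _. f_equal.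
    rewrite <- (char_mod n j) by easy. fold k. unfold char. f_equal. rewrite !opp_IZR. unfold Rdiv. ring.
Qed.

(** * Lattice measures are eigenmeasures *)

(** The inverse passage, needed because the transform of [f] itself produces the kernel with
    positive sign under Poisson summation. *)
Lemma lattice_eigen_dual alpha n w lam : (0 < n)%nat -> alpha = sqrt (INR n) -> zperiodic n w ->
  (forall j, (lam * w j = RtoC (/ alpha) * csum n (fun l => w (Z.of_nat l) * char n j (- Z.of_nat l)))%C) ->
  forall j, (w j = lam * (RtoC (/ alpha) * csum n (fun l => w (Z.of_nat l) * char n j (Z.of_nat l))))%C.
Proof.
  intros Hn Ea P E. destruct (sqrt_INR_facts n alpha Hn Ea) as (Hn0 & Ha & Ha2).
  assert (Inv : forall m, (m < n)%nat -> csum n (fun j => lam * w (Z.of_nat j) * char n (Z.of_nat j) (Z.of_nat m))%C = (RtoC alpha * w (Z.of_nat m))%C).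
  { intros m Hm.
    pose proof (dft_inverse n (fun l => RtoC (/ alpha) * w (Z.of_nat l))%C (fun j => lam * w (Z.of_nat j))%C (-1) (or_intror eq_refl)) as I.
    rewrite (csum_ext _ _ (fun j => lam * w (Z.of_nat j) * char n (Z.of_nat j) (- (-1 * Z.of_nat m)))%C) by (intros; do 2 f_equal; lia).
    rewrite I; [|intros j Hj; rewrite E, <- csum_scal; apply csum_ext; intros; replace (-1 * Z.of_nat i)%Z with (- Z.of_nat i)%Z by lia; ring|easy].
    rewrite <- Ha2. rewrite Cmult_assoc, <- RtoC_mult. do 2 f_equal. field. lra. }
  intros j. rewrite <- (zperiodic_mod n w j) by easy. set (k := Z.to_nat (j mod Z.of_nat n)).
  assert (Hk : (k < n)%nat) by (unfold k; pose proof (Z.mod_pos_bound j (Z.of_nat n)); lia).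
  transitivity (RtoC (/ alpha) * (RtoC alpha * w (Z.of_nat k)))%C.
  { rewrite Cmult_assoc, <- RtoC_mult, Rinv_l by lra. ring. }
  rewrite <- Inv by easy. rewrite <- !csum_scal. apply csum_ext. intros l _.
  rewrite <- (char_mod n j) by easy. fold k. rewrite (char_sym n (Z.of_nat l)). ring.
Qed.

Lemma zperiodic_bounded n w : (0 < n)%nat -> zperiodic n w -> exists W, 0 <= W /\ forall j, Cmod (w j) <= W.
Proof.
  intros Hn P. exists (rsum n (fun l => Cmod (w (Z.of_nat l)))). split; [apply rsum_ge_0; intros; apply Cmod_ge_0|].
  intros j. rewrite <- (zperiodic_mod n w j) by easy.
  apply (rsum_ge_term n (fun l => Cmod (w (Z.of_nat l)))); [intros; apply Cmod_ge_0|].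
  pose proof (Z.mod_pos_bound j (Z.of_nat n)). lia.
Qed.

Lemma Cmod_char n j l : Cmod (char n j l) = 1.
Proof. apply Cmod_cexpi. Qed.

(** As alpha^2 = n, the character at j is exactly the factor produced by translating [f] by s/alpha;
    Poisson summation is applied to that translate with step 1/alpha. *)
Lemma poisson_char n alpha f r J s b M : (0 < n)%nat -> alpha = sqrt (INR n) -> Cc f -> supp r f -> 0 <= r ->
  r + Rabs (IZR s / alpha) <= INR J / / alpha ->
  (forall k, Cmod (fourier f (IZR k / alpha)) <= b k) -> (forall N, zrsum N b <= M) ->
  clim (fun N => zsum N (fun j => char n j s * fourier f (IZR j / alpha)%R)%C) (RtoC alpha * zsum J (fun k => f (IZR k * alpha + IZR s / alpha)%R))%C.
Proof.
  intros Hn Ea Hf S Hr HJ Hb HM. destruct (sqrt_INR_facts n alpha Hn Ea) as (Hn0 & Ha & Ha2).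
  assert (Hia : 0 < / alpha) by now apply Rinv_0_lt_compat.
  set (g := fun x => f (x + IZR s / alpha)).
  assert (E : forall j, (char n j s * fourier f (IZR j / alpha)%R)%C = fourier g (IZR j * / alpha)).
  { intros j. unfold g. rewrite fourier_shift by easy. f_equal. unfold char. f_equal. rewrite <- Ha2. field. lra. }
  destruct (zsum_abs_conv (fun j => char n j s * fourier f (IZR j / alpha)%R)%C b M) as (l & Hl & _); [|easy|].
  { intros k. rewrite Cmod_mult, Cmod_char, Rmult_1_l. apply Hb. }
  assert (El : l = (RtoC (/ / alpha) * zsum J (fun j => g (IZR j / / alpha)%R))%C).
  { apply (poisson g (/ alpha) (r + Rabs (IZR s / alpha))); [easy|now apply ccont_shift, Cc_ccont| | |now apply le_half_shift|].
    - intros x Hx. apply S. pose proof (Rabs_triang (x + IZR s / alpha) (- (IZR s / alpha))) as Q. rewrite Rabs_Ropp in Q.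
      replace (x + IZR s / alpha + - (IZR s / alpha)) with x in Q by ring. lra.
    - pose proof (Rabs_pos (IZR s / alpha)). lra.
    - revert Hl. apply (clim_eventually _ _ _ 0). intros N _. apply zsum_ext. intros k _. apply E. }
  rewrite El in Hl. replace (RtoC alpha * zsum J (fun k => f (IZR k * alpha + IZR s / alpha)%R))%C with (RtoC (/ / alpha) * zsum J (fun j => g (IZR j / / alpha)%R))%C; [exact Hl|].
  rewrite Rinv_inv. f_equal. apply zsum_ext. intros k _. unfold g. f_equal. field. lra.
Qed.

(** A single [J] must serve two lattices: the atoms with spacing 1/alpha, and the Poisson sums with
    spacing alpha. *)
Lemma lattice_span_nat alpha n r : 0 < alpha -> exists J, r <= INR J / alpha /\ forall s, (Z.abs s <= Z.of_nat n)%Z -> r + Rabs (IZR s / alpha) <= INR J / / alpha.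
Proof.
  intros Ha. assert (Hia : 0 < / alpha) by now apply Rinv_0_lt_compat.
  destruct (nat_above_div (Rabs r) alpha Ha) as [J1 H1]. destruct (nat_above_div (Rabs r + INR n / alpha) (/ alpha) Hia) as [J2 H2].
  pose proof (Rle_abs r). assert (0 < / / alpha) by now apply Rinv_0_lt_compat.
  exists (J1 + J2)%nat. rewrite plus_INR. pose proof (pos_INR J1). pose proof (pos_INR J2). split.
  - unfold Rdiv in *. nra.
  - intros s Hs. apply Rle_trans with (Rabs r + INR n / alpha).
    + apply Rplus_le_compat; [easy|]. unfold Rdiv. rewrite Rabs_mult, (Rabs_right (/ alpha)) by lra.
      apply Rmult_le_compat_r; [lra|]. rewrite <- abs_IZR, INR_IZR_INZ. now apply IZR_le.
    + unfold Rdiv in *. nra.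
Qed.

(* Poisson summation turns the eigenvector equation into the eigenvalue equation for the lattice sums. *)
Lemma lattice_fourier_sum n alpha w mu f b M e : (e = 1 \/ e = -1)%Z -> (0 < n)%nat -> alpha = sqrt (INR n) -> zperiodic n w -> lattice_measure alpha w mu ->
  Cc f -> (forall k, Cmod (fourier f (IZR k / alpha)) <= b k) -> (forall N, zrsum N b <= M) ->
  clim (fun N => zsum N (fun j => RtoC (/ alpha) * csum n (fun l => w (Z.of_nat l) * char n j (e * Z.of_nat l)) * fourier f (IZR j / alpha)%R)%C)
    (mu (fun x => f (IZR e * x))).
Proof.
  intros He Hn Ea P L Hf Hb HM. destruct (sqrt_INR_facts n alpha Hn Ea) as (Hn0 & Ha & Ha2).
  destruct (Cc_supp f Hf) as (r & Hr & S). destruct (lattice_span_nat alpha n r Ha) as (J & HJ1 & HJ2).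
  set (fe := fun x => f (IZR e * x)).
  assert (Hfe : Cc fe /\ supp r fe).
  { destruct He as [->| ->]; unfold fe.
    - replace (fun x => f (1 * x)) with f by (extensionality x; f_equal; ring). easy.
    - replace (fun x => f (-1 * x)) with (fun x => f (- x)) by (extensionality x; f_equal; ring). split; [now apply Cc_opp_arg|now apply supp_opp_arg]. }
  destruct Hfe as [Hfe Sfe].
  rewrite (L fe r J) by easy. rewrite <- (lattice_regroup n alpha w fe r J J) by (auto; lia).
  apply (clim_eventually (fun N => csum n (fun l => RtoC (/ alpha) * w (Z.of_nat l) * zsum N (fun j => char n j (e * Z.of_nat l) * fourier f (IZR j / alpha)%R)))%C _ _ 0).
  - intros N _. rewrite <- (csum_ext n (fun l => zsum N (fun j => RtoC (/ alpha) * w (Z.of_nat l) * (char n j (e * Z.of_nat l) * fourier f (IZR j / alpha)%R))%C)) by (intros; apply zsum_scal).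
    rewrite <- (zsum_csum N n (fun j l => RtoC (/ alpha) * w (Z.of_nat l) * (char n j (e * Z.of_nat l) * fourier f (IZR j / alpha)%R))%C).
    apply zsum_ext. intros j _. rewrite <- csum_scal, csum_mult_r. apply csum_ext. intros. ring.
  - apply (clim_csum n (fun N l => RtoC (/ alpha) * w (Z.of_nat l) * zsum N (fun j => char n j (e * Z.of_nat l) * fourier f (IZR j / alpha)%R))%C).
    intros l Hl. assert (Hs : (Z.abs (e * Z.of_nat l) <= Z.of_nat n)%Z) by (destruct He as [->| ->]; lia).
    pose proof (poisson_char n alpha f r J (e * Z.of_nat l) b M Hn Ea Hf S (Rlt_le _ _ Hr) (HJ2 _ Hs) Hb HM) as Q.
    apply (clim_scal (RtoC (/ alpha) * w (Z.of_nat l))%C) in Q.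
    match type of Q with clim _ ?x => match goal with |- clim _ ?y => replace y with x; [exact Q|] end end.
    transitivity (RtoC (/ alpha * alpha) * w (Z.of_nat l) * zsum J (fun k => f (IZR k * alpha + IZR (e * Z.of_nat l) / alpha)%R))%C; [rewrite RtoC_mult; ring|].
    rewrite Rinv_l, Cmult_1_l by lra. f_equal. unfold fe. destruct He as [->| ->].
    + apply zsum_ext. intros k _. f_equal. rewrite Z.mul_1_l, <- INR_IZR_INZ. ring.
    (* For e = -1 the points -(l/alpha + k alpha) match after k is replaced by -k. *)
    + rewrite <- zsum_opp. apply zsum_ext. intros k _. f_equal. rewrite mult_IZR, opp_IZR, <- INR_IZR_INZ. unfold Rdiv. ring.
Qed.

(** The candidate for the tempered extension has to be a total functional. [Lim_seq] and [real] give
    default values where the sums diverge; under decay 1/(1 + t^2) the sums converge and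
    [lattice_ext_lim] identifies the value. *)
Definition lattice_ext (alpha : R) (w : Z -> C) (F : R -> C) : C :=
  (real (Lim_seq (fun N => Re (zsum N (fun j => w j * F (IZR j / alpha)%R)%C))),
   real (Lim_seq (fun N => Im (zsum N (fun j => w j * F (IZR j / alpha)%R)%C)))).

Lemma lattice_ext_lim alpha w F l : clim (fun N => zsum N (fun j => w j * F (IZR j / alpha)%R)%C) l -> lattice_ext alpha w F = l.
Proof.
  intros H. unfold lattice_ext. rewrite (is_lim_seq_unique _ _ (clim_Re _ _ H)), (is_lim_seq_unique _ _ (clim_Im _ _ H)).
  symmetry. apply surjective_pairing.
Qed.

Definition lattice_ext_bound (alpha A : R) (w : Z -> C) : Prop :=
  forall F C0, 0 <= C0 -> (forall t, Cmod (F t) <= C0 / (1 + t ^ 2)) ->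
    clim (fun N => zsum N (fun j => w j * F (IZR j / alpha)%R)%C) (lattice_ext alpha w F) /\ Cmod (lattice_ext alpha w F) <= A * C0.

Lemma lattice_ext_decay alpha w W : 0 < alpha -> 0 <= W -> (forall j, Cmod (w j) <= W) ->
  exists A, 0 <= A /\ lattice_ext_bound alpha A w.
Proof.
  intros Ha HW Hw. assert (Hia : 0 < / alpha) by now apply Rinv_0_lt_compat.
  set (q := 1 + 2 / (/ alpha) ^ 2 + 2 * 0 ^ 2 / (/ alpha) ^ 2).
  assert (Hq : 0 <= q).
  { unfold q. assert (0 < 2 / (/ alpha) ^ 2) by (apply Rdiv_lt_0_compat; [lra|now apply pow_lt]). assert (2 * 0 ^ 2 / (/ alpha) ^ 2 = 0) by (unfold Rdiv; ring). lra. }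
  exists (W * (q * 5)). split; [apply Rmult_le_pos; [easy|lra]|].
  intros F C0 HC HF. destruct (decay_lattice_bound F C0 (/ alpha) 0 0 Hia HC ltac:(rewrite Rabs_R0; lra) HF) as [B1 B2]. fold q in B1, B2.
  destruct (zsum_abs_conv (fun j => w j * F (IZR j / alpha)%R)%C (fun k => W * (C0 * q * / (1 + IZR k ^ 2))) (W * (C0 * q * 5))) as (l & Hl & Bl).
  - intros k. rewrite Cmod_mult. apply Rmult_le_compat; try apply Cmod_ge_0; [apply Hw|]. specialize (B1 k).
    replace (0 + IZR k * / alpha) with (IZR k / alpha) in B1 by (unfold Rdiv; ring). exact B1.
  - intros N. rewrite zrsum_scal. apply Rmult_le_compat_l; [easy|apply B2].
  - rewrite (lattice_ext_lim _ _ _ _ Hl). split; [easy|]. eapply Rle_trans; [exact Bl|]. right. ring.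
Qed.

Lemma lattice_ext_add alpha A w f g a b : lattice_ext_bound alpha A w -> 0 <= a -> 0 <= b -> (forall t, Cmod (f t) <= a / (1 + t ^ 2)) -> (forall t, Cmod (g t) <= b / (1 + t ^ 2)) ->
  lattice_ext alpha w (fadd f g) = (lattice_ext alpha w f + lattice_ext alpha w g)%C.
Proof.
  intros HA Ha Hb Hf Hg. destruct (HA f a Ha Hf) as [L1 _]. destruct (HA g b Hb Hg) as [L2 _].
  apply lattice_ext_lim. pose proof (clim_plus _ _ _ _ L1 L2) as L. revert L. apply (clim_eventually _ _ _ 0).
  intros N _. rewrite <- zsum_plus. apply zsum_ext. intros. unfold fadd. ring.
Qed.

Lemma lattice_ext_scal alpha A w c f a : lattice_ext_bound alpha A w -> 0 <= a -> (forall t, Cmod (f t) <= a / (1 + t ^ 2)) ->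
  lattice_ext alpha w (fscal c f) = (c * lattice_ext alpha w f)%C.
Proof.
  intros HA Ha Hf. destruct (HA f a Ha Hf) as [L1 _].
  apply lattice_ext_lim. pose proof (clim_scal c _ _ L1) as L. revert L. apply (clim_eventually _ _ _ 0).
  intros N _. rewrite <- zsum_scal. apply zsum_ext. intros. unfold fscal. ring.
Qed.
Lemma lattice_ext_Cc alpha w mu f : 0 < alpha -> lattice_measure alpha w mu -> Cc f -> lattice_ext alpha w f = mu f.
Proof.
  intros Ha L Hf. destruct (Cc_supp f Hf) as (r & Hr & S). destruct (nat_above_div r alpha Ha) as [J HJ].
  apply lattice_ext_lim. rewrite (L f r J) by easy.
  apply (clim_eventually (fun _ => zsum J (fun j => w j * f (IZR j / alpha)%R)%C) _ _ J); [|apply clim_const].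
  intros N HN. symmetry. now apply (lattice_sum_stable alpha w f r).
Qed.

Lemma lattice_tempered alpha w W mu : 0 < alpha -> 0 <= W -> (forall j, Cmod (w j) <= W) -> lattice_measure alpha w mu ->
  tempered_extension mu (lattice_ext alpha w).
Proof.
  intros Ha HW Hw L. destruct (lattice_ext_decay alpha w W Ha HW Hw) as (A & HA0 & HA). split; [|split; [|split]].
  - intros f g Hf Hg. destruct (schwartz_decay f Hf) as (a & Ha0 & Da). destruct (schwartz_decay g Hg) as (b & Hb0 & Db).
    now apply (lattice_ext_add alpha A w f g a b).
  - intros c f Hf. destruct (schwartz_decay f Hf) as (a & Ha0 & Da). now apply (lattice_ext_scal alpha A w c f a).
  (* The undifferentiated seminorms with j = 0 and j = 2 add up to a bound for (1 + x^2) |f|. *)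
  - exists 2%nat, A. intros f B Hf HB.
    assert (BP : forall j l, (j <= 2)%nat -> (l <= 2)%nat -> 0 <= B j l).
    { intros j l Hj Hl. eapply Rle_trans; [|apply (HB j l 0 Hj Hl)]. apply Rmult_le_pos; [apply pow_le, Rabs_pos|apply Cmod_ge_0]. }
    assert (E0 : forall x, Dn f 0 x = f x) by (intros; unfold Dn; simpl; symmetry; apply surjective_pairing).
    pose proof (BP 0%nat 0%nat ltac:(lia) ltac:(lia)). pose proof (BP 2%nat 0%nat ltac:(lia) ltac:(lia)).
    assert (D : forall x, Cmod (f x) <= (B 0%nat 0%nat + B 2%nat 0%nat) / (1 + x ^ 2)).
    { intros x. pose proof (HB 0%nat 0%nat x ltac:(lia) ltac:(lia)) as H1. pose proof (HB 2%nat 0%nat x ltac:(lia) ltac:(lia)) as H2.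
      rewrite E0 in H1, H2. rewrite pow2_abs in H2. rewrite pow_O, Rmult_1_l in H1. pose proof (sqr1_pos x).
      apply (Rmult_le_reg_l (1 + x ^ 2)); [lra|]. replace ((1 + x ^ 2) * ((B 0%nat 0%nat + B 2%nat 0%nat) / (1 + x ^ 2))) with (B 0%nat 0%nat + B 2%nat 0%nat) by (field; lra). lra. }
    eapply Rle_trans; [apply (HA f (B 0%nat 0%nat + B 2%nat 0%nat) ltac:(lra) D)|]. apply Rmult_le_compat_l; [easy|].
    assert (G : forall j, (j <= 2)%nat -> B j 0%nat <= rsum 3 (fun l => B j l)) by (intros j Hj; apply (rsum_ge_term 3 (fun l => B j l)); [intros; apply BP; lia|lia]).
    assert (G1 : 0 <= rsum 3 (fun l => B 1%nat l)) by (apply rsum_ge_0; intros; apply BP; lia).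
    pose proof (G 0%nat ltac:(lia)). pose proof (G 2%nat ltac:(lia)).
    change (rsum 3 (fun j => rsum 3 (fun l => B j l))) with (0 + rsum 3 (fun l => B 0%nat l) + rsum 3 (fun l => B 1%nat l) + rsum 3 (fun l => B 2%nat l)). lra.
  - intros f Hf. apply lattice_ext_Cc; auto using test_Cc.
Qed.

(** * Schwartz functions and their transforms as limits of cutoffs *)

Lemma CI_tail_right g B a b : 0 < a -> a <= b -> 0 <= B -> ccont g -> (forall x, Cmod (g x) <= B / (1 + x ^ 2)) -> Cmod (CI g a b) <= B / a.
Proof.
  intros Ha Hab HB Hg H.
  assert (I : is_RInt (fun x => B / x ^ 2) a b (minus (- B / b) (- B / a))).
  { apply (is_RInt_derive (V := R_CompleteNormedModule) (fun x => - B / x) (fun x => B / x ^ 2)); rewrite Rmin_left, Rmax_right by lra; intros x Hx.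
    - auto_derive; [lra|]. field. lra.
    - apply (ex_derive_continuous (V := R_NormedModule)). auto_derive. assert (0 < x * (x * 1)) by nra. lra. }
  eapply Rle_trans; [apply (CI_bound g (fun x => B / x ^ 2) a b Hab Hg); [eexists; exact I|]|].
  - intros x Hx. eapply Rle_trans; [apply H|]. apply Rmult_le_compat_l; [easy|]. assert (0 < x ^ 2) by (apply pow_lt; lra). apply Rinv_le_contravar; lra.
  - rewrite (is_RInt_unique _ _ _ _ I). unfold minus, plus, opp; simpl.
    assert (0 <= B / b) by (apply Rmult_le_pos; [easy|left; apply Rinv_0_lt_compat; lra]). unfold Rdiv in *. lra.
Qed.

Lemma CI_tail_left g B a b : 0 < a -> a <= b -> 0 <= B -> ccont g -> (forall x, Cmod (g x) <= B / (1 + x ^ 2)) -> Cmod (CI g (- b) (- a)) <= B / a.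
Proof.
  intros Ha Hab HB Hg H.
  assert (E : CI g (- b) (- a) = CI (fun x => g (-1 * x + 0)) a b).
  { rewrite CI_lin by (auto; lra). replace (-1 * a + 0) with (- a) by ring. replace (-1 * b + 0) with (- b) by ring.
    assert (Sw : CI g (- a) (- b) = Copp (CI g (- b) (- a))).
    { symmetry. apply (opp_RInt_swap (V := C_R_CompleteNormedModule)). now apply ex_CI. }
    rewrite Sw. ceq; field. }
  rewrite E. apply CI_tail_right; auto; [now apply ccont_lin|].
  intros x. eapply Rle_trans; [apply H|]. right. f_equal. ring.
Qed.

Lemma CI_tails g B a b c : 0 < c -> a <= - c -> c <= b -> 0 <= B -> ccont g -> (forall x, Cmod (g x) <= B / (1 + x ^ 2)) ->
  Cmod (CI g a b - CI g (- c) c) <= 2 * (B / c).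
Proof.
  intros Hc H1 H2 HB Hg H. rewrite <- (CI_Chasles g a (- c) b), <- (CI_Chasles g (- c) c b) by easy.
  match goal with |- Cmod (?p + (?q + ?r) - ?q)%C <= _ => replace (p + (q + r) - q)%C with (p + r)%C by ring end.
  eapply Rle_trans; [apply Cmod_triangle|]. replace a with (- - a) by ring.
  pose proof (CI_tail_left g B c (- a) Hc ltac:(lra) HB Hg H). pose proof (CI_tail_right g B c b Hc ltac:(lra) HB Hg H). lra.
Qed.

(** The improper integral is a filter limit in both end points, so its existence has to be proved:
    the limit along symmetric intervals is found first, and the tails show that all large intervals
    approach it. *)
Lemma integral_lim g B : 0 <= B -> ccont g -> (forall x, Cmod (g x) <= B / (1 + x ^ 2)) ->
  clim (fun n => CI g (- INR (S n)) (INR (S n))) (integral g) /\ forall c, 0 < c -> Cmod (integral g - CI g (- c) c) <= 2 * (B / c).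
Proof.
  intros HB Hg H.
  assert (P : forall n, 0 < INR (S n)) by (intros; apply lt_0_INR; lia).
  destruct (clim_cauchy (fun n => CI g (- INR (S n)) (INR (S n))) (fun n => 2 * (B / INR (S n)))) as (l & Hl & _).
  - replace (Finite 0) with (Rbar_mult 2 (B * 0)) by (simpl; f_equal; ring). apply is_lim_seq_scal_l.
    apply (is_lim_seq_scal_l (fun n => / INR (S n)) B 0). apply (is_lim_seq_incr_1 (fun n => / INR n)).
    apply (is_lim_seq_inv INR p_infty); [apply is_lim_seq_INR|easy].
  - intros n m Hnm. assert (INR (S n) <= INR (S m)) by (apply le_INR; lia).
    apply (CI_tails g B); auto; lra.
  - assert (T : forall c a b, 0 < c -> a <= - c -> c <= b -> Cmod (CI g a b - CI g (- c) c) <= 2 * (B / c)).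
    { intros c a b Hc Ha Hb. now apply (CI_tails g B). }
    assert (TL : forall c, 0 < c -> Cmod (l - CI g (- c) c) <= 2 * (B / c)).
    { intros c Hc. apply le_epsilon. intros e He. destruct (Hl e He) as [N HN]. destruct (nat_above c) as [m Hm].
      specialize (HN (N + m)%nat ltac:(lia)). specialize (T c (- INR (S (N + m))) (INR (S (N + m))) Hc).
      assert (c <= INR (S (N + m))) by (eapply Rle_trans; [exact Hm|apply le_INR; lia]). specialize (T ltac:(lra) ltac:(lra)).
      set (u := CI g (- INR (S (N + m))) (INR (S (N + m)))) in *.
      replace (l - CI g (- c) c)%C with ((u - CI g (- c) c) - (u - l))%C by ring.
      eapply Rle_trans; [apply Cmod_triangle|]. rewrite Cmod_opp. lra. }
    assert (E : integral g = l).
    { unfold integral. apply (is_RInt_gen_unique (V := C_R_CompleteNormedModule)).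
      intros Q [eps HQ]. unfold filtermapi.
      (* Two tail estimates of 2 B/c each must stay below [eps]; the summand 1 makes this strict and
         keeps [c] positive. *)
      set (c := 4 * B / eps + 1). assert (He := cond_pos eps).
      assert (Hc0 : 0 <= 4 * B / eps) by (apply Rmult_le_pos; [lra|left; now apply Rinv_0_lt_compat]).
      assert (Hc : 0 < c) by (unfold c; lra).
      exists (fun a => a < - c) (fun b => c < b).
      - exists (- c). auto.
      - exists c. auto.
      - intros a b Ha Hb. exists (CI g a b). split.
        + apply (RInt_correct (V := C_R_CompleteNormedModule)). now apply ex_CI.
        + apply HQ. apply C_NormedModule_mixin_compat1.
          change (Cmod (CI g a b - l)%C < eps).
          replace (CI g a b - l)%C with ((CI g a b - CI g (- c) c) - (l - CI g (- c) c))%C by ring.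
          eapply Rle_lt_trans; [apply Cmod_triangle|]. rewrite Cmod_opp.
          specialize (T c a b Hc ltac:(lra) ltac:(lra)). specialize (TL c Hc).
          apply Rle_lt_trans with (4 * (B / c)); [lra|].
          apply (Rmult_lt_reg_r c); [easy|]. replace (4 * (B / c) * c) with (4 * B) by (field; lra).
          unfold c. replace (eps * (4 * B / eps + 1)) with (4 * B + eps) by (field; lra). lra. }
    rewrite E. split; [easy|]. exact TL.
Qed.

Definition schwartz_cut (f : R -> C) (r : nat) (x : R) : C := (RtoC (chi (INR r) x) * f x)%C.

Lemma schwartz_cut_test f r : schwartz f -> test_fun (schwartz_cut f r).
Proof. intros [H _]. now apply chi_mult_test. Qed.

Lemma dec_Dc2 g w : dec 2 g w -> forall x, Cmod (Dc (Dc g) x) <= w x.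
Proof.
  intros H x. destruct (dec_Dn 2 g w H 2 x (Nat.le_refl _)) as (_ & _ & B).
  replace (Dc (Dc g) x) with (Dn g 2 x); [easy|]. rewrite <- !Dn_Dc. unfold Dn; simpl. symmetry. apply surjective_pairing.
Qed.

(** By [fourier_Dc2], multiplying the transform by 1 + y^2 adds a multiple of the second derivative
    with factor at most 1 in modulus. That doubles c, and [fourier_bound_decay] contributes 4. *)
Lemma fourier_decay_of_dec2 g c y : test_fun g -> 0 <= c -> dec 2 g (fun x => c / (1 + x ^ 2)) -> Cmod (fourier g y) <= 8 * c / (1 + y ^ 2).
Proof.
  intros Tg Hc D. destruct (test_Dc g Tg) as [T1 _]. destruct (test_Dc _ T1) as [T2 _].
  set (k := RtoC (- / (4 * PI ^ 2))).
  assert (Hk : Cmod k <= 1).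
  { unfold k. rewrite Cmod_R, Rabs_Ropp. pose proof PI_RGT_0. pose proof PI2_1. assert (Hp : 2 < PI) by (unfold PI2 in *; lra).
    assert (1 <= 4 * PI ^ 2) by nra. rewrite Rabs_right by (left; apply Rinv_0_lt_compat; lra).
    rewrite <- Rinv_1. apply Rinv_le_contravar; lra. }
  pose proof (fourier_bound_decay (fadd g (fscal k (Dc (Dc g)))) (2 * c) y) as F.
  unfold k in F. rewrite fourier_Dc2 in F by easy. fold k in F.
  rewrite Cmod_mult, Cmod_R, Rabs_right in F by (pose proof (sqr1_pos y); lra).
  pose proof (sqr1_pos y). apply (Rmult_le_reg_l (1 + y ^ 2)); [lra|].
  replace ((1 + y ^ 2) * (8 * c / (1 + y ^ 2))) with (4 * (2 * c)) by (field; lra).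
  apply F; [auto using Cc_fadd, Cc_fscal, test_Cc|lra|].
  intros x. eapply Rle_trans; [apply Cmod_triangle|]. unfold fscal. rewrite Cmod_mult.
  pose proof (dec_bound _ _ _ x D) as B1. pose proof (dec_Dc2 _ _ D x) as B2. cbv beta in B1, B2.
  pose proof (Cmod_ge_0 (Dc (Dc g) x)). pose proof (Cmod_ge_0 k).
  assert (Cmod k * Cmod (Dc (Dc g) x) <= 1 * (c / (1 + x ^ 2))) by (apply Rmult_le_compat; auto). unfold Rdiv in *. lra.
Qed.

(** Of two powers of decay, one becomes 1/(1 + r^2) beyond the cutoff and one is kept in x. Two
    derivatives are controlled so that the transform decays as well. *)
Lemma schwartz_cut_error f : schwartz f -> exists c, 0 <= c /\ forall r : nat,
  dec 2 (fun x => (1 - RtoC (chi (INR r) x)) * f x)%C (fun x => c / (1 + INR r ^ 2) / (1 + x ^ 2)).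
Proof.
  intros H. destruct (chi_compl_dec 2) as (M & HM & DM). destruct (dec_of_schwartz f H 2 2) as (B & HB & DB).
  exists (4 * (M * B)). split; [nra|]. intros r.
  eapply dec_weaken; [|apply (dec_mult 2 _ f _ _ (DM (INR r)) DB)]. intros x. cbv beta.
  pose proof (chi_compl_decay (INR r) B M x HB ltac:(lra) (pos_INR r)) as Q. pose proof (sqr1_pos x). pose proof (sqr1_pos (INR r)).
  set (m := if Rlt_dec (Rabs x) (INR r) then 0 else M) in *.
  replace (2 ^ 2 * (m * (B / (1 + x ^ 2) ^ 2))) with (4 * (m * (B / (1 + x ^ 2))) * / (1 + x ^ 2)) by (field; lra).
  apply Rmult_le_compat_r; [left; apply Rinv_0_lt_compat; lra|]. unfold Rdiv in *. lra.
Qed.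

Lemma fourier_cut_lim f y : schwartz f -> clim (fun r => fourier (schwartz_cut f r) y) (fourier f y).
Proof.
  intros H. destruct (schwartz_decay f H) as (B & HB & D). destruct (schwartz_cut_error f H) as (c & Hc & DC).
  assert (Cf : ccont f) by apply smooth_ccont, H.
  set (E := fun x => cexpi (- 2 * PI * x * y)). assert (CE : ccont E) by apply ccont_kernel.
  assert (Cg : ccont (fun x => f x * E x)%C) by now apply ccont_mult.
  assert (Dg : forall x, Cmod (f x * E x) <= B / (1 + x ^ 2)) by (intros x; unfold E; rewrite Cmod_mult, Cmod_cexpi, Rmult_1_r; apply D).
  destruct (integral_lim _ B HB Cg Dg) as [_ T]. fold E in T. change (integral (fun x => f x * E x)%C) with (fourier f y) in T.
  (* The first term is the tail of the integral beyond r + 2, where [chi] vanishes; the second is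
     the cutoff error inside, integrated against its weight. *)
  apply clim_diff. apply (clim_0_of_bound _ (fun r => 2 * (B / INR (r + 2)) + 4 * c / (1 + INR r ^ 2))).
  - intros r. assert (Hr : 0 < INR (r + 2)) by (apply lt_0_INR; lia).
    assert (Tc := schwartz_cut_test f r H).
    rewrite (fourier_CI (schwartz_cut f r) (INR (r + 2))); [|now apply Cc_ccont, test_Cc| |lra].
    2:{ intros x Hx. unfold schwartz_cut. rewrite plus_INR in Hx. simpl (INR 2) in Hx. rewrite chi_out by lra. ring. }
    fold E. specialize (T _ Hr). set (u := CI (fun x => f x * E x)%C (- INR (r + 2)) (INR (r + 2))) in *.
    assert (Q : Cmod (CI (fun x => schwartz_cut f r x * E x)%C (- INR (r + 2)) (INR (r + 2)) - u)%C <= 4 * (c / (1 + INR r ^ 2))).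
    { assert (CC : ccont (fun x => schwartz_cut f r x * E x)%C) by (apply ccont_mult; [now apply Cc_ccont, test_Cc|easy]).
      set (v := CI (fun x => schwartz_cut f r x * E x)%C _ _).
      replace (v - u)%C with (v + (-1) * u)%C by ring. unfold u, v. rewrite <- CI_scal by easy.
      rewrite <- CI_plus; [|easy|apply (ccont_mult (fun _ => RtoC (-1))); [apply ccont_const|easy]].
      assert (0 <= c / (1 + INR r ^ 2)) by (apply Rmult_le_pos; [easy|left; apply Rinv_0_lt_compat; pose proof (sqr1_pos (INR r)); lra]).
      apply CI_bound_decay; [lra|easy| |].
      - apply ccont_plus; [easy|]. apply (ccont_mult (fun _ => RtoC (-1))); [apply ccont_const|easy].
      - intros x _. replace (schwartz_cut f r x * E x + -1 * (f x * E x))%C with (- (((1 - RtoC (chi (INR r) x)) * f x) * E x))%C by (unfold schwartz_cut; ring).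
        rewrite Cmod_opp, Cmod_mult. unfold E. rewrite Cmod_cexpi, Rmult_1_r. apply (dec_bound _ _ _ x (DC r)). }
    match goal with |- Cmod (?z - ?w)%C <= _ => replace (z - w)%C with ((z - u) - (w - u))%C by ring end.
    eapply Rle_trans; [apply Cmod_triangle|]. rewrite Cmod_opp. eapply Rle_trans; [apply Rplus_le_compat; [exact Q|exact T]|]. right; unfold Rdiv; ring.
  - replace (Finite 0) with (Finite (2 * (B * 0) + 0)) by (f_equal; ring). apply is_lim_seq_plus'; [|apply is_lim_seq_inv_sqr].
    apply (is_lim_seq_scal_l (fun r => B / INR (r + 2)) 2 (B * 0)). apply (is_lim_seq_scal_l (fun r => / INR (r + 2)) B 0).
    apply (is_lim_seq_incr_n (fun n => / INR n) 2). apply (is_lim_seq_inv INR p_infty); [apply is_lim_seq_INR|easy].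
Qed.

(** The difference of [f] and its cut need not have compact support. The cuts at r and r + R0 differ
    by a test function, to which the decay bound applies uniformly in R0, and R0 then tends to
    infinity. *)
Lemma fourier_cut_error f : schwartz f -> exists c, 0 <= c /\ forall r : nat,
  (forall x, Cmod (f x - schwartz_cut f r x) <= c / (1 + INR r ^ 2) / (1 + x ^ 2)) /\
  (forall y, Cmod (fourier f y - fourier (schwartz_cut f r) y) <= c / (1 + INR r ^ 2) / (1 + y ^ 2)).
Proof.
  (* The difference of two cuts collects two errors, each multiplied by the 8 of
     [fourier_decay_of_dec2]. *)
  intros H. destruct (schwartz_cut_error f H) as (c & Hc & DC). exists (16 * c). split; [lra|]. intros r.
  assert (Pos : forall s : nat, 0 < / (1 + INR s ^ 2)) by (intros s; apply Rinv_0_lt_compat; pose proof (sqr1_pos (INR s)); lra).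
  set (e := c / (1 + INR r ^ 2)). assert (He : 0 <= e) by (apply Rmult_le_pos; [easy|left; apply Pos]).
  replace (16 * c / (1 + INR r ^ 2)) with (16 * e) by (unfold e, Rdiv; ring). split.
  - intros x. replace (f x - schwartz_cut f r x)%C with ((1 - RtoC (chi (INR r) x)) * f x)%C by (unfold schwartz_cut; ring).
    eapply Rle_trans; [apply (dec_bound _ _ _ x (DC r))|]. fold e. apply Rmult_le_compat_r; [left; apply Rinv_0_lt_compat; pose proof (sqr1_pos x); lra|lra].
  - intros y. apply (clim_bound (fun R0 => fourier (schwartz_cut f (r + R0)) y - fourier (schwartz_cut f r) y)%C).
    + intros R0. set (g := fadd (schwartz_cut f (r + R0)) (fscal (-1) (schwartz_cut f r))).
      assert (Tg : test_fun g) by (apply test_fadd; [|apply test_fscal]; now apply schwartz_cut_test).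
      replace (fourier (schwartz_cut f (r + R0)) y - fourier (schwartz_cut f r) y)%C with (fourier g y).
      2:{ assert (Cc1 := test_Cc _ (schwartz_cut_test f (r + R0) H)). assert (Cc2 := test_Cc _ (schwartz_cut_test f r H)).
          unfold g. rewrite (fourier_fadd _ _ Cc1 (Cc_fscal (-1) _ Cc2)), (fourier_fscal (-1) _ Cc2). unfold fadd, fscal. ring. }
      replace (16 * e / (1 + y ^ 2)) with (8 * (2 * e) / (1 + y ^ 2)) by (unfold Rdiv; ring).
      apply fourier_decay_of_dec2; [easy|lra|].
      apply (dec_ext _ (fun x => (1 - RtoC (chi (INR r) x)) * f x + (-1) * ((1 - RtoC (chi (INR (r + R0)) x)) * f x))%C).
      { intros x. unfold g, fadd, fscal, schwartz_cut. ring. }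
      eapply dec_weaken; [|apply dec_plus; [apply (DC r)|apply dec_scal, (DC (r + R0)%nat)]].
      intros x. cbv beta. fold e. rewrite Cmod_R, Rabs_left by lra.
      assert (c / (1 + INR (r + R0) ^ 2) <= e).
      { apply Rmult_le_compat_l; [easy|]. apply Rinv_le_contravar; [pose proof (sqr1_pos (INR r)); lra|].
        assert (INR r ^ 2 <= INR (r + R0) ^ 2) by (apply pow_incr; split; [apply pos_INR|apply le_INR; lia]). lra. }
      assert (0 < / (1 + x ^ 2)) by (apply Rinv_0_lt_compat; pose proof (sqr1_pos x); lra). unfold Rdiv in *. nra.
    + apply (clim_plus _ (fun _ => - fourier (schwartz_cut f r) y)%C); [|apply clim_const].
      pose proof (fourier_cut_lim f y H) as L. intros eps Heps. destruct (L eps Heps) as [N HN]. exists N. intros n Hn. apply HN. lia.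
Qed.

Lemma lattice_eigen_eigenmeasure alpha mu lam : is_measure mu -> nontrivial mu -> lattice_eigen alpha mu lam -> eigenmeasure mu lam.
Proof.
  intros Hm Nt (n & w & Hn & Ea & P & L & E). destruct (sqrt_INR_facts n alpha Hn Ea) as (Hn0 & Ha & Ha2).
  destruct (zperiodic_bounded n w Hn P) as (W & HW & BW). split; [easy|]. split; [easy|].
  exists (lattice_ext alpha w). split; [now apply (lattice_tempered alpha w W)|].
  destruct (lattice_ext_decay alpha w W Ha HW BW) as (A & HA0 & HA).
  assert (Dual := lattice_eigen_dual alpha n w lam Hn Ea P E).
  (* On test functions the claim is Poisson summation combined with the dual form of the eigenvector
     equation. *)
  assert (Tst : forall f, test_fun f -> lattice_ext alpha w (fourier f) = (lam * mu f)%C).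
  { intros f Tf. destruct (fourier_test_decay2 f Tf) as (B & HB & D).
    assert (Hia : 0 < / alpha) by now apply Rinv_0_lt_compat.
    destruct (decay_lattice_bound (fourier f) B (/ alpha) 0 0 Hia HB ltac:(rewrite Rabs_R0; lra) D) as [B1 B2].
    assert (B1' : forall k, Cmod (fourier f (IZR k / alpha)) <= B * (1 + 2 / (/ alpha) ^ 2 + 2 * 0 ^ 2 / (/ alpha) ^ 2) * / (1 + IZR k ^ 2)).
    { intros k. replace (IZR k / alpha) with (0 + IZR k * / alpha) by (unfold Rdiv; ring). apply B1. }
    pose proof (lattice_fourier_sum n alpha w mu f _ _ 1 (or_introl eq_refl) Hn Ea P L (test_Cc f Tf) B1' B2) as Q.
    apply (clim_scal lam) in Q. replace (fun x => f (1 * x)) with f in Q by (extensionality x; f_equal; ring).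
    apply lattice_ext_lim. revert Q. apply (clim_eventually _ _ _ 0). intros N _. rewrite <- zsum_scal. apply zsum_ext. intros j _.
    rewrite (Dual j). rewrite (csum_ext n (fun l => w (Z.of_nat l) * char n j (1 * Z.of_nat l))%C (fun l => w (Z.of_nat l) * char n j (Z.of_nat l))%C) by (intros; now rewrite Z.mul_1_l). ring. }
  intros f Hf. destruct (fourier_cut_error f Hf) as (c & Hc & CE). destruct (schwartz_decay f Hf) as (B & HB & D).
  set (z := (lattice_ext alpha w (fourier f) - lam * lattice_ext alpha w f)%C).
  assert (Z : z = RtoC 0).
  (* [z] does not depend on [r], while each cut bounds it by the errors [d] and [dh]. Both are
     O(1/(1 + r^2)) in the weighted norm that controls [lattice_ext]. *)
  { apply (clim_unique (fun _ => z)); [apply clim_const|].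
    apply (clim_0_of_bound _ (fun r => (A * c + Cmod lam * (A * c)) / (1 + INR r ^ 2))); [|apply is_lim_seq_inv_sqr].
    intros r. destruct (CE r) as [C1 C2]. set (e := c / (1 + INR r ^ 2)) in *.
    assert (He : 0 <= e) by (apply Rmult_le_pos; [easy|left; apply Rinv_0_lt_compat; pose proof (sqr1_pos (INR r)); lra]).
    set (fr := schwartz_cut f r) in *. assert (Tr : test_fun fr) by now apply schwartz_cut_test.
    destruct (schwartz_decay fr (test_schwartz fr Tr)) as (Br & HBr & Dr).
    destruct (fourier_test_decay2 fr Tr) as (Bf & HBf & Df).
    set (d := fun x => (f x - fr x)%C). set (dh := fun y => (fourier f y - fourier fr y)%C).
    assert (Ef : lattice_ext alpha w f = (lattice_ext alpha w d + lattice_ext alpha w fr)%C).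
    { rewrite <- (lattice_ext_add alpha A w d fr e Br) by auto. f_equal. extensionality x. unfold fadd, d. ring. }
    assert (Eh : lattice_ext alpha w (fourier f) = (lattice_ext alpha w dh + lattice_ext alpha w (fourier fr))%C).
    { rewrite <- (lattice_ext_add alpha A w dh (fourier fr) e Bf) by auto. f_equal. extensionality x. unfold fadd, dh. ring. }
    unfold z. rewrite Ef, Eh, Tst, (lattice_ext_Cc alpha w mu fr) by (auto using test_Cc).
    replace (lattice_ext alpha w dh + lam * mu fr - lam * (lattice_ext alpha w d + mu fr))%C with (lattice_ext alpha w dh - lam * lattice_ext alpha w d)%C by ring.
    eapply Rle_trans; [apply Cmod_triangle|]. rewrite Cmod_opp, Cmod_mult.
    destruct (HA d e He C1) as [_ Q1]. destruct (HA dh e He C2) as [_ Q2].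
    pose proof (Cmod_ge_0 lam). apply Rle_trans with (A * e + Cmod lam * (A * e)); [|right; unfold e, Rdiv; ring].
    apply Rplus_le_compat; [easy|]. now apply Rmult_le_compat_l. }
  transitivity (z + lam * lattice_ext alpha w f)%C; [unfold z; ring|]. rewrite Z. ring.
Qed.

Lemma zrsum_opp N b : zrsum N (fun k => b (- k)%Z) = zrsum N b.
Proof. induction N; [now rewrite !zrsum_0|]. rewrite !zrsum_S, IHN, Z.opp_involutive. ring. Qed.

Lemma span_conv_Cc f : in_span_conv f -> Cc f.
Proof.
  intros (n & a & g & h & H & E). replace f with (fun x => csum n (fun i => a i * conv (g i) (h i) x)%C) by (extensionality x; now rewrite E).
  apply (Cc_csum n (fun i x => a i * conv (g i) (h i) x)%C). intros i _. apply (Cc_fscal (a i) (conv (g i) (h i))). apply Cc_conv; apply H.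
Qed.

(** A product of transforms is at most the sum of their squares in modulus, and [bessel] sums the
    squares. This replaces pointwise decay when the factors are merely continuous. *)
Lemma span_conv_fourier_summable f a0 : 0 < a0 -> in_span_conv f ->
  exists b M, (forall k, Cmod (fourier f (IZR k * a0)) <= b k) /\ forall N, zrsum N b <= M.
Proof.
  intros Ha (n & a & g & h & H & E).
  assert (Ef : f = (fun x => csum n (fun i => fscal (a i) (conv (g i) (h i)) x))) by (extensionality x; now rewrite E).
  assert (HC : forall i, Cc (fscal (a i) (conv (g i) (h i)))) by (intros; apply Cc_fscal, Cc_conv; apply H).
  set (p := fun i (k : Z) => Cmod (fourier (g i) (IZR k * a0)) ^ 2 + Cmod (fourier (h i) (IZR k * a0)) ^ 2).
  set (b := fun k => rsum n (fun i => Cmod (a i) * p i k)).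
  assert (BM : exists M, forall N, zrsum N b <= M).
  { unfold b. clear E Ef. induction n.
    - exists 0. intros N. simpl. unfold zrsum. rewrite rsum_const. lra.
    - destruct IHn as [M HM]. destruct (bessel (g n) a0 Ha (proj1 (H n))) as (M1 & _ & H1). destruct (bessel (h n) a0 Ha (proj2 (H n))) as (M2 & _ & H2).
      exists (M + Cmod (a n) * (M1 + M2)). intros N. cbn [rsum]. rewrite zrsum_plus, zrsum_scal. apply Rplus_le_compat; [apply HM|].
      apply Rmult_le_compat_l; [apply Cmod_ge_0|]. unfold p. rewrite zrsum_plus. apply Rplus_le_compat; [apply H1|apply H2]. }
  destruct BM as [M HM]. exists b, M. split; [|easy].
  intros k. rewrite Ef, (fourier_csum n (fun i => fscal (a i) (conv (g i) (h i)))) by auto. apply csum_bound. intros i _.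
  destruct (H i) as [Hg Hh]. rewrite fourier_fscal by now apply Cc_conv. unfold fscal. rewrite fourier_conv, !Cmod_mult by easy.
  apply Rmult_le_compat_l; [apply Cmod_ge_0|]. unfold p. set (u := Cmod _). set (v := Cmod _).
  pose proof (pow2_ge_0 (u - v)). pose proof (pow2_ge_0 (u + v)). nra.
Qed.

Lemma lattice_eigen_strict alpha mu lam : is_measure mu -> nontrivial mu -> lattice_eigen alpha mu lam -> strict_eigenmeasure mu lam.
Proof.
  intros Hm Nt (n & w & Hn & Ea & P & L & E). destruct (sqrt_INR_facts n alpha Hn Ea) as (Hn0 & Ha & Ha2).
  destruct (zperiodic_bounded n w Hn P) as (W & HW & BW). assert (Hia : 0 < / alpha) by now apply Rinv_0_lt_compat.
  split; [easy|]. split; [easy|]. split; [exists (lattice_ext alpha w); now apply (lattice_tempered alpha w W)|].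
  exists (fun g => lam * mu g)%C. split; [|easy]. split; [now apply is_measure_scal|].
  intros f Sf. assert (Hf := span_conv_Cc f Sf). destruct (span_conv_fourier_summable f (/ alpha) Hia Sf) as (b0 & M & B0 & HM0).
  set (fr := fun x => f (- x)). assert (Hfr : Cc fr) by now apply Cc_opp_arg.
  set (F := fcheck f). assert (CF : ccont F) by now apply ccont_fcheck.
  assert (EF : F = fourier fr) by now apply fcheck_fourier.
  (* [fcheck] evaluates the transform at the opposite point, so the majorant is reflected as
     well. *)
  set (b := fun k => b0 (- k)%Z).
  assert (HM : forall N, zrsum N b <= M) by (intros N; unfold b; rewrite zrsum_opp; apply HM0).
  assert (Bb : forall k, Cmod (F (IZR k / alpha)) <= b k).
  { intros k. unfold F, fcheck, b. replace (- (IZR k / alpha)) with (IZR (- k) * / alpha) by (rewrite opp_IZR; unfold Rdiv; ring). apply B0. }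
  assert (Bw : forall k, Cmod (w k * F (IZR k / alpha)%R) <= W * b k).
  { intros k. rewrite Cmod_mult. apply Rmult_le_compat; try apply Cmod_ge_0; auto. }
  assert (HMw : forall N, zrsum N (fun k => W * b k) <= W * M) by (intros; rewrite zrsum_scal; now apply Rmult_le_compat_l).
  destruct (zsum_abs_conv _ _ _ Bw HMw) as (l & Hl & _).
  (* Here the transform is that of the reflected function; with e = -1 the lattice formula returns
     [mu f] and carries the kernel of the eigenvector equation. *)
  assert (El : (lam * l)%C = mu f).
  { apply (clim_scal lam) in Hl. apply (clim_unique _ _ _ Hl).
    assert (Bb' : forall k, Cmod (fourier fr (IZR k / alpha)) <= b k) by (rewrite <- EF; exact Bb).
    pose proof (lattice_fourier_sum n alpha w mu fr b M (-1) (or_intror eq_refl) Hn Ea P L Hfr Bb' HM) as Q.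
    replace (fun x => fr (-1 * x)) with f in Q by (extensionality x; unfold fr; f_equal; ring).
    revert Q. apply (clim_eventually _ _ _ 0). intros N _. rewrite <- zsum_scal. apply zsum_ext. intros j _.
    rewrite Cmult_assoc, E, EF. reflexivity. }
  split.
  (* Every competitor [h] is dominated by |F| at the atoms, so one summable majorant bounds the
     upper integral. *)
  - split; [exact CF|]. exists (Cmod lam * (W * M)). intros h Hh Bh. rewrite Cmod_mult. apply Rmult_le_compat_l; [apply Cmod_ge_0|].
    destruct (Cc_supp h Hh) as (r & Hr & S). destruct (nat_above_div r alpha Ha) as [J HJ]. rewrite (L h r J) by easy.
    eapply Rle_trans; [|apply (HMw J)]. apply zsum_bound. intros k _. rewrite Cmod_mult.
    apply Rmult_le_compat; try apply Cmod_ge_0; auto. eapply Rle_trans; [apply Bh|apply Bb].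
  - apply clim_filterlim. rewrite <- El. apply clim_scal.
    apply (zsum_cutoff_lim (fun k => w k * F (IZR k / alpha)%R)%C (fun k => W * b k) (W * M) l (fun r k => cutoff (INR r) (IZR k / alpha)) _ (/ alpha)); auto.
    + intros; apply cutoff_range.
    + intros r k Hk. apply cutoff_in. unfold Rdiv. rewrite Rabs_mult, (Rabs_right (/ alpha)), <- abs_IZR by lra. easy.
    + intros r. destruct (nat_above_div (INR r + 1) alpha Ha) as [J HJ]. exists J. intros N HN.
      rewrite (L _ (INR r + 1) N).
      * apply zsum_ext. intros k _. ring.
      * now apply Cc_cutoff_mult.
      * intros x Hx. rewrite cutoff_out by lra. ring.
      * eapply Rle_trans; [exact HJ|]. apply Rmult_le_compat_r; [lra|]. now apply le_INR.
Qed.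

Theorem theorem4p2 (alpha : R) (lam : C) (mu : (R -> C) -> C) :
  0 < alpha ->
  Cpow lam 4 = RtoC 1 ->
  is_measure mu ->
  nontrivial mu ->
  periodic alpha mu ->
  (eigenmeasure mu lam <-> strict_eigenmeasure mu lam) /\
  (strict_eigenmeasure mu lam <-> comb_form alpha mu lam).
Proof.
  intros Ha Hl Hm Nt Per.
  assert (S2L := strict_eigenmeasure_lattice alpha mu lam Ha Per).
  assert (L2S := lattice_eigen_strict alpha mu lam Hm Nt).
  split; split; intros H.
  - now apply L2S, eigenmeasure_lattice.
  - now apply (lattice_eigen_eigenmeasure alpha), S2L.
  - now apply lattice_eigen_comb, S2L.
  - now apply L2S, comb_lattice_eigen.
Qed.
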